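(* Let $\eta=\frac{dx\wedge dy}{xy}$ on $\mathbf{P}^2$ and let $f:\mathbf{P}^2\dashrightarrow\mathbf{P}^2$ be a rational map preserving $\eta$. Then $f$ induces a (well-defined) map $f_\sharp:\mathcal{P}_{polar}\to\mathcal{P}_{polar}$, and, under the identification of $\mathcal{P}_{polar}$ with the set of rational rays in $\mathbf{R}^2$, $f_\sharp$ corresponds to a piecewise linear map $T_f:\mathbf{R}^2\to\mathbf{R}^2$ (that is, if $C\in\mathcal{P}_{polar}$ corresponds to the ray $\tau$, then $f_\sharp C$ corresponds to the ray $T_f(\tau)$) such that $T_f(\mathbf{Z}^2)\subset\mathbf{Z}^2$ and $T_f$ restricts to a finite covering $\mathbf{R}^2\setminus\{\mathbf{0}\}\to\mathbf{R}^2\setminus\{\mathbf{0}\}$.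
   Context: All surfaces are smooth complex projective. $f$ preserves $\eta$ if $f^*\eta=\delta\eta$ for some $\delta\in\mathbf{C}^*$. A modification is a composition of finitely many point blowups; a modification $\pi_X:X\to\mathbf{P}^2$ is an elaboration of $\eta$ if $\eta_X:=\pi_X^*\eta$ has no zeros. Irreducible curves $C_X\subset X$, $C_Y\subset Y$ in two elaborations are equivalent if they have the same strict transform in a common further elaboration $Z\to X,Y$. An equivalence class $C$ is an $\eta$-prime; if it has a representative curve $C_X\subset X$ then $C$ appears in $X$, and $C_X$ is its incarnation in $X$. $\mathcal{P}_{polar}$ is the set of $\eta$-primes $C$ whose incarnations $C_X$ are poles of $\eta_X$ (this does not depend on the incarnation). Identification with rational rays: a rational ray is $\mathbf{R}_+u$ with $u=(a,b)\in\mathbf{Z}^2\setminus\{\mathbf{0}\}$, where we may take $a,b$ relatively prime. $C\in\mathcal{P}_{polar}$ corresponds to $\mathbf{R}_+u$ if, in a toric modification $\pi_X:X\to\mathbf{P}^2$ (a composition of blowups at torus-fixed points, so that $X$ is a toric surface containing $(\mathbf{C}^* )^2$) in which $C$ appears, $\lim_{z\to 0}(\alpha z^a,\beta z^b)$ lies in $C_X$ and in no other irreducible component of $X\setminus(\mathbf{C}^* )^2$, for all $(\alpha,\beta)\in(\mathbf{C}^* )^2$. This gives a bijection between $\mathcal{P}_{polar}$ and rational rays. Definition of $f_\sharp$: for elaborations $\pi_X,\pi_Y$ of $\eta$ put $f_{XY}=\pi_Y^{-1}\circ f\circ\pi_X:X\dashrightarrow Y$. Given an $\eta$-prime $C$,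 choose elaborations $X,Y$ such that $C$ appears in $X$ and $f_{XY}$ does not contract $C_X$; then $f_\sharp C$ is the $\eta$-prime incarnated by the curve $f_{XY}(C_X)=\overline{f_{XY}(C_X\setminus I(f_{XY}))}$. Piecewise linear means: continuous, and linear on each of finitely many closed cones with vertex $\mathbf{0}$ that together cover $\mathbf{R}^2$. *)

(* Defs.v *)
(* Surfaces birational to P^2 are modelled inside the function field
   K = C(x,y) of P^2: a closed point is its local ring O_p, a subset of K, and
   a surface is the set of the local rings of its closed points.  A birational
   morphism of surfaces over P^2 becomes the identity of K, so that a point at
   which such a morphism is a local isomorphism is literally the same element
   of both surfaces. *)
From HB Require Import structures.
From mathcomp Require Import all_boot all_order all_algebra.
From mathcomp Require Import complex.
From mathcomp Require Import all_classical all_reals all_analysis.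
(* The notations of mpoly clash with those of MathComp-Analysis. *)
From mathcomp Require Import -(notations) mpoly.

Set Implicit Arguments.
Unset Strict Implicit.
Unset Printing Implicit Defensive.

Import Order.TTheory GRing.Theory Num.Theory.
Import numFieldNormedType.Exports.
Local Open Scope ring_scope.
Local Open Scope quotient_scope.
Local Open Scope classical_set_scope.

Definition Cplx (R : realType) : numClosedFieldType := R[i]%C.

Definition funfield (R : realType) : fieldType := {fraction (mpoly 2 (Cplx R))}.

Definition constK (R : realType) (c : Cplx R) : funfield R :=
  tofrac (mpolyC 2 c).

Definition xK (R : realType) : funfield R :=
  tofrac (mpolyX (Cplx R) (mnm1 (ord0 : 'I_2))).
Definition yK (R : realType) : funfield R :=
  tofrac (mpolyX (Cplx R) (mnm1 (ord_max : 'I_2))).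

(* P(u, v) *)
Definition subst (R : realType) (u v : funfield R) (P : mpoly 2 (Cplx R)) :
    funfield R :=
  mmap (@constK R) (tnth [tuple u; v]) P.

(* g(u, v), meaningful when u and v are algebraically independent (or at least
   when the denominator of g does not vanish at (u, v)). *)
Definition pullback (R : realType) (u v g : funfield R) : funfield R :=
  let: (n, d) := frac (repr g) in subst u v n / subst u v d.

Definition partialK (R : realType) (i : 'I_2) (g : funfield R) : funfield R :=
  let: (n, d) := frac (repr g) in
  tofrac (mderiv i n * d - n * mderiv i d) / tofrac d ^+ 2.

Definition jacobian (R : realType) (u v : funfield R) : funfield R :=
  partialK ord0 u * partialK ord_max v - partialK ord_max u * partialK ord0 v.

(* The rational two-form w dx /\ dy is represented by w. *)
Definition two_form (R : realType) : Type := funfield R.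

Definition eta (R : realType) : two_form R := (xK R * yK R)^-1.

(* The h such that w dx /\ dy = h du /\ dv. *)
Definition form_coef (R : realType) (w : two_form R) (u v : funfield R) :
    funfield R :=
  w / jacobian u v.

Definition point (R : realType) : Type := set (funfield R).
Definition surface (R : realType) : Type := set (point R).

(* The point with local coordinates (u, v): the localization of C[u, v] at the
   ideal (u, v). *)
Definition local_ring (R : realType) (u v : funfield R) : point R :=
  [set g | exists P Q : mpoly 2 (Cplx R),
     meval (fun=> 0) Q != 0 /\ g = subst u v P / subst u v Q].

Definition max_ideal (R : realType) (p : point R) : set (funfield R) :=
  [set g | p g /\ ~ (g != 0 /\ p g^-1)].

Definition has_value (R : realType) (p : point R) (g : funfield R)
    (c : Cplx R) : Prop :=
  max_ideal p (g - constK c).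

Definition P2 (R : realType) : surface R :=
  [set p | exists a b : Cplx R,
     [\/ p = local_ring (xK R - constK a) (yK R - constK b),
         p = local_ring ((xK R)^-1 - constK a) (yK R / xK R - constK b)
       | p = local_ring ((yK R)^-1 - constK a) (xK R / yK R - constK b)]].

(* The blowup of X at the point with local coordinates (u, v): the exceptional
   curve has coordinate [u : v]. *)
Definition blowup (R : realType) (X : surface R) (u v : funfield R) :
    surface R :=
  (X `\ local_ring u v) `|`
  [set q | (exists c : Cplx R, q = local_ring u (v / u - constK c)) \/
           q = local_ring (u / v) v].

Arguments P2 R : clear implicits.

(* Finite compositions of blowups at points satisfying [adm]. *)
Inductive blowup_tower (R : realType) (adm : point R -> Prop) :
    surface R -> Prop :=
| tower_P2 : blowup_tower adm (P2 R)
| tower_blowup (X : surface R) (u v : funfield R) :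
    blowup_tower adm X -> X (local_ring u v) -> adm (local_ring u v) ->
    blowup_tower adm (blowup X u v).

Definition modification (R : realType) (X : surface R) : Prop :=
  blowup_tower (fun=> True) X.

Definition torus_fixed (R : realType) (p : point R) : Prop :=
  forall s t : Cplx R, s != 0 -> t != 0 ->
  forall g, p g -> p (pullback (constK s * xK R) (constK t * yK R) g).

Definition toric_modification (R : realType) (X : surface R) : Prop :=
  blowup_tower (@torus_fixed R) X.

Definition regular_form_at (R : realType) (w : two_form R) (p : point R) :
    Prop :=
  exists u v, p = local_ring u v /\ p (form_coef w u v).

Definition form_vanishes_at (R : realType) (w : two_form R) (p : point R) :
    Prop :=
  exists u v, p = local_ring u v /\ max_ideal p (form_coef w u v).

Definition elaboration (R : realType) (X : surface R) : Prop :=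
  modification X /\ forall p, X p -> ~ form_vanishes_at (eta R) p.

(* The domains of definition {p | g \in O_p}, g in K, generate the Zariski
   topology. *)
Definition zariski_open (R : realType) (X : surface R) (U : set (point R)) :
    Prop :=
  U `<=` X /\
  forall p, U p -> exists s : seq (funfield R),
    (forall g, g \in s -> p g) /\
    (forall q, X q -> (forall g, g \in s -> q g) -> U q).

Definition zariski_closed (R : realType) (X : surface R) (Z : set (point R)) :
    Prop :=
  Z `<=` X /\ zariski_open X (X `\` Z).

Definition zariski_closure (R : realType) (X : surface R)
    (S : set (point R)) : set (point R) :=
  [set p | X p /\ forall Z, zariski_closed X Z -> S `<=` Z -> Z p].

Definition irreducible_closed (R : realType) (X : surface R)
    (C : set (point R)) : Prop :=
  [/\ zariski_closed X C, C !=set0 &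
      forall Z1 Z2, zariski_closed X Z1 -> zariski_closed X Z2 ->
        C `<=` Z1 `|` Z2 -> C `<=` Z1 \/ C `<=` Z2].

(* On a surface, the irreducible closed subsets of dimension one are those
   which are neither the whole surface nor a point. *)
Definition irreducible_curve (R : realType) (X : surface R)
    (C : set (point R)) : Prop :=
  [/\ irreducible_closed X C, C <> X & forall p, C <> [set p]].

Definition irreducible_component (R : realType) (X : surface R)
    (D C : set (point R)) : Prop :=
  [/\ irreducible_closed X C, C `<=` D &
      forall E, irreducible_closed X E -> E `<=` D -> C `<=` E -> E = C].

Definition pole (R : realType) (w : two_form R) (C : set (point R)) : Prop :=
  forall p, C p -> ~ regular_form_at w p.

(* For a rational map F between surfaces with function field K, given by
   phi = F^* : K -> K: F is regular at p and F(p) = q. *)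
Definition maps_to (R : realType) (phi : funfield R -> funfield R)
    (p q : point R) : Prop :=
  (forall g, q g -> p (phi g)) /\
  (forall g, max_ideal q g -> max_ideal p (phi g)).

(* F(C \ I(F)), for F with target Y *)
Definition proper_image (R : realType) (phi : funfield R -> funfield R)
    (Y : surface R) (C : set (point R)) : set (point R) :=
  [set q | Y q /\ exists2 p, C p & maps_to phi p q].

Definition image_closure (R : realType) (phi : funfield R -> funfield R)
    (Y : surface R) (C : set (point R)) : set (point R) :=
  zariski_closure Y (proper_image phi Y C).

Definition contracts (R : realType) (phi : funfield R -> funfield R)
    (Y : surface R) (C : set (point R)) : Prop :=
  exists q, proper_image phi Y C = [set q].

(* The canonical birational map Z --> X is a morphism. *)
Definition dominates (R : realType) (Z X : surface R) : Prop :=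
  forall q, Z q -> exists2 p, X p & maps_to id q p.

(* The image of C under the inverse X --> Z of the morphism Z -> X. *)
Definition strict_transform (R : realType) (Z : surface R)
    (C : set (point R)) : set (point R) :=
  image_closure id Z C.

(* Rational maps P^2 --> P^2 in the homogeneous coordinates [x0 : x1 : x2],
   where x = x1 / x0 and y = x2 / x0; the components may have a common
   factor. *)
Record rational_map (R : realType) := RationalMap {
  component :> 'I_3 -> mpoly 3 (Cplx R);
  map_degree : nat;
  component_homog : forall i, component i \is ishomog1 map_degree mdeg;
  component_neq0 : exists i, component i != 0 }.

Definition dehomogenize (R : realType) (F : mpoly 3 (Cplx R)) : funfield R :=
  mmap (@constK R) (tnth [tuple 1; xK R; yK R]) F.

(* x \o f and y \o f, when f does not map P^2 into the line x0 = 0 *)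
Definition map_x (R : realType) (f : rational_map R) : funfield R :=
  dehomogenize (f (inord 1)) / dehomogenize (f (inord 0)).
Definition map_y (R : realType) (f : rational_map R) : funfield R :=
  dehomogenize (f (inord 2)) / dehomogenize (f (inord 0)).

Definition map_pullback (R : realType) (f : rational_map R) :
    funfield R -> funfield R :=
  pullback (map_x f) (map_y f).

Definition form_pullback (R : realType) (f : rational_map R)
    (w : two_form R) : two_form R :=
  map_pullback f w * jacobian (map_x f) (map_y f).

(* For f^* eta to make sense, no component of f may vanish identically. *)
Definition preserves_eta (R : realType) (f : rational_map R) : Prop :=
  (forall i, f i != 0) /\
  exists2 delta : Cplx R, delta != 0 &
    form_pullback f (eta R) = constK delta * eta R.

(* A pair (X, C): an elaboration X and an irreducible curve C in X *)
Definition placed_curve (R : realType) : Type := (surface R * set (point R))%type.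

Definition is_placed_curve (R : realType) (XC : placed_curve R) : Prop :=
  elaboration XC.1 /\ irreducible_curve XC.1 XC.2.

Definition equivalent_curves (R : realType) (XC YD : placed_curve R) : Prop :=
  exists Z : surface R,
    [/\ elaboration Z, dominates Z XC.1, dominates Z YD.1 &
        strict_transform Z XC.2 = strict_transform Z YD.2].

(* An eta-prime is the set of its incarnations: [P (X, C)] says that P appears
   in X with incarnation C. *)
Definition is_eta_prime (R : realType) (P : set (placed_curve R)) : Prop :=
  exists2 XC, is_placed_curve XC &
    P = [set YD | is_placed_curve YD /\ equivalent_curves XC YD].

Definition is_polar_prime (R : realType) (P : set (placed_curve R)) : Prop :=
  is_eta_prime P /\ forall XC, P XC -> pole (eta R) XC.2.

Definition polar_prime (R : realType) : Type :=
  {P : set (placed_curve R) | is_polar_prime P}.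

(* Q is obtained from P by the recipe defining f_sharp, for some choice of the
   elaborations X and Y. *)
Definition sharp_image (R : realType) (f : rational_map R)
    (P Q : set (placed_curve R)) : Prop :=
  is_eta_prime Q /\
  exists X Y C,
    [/\ P (X, C), elaboration Y, ~ contracts (map_pullback f) Y C &
        Q (Y, image_closure (map_pullback f) Y C)].

Definition torus_point (R : realType) (s t : Cplx R) : point R :=
  local_ring (xK R - constK s) (yK R - constK t).

Definition torus (R : realType) : set (point R) :=
  [set p | exists s t : Cplx R, [/\ s != 0, t != 0 & p = torus_point s t]].

Arguments torus R : clear implicits.

(* (alpha z^a, beta z^b) tends to p as z tends to 0, in the complex topology:
   every g in O_p is defined along the arc near z = 0, and its values tend to
   g(p). *)
Definition arc_tends_to (R : realType) (alpha beta : Cplx R) (a b : int)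
    (p : point R) : Prop :=
  forall g c, has_value p g c -> forall e : Cplx R, 0 < e ->
  \forall z \near (0 : Cplx R)^', exists2 w,
    has_value (torus_point (alpha * z ^ a) (beta * z ^ b)) g w & `|w - c| < e.

Definition ray (R : realType) (a b : int) : set (R * R) :=
  [set u | exists2 r : R, 0 <= r & u = (r * a%:~R, r * b%:~R)].

Arguments ray R a b : clear implicits.

Definition corresponds (R : realType) (P : set (placed_curve R))
    (tau : set (R * R)) : Prop :=
  exists a b : int, [/\ coprimez a b, tau = ray R a b &
    exists X C, [/\ toric_modification X, P (X, C) &
      forall alpha beta : Cplx R, alpha != 0 -> beta != 0 ->
      exists p, [/\ X p, arc_tends_to alpha beta a b p, C p,
        irreducible_component X (X `\` torus R) C &
        forall E, irreducible_component X (X `\` torus R) E -> E p -> E = C]]].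

Definition closed_cone (R : realType) (s : set (R * R)) : Prop :=
  closed s /\ forall (r : R) u, 0 <= r -> s u -> s (r *: u).

Definition piecewise_linear (R : realType) (T : R * R -> R * R) : Prop :=
  continuous T /\
  exists (n : nat) (s : 'I_n -> set (R * R)),
    [/\ forall i, closed_cone (s i),
        \bigcup_i s i = setT &
        forall i, exists L : {linear (R * R)%type -> (R * R)%type},
          forall u, s i u -> T u = L u].

Definition preserves_lattice (R : realType) (T : R * R -> R * R) : Prop :=
  forall m n : int, exists m' n' : int,
    T (m%:~R, n%:~R) = (m'%:~R, n'%:~R).

Definition relatively_open (S : topologicalType) (A U : set S) : Prop :=
  exists2 O, open O & U = A `&` O.

Definition homeomorphism_on (S S' : topologicalType) (U : set S) (V : set S')
    (f : S -> S') : Prop :=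
  {within U, continuous f} /\
  exists g : S' -> S, [/\ {within V, continuous g},
    forall x, U x -> V (f x) /\ g (f x) = x &
    forall y, V y -> U (g y) /\ f (g y) = y].

(* f restricts to a covering map A -> B with finitely many sheets. *)
Definition finite_covering (S S' : topologicalType) (A : set S) (B : set S')
    (f : S -> S') : Prop :=
  [/\ forall x, A x -> B (f x),
      {within A, continuous f} &
      exists2 n : nat, (0 < n)%N &
        forall y, B y -> exists V : set S',
          [/\ relatively_open B V, V y &
            exists U : 'I_n -> set S,
              [/\ forall i, relatively_open A (U i),
                  trivIset setT U,
                  A `&` f @^-1` V = \bigcup_i U i &
                  forall i, homeomorphism_on (U i) V f]]].

Definition punctured_plane (R : realType) : set (R * R) := [set u | u <> 0].
Arguments punctured_plane R : clear implicits.

(* Main.v *)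
(* For a primitive integer vector l let V l be the ring of the monomial valuation
   of weight l.  Blowing up a point where eta is regular creates a zero, so an
   elaboration only blows up poles, and all but finitely many of its poles lie on
   curves with local ring some V l.  So the polar primes are the rings V l, and
   those which appear in a toric surface are its boundary divisors.

   Let u = x o f, v = y o f, and let nu_t(P) be the minimum of <t, m> over the
   exponents m of P.  Refine the weight t to a lexicographic one (t, s).  The
   lowest terms in f^* eta = delta eta show that the leading exponents of u and v
   have determinant delta, so the lowest terms of P(u, v) cannot cancel and
   nu_t(g o f) = nu_{T t}(g) for T t = (nu_t(u), nu_t(v)).  Hence f maps the
   divisor of weight l onto that of weight l', where T l is a positive multiple
   of l'.  The map T is piecewise linear, and all its linear pieces have
   determinant delta.  It is therefore a local homeomorphism outside 0 with
   finitely many inverse branches, hence a finite covering. *)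
Require Import Defs.
From HB Require Import structures.
From mathcomp Require Import all_boot all_order all_algebra.
From mathcomp Require Import complex.
From mathcomp Require Import all_classical all_reals all_analysis.
From mathcomp Require Import -(notations) mpoly.
From mathcomp Require Import ring lra zify.

Import Order.TTheory GRing.Theory Num.Theory.
Import numFieldNormedType.Exports.
Local Open Scope ring_scope.
Local Open Scope classical_set_scope.

(** Geometry is expressed through inclusions of local rings. All points have residue field C, so an
    inclusion is automatically a local homomorphism, and one point contains another exactly when it
    is infinitely near or equal to it. The union of the local rings along a curve is the local ring
    of its generic point and determines the curve on every surface. Equivalence of curves thus
    becomes equality of subrings of K.

    That f_sharp is well defined concerns all elaborations, toric or not. Whatever X and Y are, the
    points of the image closure are contained in [V l'], so the closure is polar and its ring is
    some [V m] inside [V l']; no two of these rings are properly nested.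

    One weight cannot exclude cancellation, since several monomials may share the lowest weight. A
    second, independent weight breaks the ties, so that each polynomial has a single lowest
    monomial; its two possible signs also describe T on the two sides of a ray. The number of
    preimages under T is locally constant, and connectedness of the punctured plane gives one number
    of sheets. *)

Module Geo.
Set Implicit Arguments.
Unset Strict Implicit.
Unset Printing Implicit Defensive.

(* An interface to C(x, y) and its subring C[x, y], because Rocq's conversion
   does not cope with the concrete field of fractions; [cf P (i, j)] is the
   coefficient of x^i y^j. *)
Record ratField (C : numClosedFieldType) := RatField {
  ratFun : fieldType;
  Pol : idomainType;
  cP : C -> Pol;
  XP : Pol;
  YP : Pol;
  toFun : Pol -> ratFun;
  numden : ratFun -> Pol * Pol;
  dP : 'I_2 -> Pol -> Pol;
  sb : ratFun -> ratFun -> Pol -> ratFun;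
  ev0 : Pol -> C;
  psize : Pol -> nat;
  cf : Pol -> nat * nat -> C;
  supp : Pol -> seq (nat * nat);
  Pol_ind : forall H : Pol -> Prop,
    (forall c, H (cP c)) -> H XP -> H YP ->
    (forall P Q, H P -> H Q -> H (P + Q)) ->
    (forall P Q, H P -> H Q -> H (P * Q)) -> forall P, H P;
  den_neq0 : forall g, (numden g).2 != 0;
  numdenE : forall g, g = toFun (numden g).1 / toFun (numden g).2;
  cPD : {morph cP : c d / c + d};
  cPM : {morph cP : c d / c * d};
  cP1 : cP 1 = 1;
  toFunD : {morph toFun : P Q / P + Q};
  toFunM : {morph toFun : P Q / P * Q};
  toFun1 : toFun 1 = 1;
  toFun_eq0 : forall P, (toFun P == 0) = (P == 0);
  sbD : forall u v, {morph sb u v : P Q / P + Q};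
  sbM : forall u v, {morph sb u v : P Q / P * Q};
  sbC : forall u v c, sb u v (cP c) = toFun (cP c);
  sbX : forall u v, sb u v XP = u;
  sbY : forall u v, sb u v YP = v;
  ev0D : {morph ev0 : P Q / P + Q};
  ev0M : {morph ev0 : P Q / P * Q};
  ev0C : forall c, ev0 (cP c) = c;
  ev0X : ev0 XP = 0;
  ev0Y : ev0 YP = 0;
  dPD : forall i, {morph dP i : P Q / P + Q};
  dPM : forall i P Q, dP i (P * Q) = dP i P * Q + P * dP i Q;
  dPC : forall i c, dP i (cP c) = 0;
  dPX0 : dP ord0 XP = 1;
  dPX1 : dP ord_max XP = 0;
  dPY0 : dP ord0 YP = 0;
  dPY1 : dP ord_max YP = 1;
  dP_eq0 : forall P, dP ord0 P = 0 -> dP ord_max P = 0 -> P = cP (ev0 P);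
  psize_dP : forall i P, P != 0 -> (psize (dP i P) < psize P)%N;
  mem_supp : forall P m, (m \in supp P) = (cf P m != 0);
  supp_uniq : forall P, uniq (supp P);
  polE : forall P,
    P = \sum_(m <- supp P) cP (cf P m) * (XP ^+ m.1 * YP ^+ m.2);
  cfD : forall P Q m, cf (P + Q) m = cf P m + cf Q m;
  cfZ : forall c P m, cf (cP c * P) m = c * cf P m;
  cfMX : forall P i j m, cf (XP ^+ i * YP ^+ j * P) m =
    if (i <= m.1)%N && (j <= m.2)%N then cf P (m.1 - i, m.2 - j)%N else 0;
  cf1 : forall m, cf 1 m = (m == (0, 0)%N)%:R;
  cf_dX : forall P i j, cf (dP ord0 P) (i, j) = cf P (i.+1, j) *+ i.+1;
  cf_dY : forall P i j, cf (dP ord_max P) (i, j) = cf P (i, j.+1) *+ j.+1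
}.

(** * Derivations of C(x, y) *)

(** The quotient rule does not depend on the fraction representing the function. [an], [ad], [an'],
    [ad'] stand for the derivatives of [n], [d], [n'], [d'], and the last hypothesis is the
    derivative of the one before. *)
Lemma partial_eq_aux (F : fieldType) (n d n' d' an ad an' ad' : F) :
  d != 0 -> d' != 0 -> n * d' = n' * d ->
  an * d' + n * ad' = an' * d + n' * ad ->
  (an * d - n * ad) / d ^+ 2 = (an' * d' - n' * ad') / d' ^+ 2.
Proof.
move=> d0 d0' e ea; apply/eqP; rewrite eqr_div ?expf_neq0 //; apply/eqP.
have -> : (an * d - n * ad) * d' ^+ 2 = an * d' * (d * d') - n * d' * (ad * d').
  by ring.
have -> : an * d' = an' * d + n' * ad - n * ad' by rewrite -ea; ring.
have -> : (an' * d + n' * ad - n * ad') * (d * d') =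
  (an' * d + n' * ad) * (d * d') - n * d' * (ad' * d) by ring.
by rewrite e; ring.
Qed.

Section Derivations.
Variables (C : numClosedFieldType) (F : ratField C).
Local Notation K := (ratFun F).
Local Notation A := (Pol F).
Local Notation i0 := (ord0 : 'I_2).
Local Notation i1 := (ord_max : 'I_2).
Implicit Types (g h u v w : K) (P Q : A) (c d : C).

Definition cK c : K := toFun (cP F c).
Definition xF : K := toFun (XP F).
Definition yF : K := toFun (YP F).

Lemma cP0 : cP F 0 = 0.
Proof. by apply: (addrI (cP F 0)); rewrite -cPD !addr0. Qed.
Lemma cPN c : cP F (- c) = - cP F c.
Proof. by apply: (addrI (cP F c)); rewrite -cPD !subrr cP0. Qed.
HB.instance Definition _ := GRing.isZmodMorphism.Build C A (@cP C F)
  (fun c d => etrans (cPD F c (- d)) (congr1 (+%R (cP F c)) (cPN d))).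
HB.instance Definition _ := GRing.isMonoidMorphism.Build C A (@cP C F)
  (conj (cP1 F) (@cPM C F)).

Lemma toFun0 : toFun (0 : A) = 0.
Proof. by apply: (addrI (toFun (0 : A))); rewrite -toFunD !addr0. Qed.
Lemma toFunN P : toFun (- P) = - toFun P.
Proof. by apply: (addrI (toFun P)); rewrite -toFunD !subrr toFun0. Qed.
HB.instance Definition _ := GRing.isZmodMorphism.Build A K (@toFun C F)
  (fun P Q => etrans (toFunD P (- Q)) (congr1 (+%R (toFun P)) (toFunN Q))).
HB.instance Definition _ := GRing.isMonoidMorphism.Build A K (@toFun C F)
  (conj (toFun1 F) (@toFunM C F)).

Lemma toFun_inj : injective (@toFun C F).
Proof.
by move=> P Q /eqP; rewrite -subr_eq0 -rmorphB /= toFun_eq0 subr_eq0 => /eqP.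
Qed.

Lemma sb0 u v : sb u v 0 = 0.
Proof. by apply: (addrI (sb u v 0)); rewrite -sbD !addr0. Qed.
Lemma sbN u v P : sb u v (- P) = - sb u v P.
Proof. by apply: (addrI (sb u v P)); rewrite -sbD !subrr sb0. Qed.
Lemma sb1 u v : sb u v 1 = 1.
Proof. by rewrite -(cP1 F) sbC cP1 toFun1. Qed.
HB.instance Definition _ u v := GRing.isZmodMorphism.Build A K (sb u v)
  (fun P Q => etrans (sbD u v P (- Q)) (congr1 (+%R (sb u v P)) (sbN u v Q))).
HB.instance Definition _ u v := GRing.isMonoidMorphism.Build A K (sb u v)
  (conj (sb1 u v) (sbM u v)).

Lemma ev0_0 : ev0 (0 : A) = 0.
Proof. by apply: (addrI (ev0 (0 : A))); rewrite -ev0D !addr0. Qed.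
Lemma ev0N P : ev0 (- P) = - ev0 P.
Proof. by apply: (addrI (ev0 P)); rewrite -ev0D !subrr ev0_0. Qed.
Lemma ev0_1 : ev0 (1 : A) = 1.
Proof. by rewrite -(cP1 F) ev0C. Qed.
HB.instance Definition _ := GRing.isZmodMorphism.Build A C (@ev0 C F)
  (fun P Q => etrans (ev0D P (- Q)) (congr1 (+%R (ev0 P)) (ev0N Q))).
HB.instance Definition _ := GRing.isMonoidMorphism.Build A C (@ev0 C F)
  (conj ev0_1 (@ev0M C F)).

HB.instance Definition _ := GRing.RMorphism.copy cK (@toFun C F \o @cP C F).

Lemma cK_eq0 c : (cK c == 0) = (c == 0).
Proof. exact: fmorph_eq0. Qed.
Lemma cK0 : cK 0 = 0. Proof. exact: rmorph0. Qed.
Lemma cK1 : cK 1 = 1. Proof. exact: rmorph1. Qed.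
Lemma cKD c d : cK (c + d) = cK c + cK d. Proof. exact: rmorphD. Qed.
Lemma cKN c : cK (- c) = - cK c. Proof. exact: rmorphN. Qed.
Lemma cKB c d : cK (c - d) = cK c - cK d. Proof. exact: rmorphB. Qed.
Lemma cKM c d : cK (c * d) = cK c * cK d. Proof. exact: rmorphM. Qed.
Lemma cKX c n : cK (c ^+ n) = cK c ^+ n. Proof. exact: rmorphXn. Qed.
Lemma cKV c : cK c^-1 = (cK c)^-1. Proof. exact: fmorphV. Qed.

Lemma sbCK u v c : sb u v (cP F c) = cK c. Proof. exact: sbC. Qed.

Lemma sb_id P : sb xF yF P = toFun P.
Proof.
elim/(@Pol_ind _ F): P => [c| | |P Q IHP IHQ|P Q IHP IHQ].
- by rewrite sbC.
- by rewrite sbX.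
- by rewrite sbY.
- by rewrite sbD toFunD IHP IHQ.
- by rewrite sbM toFunM IHP IHQ.
Qed.

Lemma sb_sum u v P :
  sb u v P = \sum_(m <- supp P) cK (cf P m) * (u ^+ m.1 * v ^+ m.2).
Proof.
rewrite {1}[P]polE rmorph_sum; apply: eq_bigr => m _ /=.
by rewrite !rmorphM !rmorphXn /= sbX sbY sbCK.
Qed.

Lemma fracF_ind (H : K -> Prop) :
  (forall P Q, Q != 0 -> H (toFun P / toFun Q)) -> forall g, H g.
Proof. by move=> h g; rewrite [g]numdenE; apply: h; apply: den_neq0. Qed.

Lemma dP1 i : dP i (1 : A) = 0.
Proof. by rewrite -(cP1 F) dPC. Qed.

Definition partial (i : 'I_2) g : K :=
  let: (n, d) := numden g in
  toFun (dP i n * d - n * dP i d) / toFun d ^+ 2.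

Lemma partial_frac i P Q : Q != 0 -> partial i (toFun P / toFun Q) =
  (toFun (dP i P) * toFun Q - toFun P * toFun (dP i Q)) / toFun Q ^+ 2.
Proof.
move=> Q0; rewrite /partial; set g := _ / _.
have := numdenE g; have := den_neq0 g; case: (numden g) => n d /= d0 /eqP.
rewrite eqr_div ?toFun_eq0 // -!toFunM => /eqP/toFun_inj e.
rewrite rmorphB /= !toFunM.
apply: (@partial_eq_aux K (toFun n) (toFun d)); rewrite ?toFun_eq0 //.
  by rewrite -!toFunM e.
by rewrite -!toFunM -!toFunD -!dPM e.
Qed.

Lemma partial_toFun i P : partial i (toFun P) = toFun (dP i P).
Proof.
rewrite -[toFun P]divr1 -(toFun1 F) partial_frac ?oner_eq0 // !toFun1.
by rewrite dP1 toFun0 mulr0 subr0 expr1n divr1 mulr1.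
Qed.

Lemma partialC i c : partial i (cK c) = 0.
Proof. by rewrite partial_toFun dPC toFun0. Qed.

Lemma partialD i g h : partial i (g + h) = partial i g + partial i h.
Proof.
elim/fracF_ind: g => P Q Q0; elim/fracF_ind: h => P' Q' Q0'.
have q0 : toFun Q != 0 by rewrite toFun_eq0.
have q0' : toFun Q' != 0 by rewrite toFun_eq0.
rewrite addf_div // -!toFunM -toFunD !partial_frac ?mulf_neq0 //.
rewrite dPD !dPM !(toFunD, toFunM).
by field; rewrite q0 q0'.
Qed.

Lemma partialM i g h :
  partial i (g * h) = partial i g * h + g * partial i h.
Proof.
elim/fracF_ind: g => P Q Q0; elim/fracF_ind: h => P' Q' Q0'.
have q0 : toFun Q != 0 by rewrite toFun_eq0.
have q0' : toFun Q' != 0 by rewrite toFun_eq0.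
rewrite mulf_div -!toFunM !partial_frac ?mulf_neq0 //.
rewrite !dPM !(toFunD, toFunM).
by field; rewrite q0 q0'.
Qed.

Lemma partial0 i : partial i 0 = 0.
Proof. by rewrite -[X in partial i X]cK0 partialC. Qed.

Lemma partialN i g : partial i (- g) = - partial i g.
Proof. by apply: (addrI (partial i g)); rewrite -partialD !subrr partial0. Qed.

Lemma partialV i g : g != 0 -> partial i g^-1 = - partial i g / g ^+ 2.
Proof.
move=> g0; have : partial i (g * g^-1) = 0 by rewrite divff // -cK1 partialC.
rewrite partialM => /eqP; rewrite addrC addr_eq0 => /eqP e.
by apply: (mulfI g0); rewrite e; field.
Qed.

Definition jac u v : K :=
  partial i0 u * partial i1 v - partial i1 u * partial i0 v.

Lemma jacDl u v w : jac (u + v) w = jac u w + jac v w.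
Proof. by rewrite /jac !partialD; ring. Qed.
Lemma jacDr u v w : jac w (u + v) = jac w u + jac w v.
Proof. by rewrite /jac !partialD; ring. Qed.
Lemma jacMl u v w : jac (u * v) w = jac u w * v + u * jac v w.
Proof. by rewrite /jac !partialM; ring. Qed.
Lemma jacMr u v w : jac w (u * v) = jac w u * v + u * jac w v.
Proof. by rewrite /jac !partialM; ring. Qed.
Lemma jacCl c w : jac (cK c) w = 0.
Proof. by rewrite /jac !partialC; ring. Qed.
Lemma jacCr c w : jac w (cK c) = 0.
Proof. by rewrite /jac !partialC; ring. Qed.
Lemma jac0l w : jac 0 w = 0.
Proof. by rewrite -[X in jac X w]cK0 jacCl. Qed.
Lemma jac0r w : jac w 0 = 0.
Proof. by rewrite -[X in jac w X]cK0 jacCr. Qed.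
Lemma jacNl u w : jac (- u) w = - jac u w.
Proof. by rewrite /jac !partialN; ring. Qed.
Lemma jacC u v : jac u v = - jac v u.
Proof. by rewrite /jac; ring. Qed.
Lemma jacNr u w : jac w (- u) = - jac w u.
Proof. by rewrite /jac !partialN; ring. Qed.
Lemma jacVl u w : u != 0 -> jac u^-1 w = - jac u w / u ^+ 2.
Proof. by move=> u0; rewrite /jac !partialV //; ring. Qed.
Lemma jacVr u w : u != 0 -> jac w u^-1 = - jac w u / u ^+ 2.
Proof. by move=> u0; rewrite /jac !partialV //; ring. Qed.
Lemma jac_diag u : jac u u = 0.
Proof. by rewrite /jac; ring. Qed.

Lemma jac_xy : jac xF yF = 1.
Proof.
by rewrite /jac !partial_toFun dPX0 dPX1 dPY0 dPY1 toFun0 toFun1; ring.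
Qed.

Lemma partial_sb i u v P : partial i (sb u v P) =
  sb u v (dP i0 P) * partial i u + sb u v (dP i1 P) * partial i v.
Proof.
elim/(@Pol_ind _ F): P => [c| | |P Q IHP IHQ|P Q IHP IHQ].
- by rewrite sbCK partialC !dPC sb0; ring.
- by rewrite sbX dPX0 dPX1 sb0 sb1; ring.
- by rewrite sbY dPY0 dPY1 sb0 sb1; ring.
- by rewrite sbD partialD IHP IHQ !dPD !sbD; ring.
- by rewrite sbM partialM IHP IHQ !dPM !sbD !sbM; ring.
Qed.

Lemma jac_sbl u v P w : jac (sb u v P) w =
  sb u v (dP i0 P) * jac u w + sb u v (dP i1 P) * jac v w.
Proof. by rewrite /jac !partial_sb; ring. Qed.

(* A relation P(u, v) = 0 of minimal degree differentiates to
   P_X(u, v) = P_Y(u, v) = 0 when the Jacobian does not vanish. *)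
Lemma sb_eq0 u v P : jac u v != 0 -> (sb u v P == 0) = (P == 0).
Proof.
move=> J; apply/eqP/eqP => [|->]; last exact: sb0.
have [n] := ubnP (psize P); elim: n P => // n IH P sP P0.
apply/eqP/negPn/negP => Pn.
have dv w : sb u v (dP i0 P) * jac u w + sb u v (dP i1 P) * jac v w = 0.
  by rewrite -jac_sbl P0 jac0l.
have e0 : dP i0 P = 0.
  apply: IH; first by rewrite (leq_trans (psize_dP _ Pn)).
  have := dv v; rewrite jac_diag mulr0 addr0 => /eqP.
  by rewrite mulf_eq0 (negPf J) orbF => /eqP.
have e1 : dP i1 P = 0.
  apply: IH; first by rewrite (leq_trans (psize_dP _ Pn)).
  have := dv u; rewrite jac_diag mulr0 add0r jacC mulrN => /eqP.
  by rewrite oppr_eq0 mulf_eq0 (negPf J) orbF => /eqP.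
move: P0 Pn; rewrite (dP_eq0 e0 e1) sbCK => /eqP; rewrite cK_eq0 => /eqP ->.
by rewrite cP0 eqxx.
Qed.

Definition pullb u v g : K :=
  let: (n, d) := numden g in sb u v n / sb u v d.

Section Pullback.
Variables (u v : K).
Hypothesis J : jac u v != 0.

Lemma pullb_frac P Q : Q != 0 ->
  pullb u v (toFun P / toFun Q) = sb u v P / sb u v Q.
Proof.
move=> Q0; rewrite /pullb; set g := _ / _.
have := numdenE g; have := den_neq0 g; case: (numden g) => n d /= d0 /eqP.
rewrite eqr_div ?toFun_eq0 // -!toFunM => /eqP/toFun_inj e.
by apply/eqP; rewrite eqr_div ?sb_eq0 // -!sbM e.
Qed.

Lemma pullb_toFun P : pullb u v (toFun P) = sb u v P.
Proof.
by rewrite -[toFun P]divr1 -(toFun1 F) pullb_frac ?oner_eq0 // sb1 divr1.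
Qed.

Lemma pullbC c : pullb u v (cK c) = cK c.
Proof. by rewrite pullb_toFun sbCK. Qed.
Lemma pullb_x : pullb u v xF = u.
Proof. by rewrite pullb_toFun sbX. Qed.
Lemma pullb_y : pullb u v yF = v.
Proof. by rewrite pullb_toFun sbY. Qed.

Lemma pullbD g h : pullb u v (g + h) = pullb u v g + pullb u v h.
Proof.
elim/fracF_ind: g => P Q Q0; elim/fracF_ind: h => P' Q' Q0'.
rewrite addf_div ?toFun_eq0 // -!toFunM -toFunD !pullb_frac ?mulf_neq0 //.
by rewrite sbD !sbM -addf_div ?sb_eq0.
Qed.

Lemma pullbM g h : pullb u v (g * h) = pullb u v g * pullb u v h.
Proof.
elim/fracF_ind: g => P Q Q0; elim/fracF_ind: h => P' Q' Q0'.
by rewrite mulf_div -!toFunM !pullb_frac ?mulf_neq0 // !sbM -mulf_div.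
Qed.

Lemma pullb0 : pullb u v 0 = 0.
Proof. by rewrite -[X in pullb u v X]cK0 pullbC cK0. Qed.
Lemma pullb1 : pullb u v 1 = 1.
Proof. by rewrite -[X in pullb u v X]cK1 pullbC cK1. Qed.
Lemma pullbN g : pullb u v (- g) = - pullb u v g.
Proof.
by apply: (addrI (pullb u v g)); rewrite -pullbD !subrr pullb0.
Qed.
Lemma pullbB g h : pullb u v (g - h) = pullb u v g - pullb u v h.
Proof. by rewrite pullbD pullbN. Qed.
Lemma pullb_eq0 g : (pullb u v g == 0) = (g == 0).
Proof.
elim/fracF_ind: g => P Q Q0.
by rewrite pullb_frac // !mulf_eq0 !invr_eq0 !toFun_eq0 !sb_eq0.
Qed.
Lemma pullbV g : pullb u v g^-1 = (pullb u v g)^-1.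
Proof.
have [->|g0] := eqVneq g 0; first by rewrite invr0 pullb0 invr0.
have p0 : pullb u v g != 0 by rewrite pullb_eq0.
by apply: (mulfI p0); rewrite -pullbM !divff // pullb1.
Qed.
Lemma pullb_sb s t P : pullb u v (sb s t P) = sb (pullb u v s) (pullb u v t) P.
Proof.
elim/(@Pol_ind _ F): P => [c| | |P Q IHP IHQ|P Q IHP IHQ].
- by rewrite !sbCK pullbC.
- by rewrite !sbX.
- by rewrite !sbY.
- by rewrite !sbD pullbD IHP IHQ.
- by rewrite !sbM pullbM IHP IHQ.
Qed.
End Pullback.

End Derivations.

(** * Points as local rings *)

(* The definitions of Defs, over ratField *)
Section Geometry.
Variables (C : numClosedFieldType) (F : ratField C).
Local Notation K := (ratFun F).

Definition two_form : Type := ratFun F.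
Definition eta : two_form := (xF F * yF F)^-1.
Definition form_coef (w : two_form) (u v : K) : K := w / jac u v.

Definition point : Type := set (ratFun F).
Definition surface : Type := set point.

Definition local_ring (u v : K) : point :=
  [set g | exists P Q : Pol F, ev0 Q != 0 /\ g = sb u v P / sb u v Q].

Definition max_ideal (p : point) : set K :=
  [set g | p g /\ ~ (g != 0 /\ p g^-1)].

Definition has_value (p : point) (g : K) (c : C) : Prop :=
  max_ideal p (g - cK F c).

Definition P2 : surface :=
  [set p | exists a b : C,
     [\/ p = local_ring (xF F - cK F a) (yF F - cK F b),
         p = local_ring ((xF F)^-1 - cK F a) (yF F / xF F - cK F b)
       | p = local_ring ((yF F)^-1 - cK F a) (xF F / yF F - cK F b)]].

Definition blowup (X : surface) (u v : K) : surface :=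
  (X `\ local_ring u v) `|`
  [set q | (exists c : C, q = local_ring u (v / u - cK F c)) \/
           q = local_ring (u / v) v].

Inductive blowup_tower (adm : point -> Prop) : surface -> Prop :=
| tower_P2 : blowup_tower adm P2
| tower_blowup (X : surface) (u v : K) :
    blowup_tower adm X -> X (local_ring u v) -> adm (local_ring u v) ->
    blowup_tower adm (blowup X u v).

Definition modification (X : surface) : Prop :=
  blowup_tower (fun=> True) X.

Definition torus_fixed (p : point) : Prop :=
  forall s t : C, s != 0 -> t != 0 ->
  forall g, p g -> p (pullb (cK F s * xF F) (cK F t * yF F) g).

Definition toric_modification (X : surface) : Prop :=
  blowup_tower torus_fixed X.

Definition regular_form_at (w : two_form) (p : point) : Prop :=
  exists u v, p = local_ring u v /\ p (form_coef w u v).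

Definition form_vanishes_at (w : two_form) (p : point) : Prop :=
  exists u v, p = local_ring u v /\ max_ideal p (form_coef w u v).

Definition elaboration (X : surface) : Prop :=
  modification X /\ forall p, X p -> ~ form_vanishes_at eta p.

Definition zariski_open (X : surface) (U : set point) : Prop :=
  U `<=` X /\
  forall p, U p -> exists s : seq K,
    (forall g, g \in s -> p g) /\
    (forall q, X q -> (forall g, g \in s -> q g) -> U q).

Definition zariski_closed (X : surface) (Z : set point) : Prop :=
  Z `<=` X /\ zariski_open X (X `\` Z).

Definition zariski_closure (X : surface) (S : set point) : set point :=
  [set p | X p /\ forall Z, zariski_closed X Z -> S `<=` Z -> Z p].

Definition irreducible_closed (X : surface) (D : set point) : Prop :=
  [/\ zariski_closed X D, D !=set0 &
      forall Z1 Z2, zariski_closed X Z1 -> zariski_closed X Z2 ->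
        D `<=` Z1 `|` Z2 -> D `<=` Z1 \/ D `<=` Z2].

Definition irreducible_curve (X : surface) (D : set point) : Prop :=
  [/\ irreducible_closed X D, D <> X & forall p, D <> [set p]].

Definition irreducible_component (X : surface) (D E : set point) : Prop :=
  [/\ irreducible_closed X E, E `<=` D &
      forall E', irreducible_closed X E' -> E' `<=` D -> E `<=` E' -> E' = E].

Definition pole (w : two_form) (D : set point) : Prop :=
  forall p, D p -> ~ regular_form_at w p.

Definition maps_to (phi : K -> K) (p q : point) : Prop :=
  (forall g, q g -> p (phi g)) /\
  (forall g, max_ideal q g -> max_ideal p (phi g)).

Definition proper_image (phi : K -> K) (Y : surface) (D : set point) :
    set point :=
  [set q | Y q /\ exists2 p, D p & maps_to phi p q].

Definition image_closure (phi : K -> K) (Y : surface) (D : set point) :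
    set point :=
  zariski_closure Y (proper_image phi Y D).

Definition contracts (phi : K -> K) (Y : surface) (D : set point) : Prop :=
  exists q, proper_image phi Y D = [set q].

Definition dominates (Z X : surface) : Prop :=
  forall q, Z q -> exists2 p, X p & maps_to id q p.

Definition strict_transform (Z : surface) (D : set point) : set point :=
  image_closure id Z D.

Definition placed_curve : Type := (surface * set point)%type.

Definition is_placed_curve (XD : placed_curve) : Prop :=
  elaboration XD.1 /\ irreducible_curve XD.1 XD.2.

Definition equivalent_curves (XD YE : placed_curve) : Prop :=
  exists Z : surface,
    [/\ elaboration Z, dominates Z XD.1, dominates Z YE.1 &
        strict_transform Z XD.2 = strict_transform Z YE.2].

Definition is_eta_prime (P : set placed_curve) : Prop :=
  exists2 XD, is_placed_curve XD &
    P = [set YE | is_placed_curve YE /\ equivalent_curves XD YE].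

Definition is_polar_prime (P : set placed_curve) : Prop :=
  is_eta_prime P /\ forall XD, P XD -> pole eta XD.2.

Definition sharp_image (phi : K -> K) (P Q : set placed_curve) : Prop :=
  is_eta_prime Q /\
  exists X Y D,
    [/\ P (X, D), elaboration Y, ~ contracts phi Y D &
        Q (Y, image_closure phi Y D)].

Definition torus_point (s t : C) : point :=
  local_ring (xF F - cK F s) (yF F - cK F t).

Definition torus : set point :=
  [set p | exists s t : C, [/\ s != 0, t != 0 & p = torus_point s t]].

End Geometry.

Arguments P2 {C} F.
Arguments eta {C} F.
Arguments torus {C} F.

Section LocalRings.
Variables (C : numClosedFieldType) (F : ratField C).
Local Notation K := (ratFun F).
Local Notation A := (Pol F).
Local Notation cK := (@cK C F).
Implicit Types (g h u v w : K) (P Q : A) (c d : C) (O p q : point F).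

(** A local C-algebra with residue field C: [loc_val] gives every element a value, and [locmD],
    [locmM] make the non-units an ideal. *)
Record is_loc O : Prop := IsLoc {
  locC : forall c, O (cK c);
  locD : forall g h, O g -> O h -> O (g + h);
  locM : forall g h, O g -> O h -> O (g * h);
  loc_val : forall g, O g -> exists c, has_value O g c;
  locmD : forall g h, max_ideal O g -> max_ideal O h -> max_ideal O (g + h);
  locmM : forall g h, O g -> max_ideal O h -> max_ideal O (g * h) }.

Lemma max_ideal_sub O g : max_ideal O g -> O g. Proof. by case. Qed.

Section Loc.
Variable O : point F.
Hypothesis L : is_loc O.

Lemma loc0 : O 0. Proof. by rewrite -(cK0 F); apply: locC. Qed.
Lemma loc1 : O 1. Proof. by rewrite -(cK1 F); apply: locC. Qed.
Lemma locN g : O g -> O (- g).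
Proof.
by move=> Og; rewrite -mulN1r -(cK1 F) -cKN; apply: locM => //; apply: locC.
Qed.
Lemma locB g h : O g -> O h -> O (g - h).
Proof. by move=> Og Oh; apply: locD => //; apply: locN. Qed.
Lemma locX g n : O g -> O (g ^+ n).
Proof.
move=> Og; elim: n => [|n IH]; first by rewrite expr0; apply: loc1.
by rewrite exprS; apply: locM.
Qed.
Lemma locm0 : max_ideal O 0.
Proof. by split; [exact: loc0|case; rewrite eqxx]. Qed.
Lemma locm1 : ~ max_ideal O 1.
Proof. by case=> _ []; rewrite invr1 oner_neq0; split=> //; apply: loc1. Qed.
Lemma locmN g : max_ideal O g -> max_ideal O (- g).
Proof.
by move=> Og; rewrite -mulN1r -(cK1 F) -cKN; apply: locmM => //; apply: locC.
Qed.
Lemma locmB g h : max_ideal O g -> max_ideal O h -> max_ideal O (g - h).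
Proof. by move=> Og Oh; apply: locmD => //; apply: locmN. Qed.
Lemma locmMr g h : max_ideal O g -> O h -> max_ideal O (g * h).
Proof. by move=> Og Oh; rewrite mulrC; apply: locmM. Qed.

Lemma locm_const c : max_ideal O (cK c) -> c = 0.
Proof.
case=> _ h; apply/eqP/negPn/negP => c0; apply: h; split.
  by rewrite cK_eq0.
by rewrite -cKV; apply: locC.
Qed.

Lemma loc_unit g : O g -> ~ max_ideal O g -> g != 0 /\ O g^-1.
Proof. by move=> Og h; apply: contrapT => h'; apply: h. Qed.

Lemma locm_inv g : g != 0 -> max_ideal O g -> ~ O g^-1.
Proof. by move=> g0 [_ h] h'; apply: h. Qed.

Lemma has_value_uniq g c d : has_value O g c -> has_value O g d -> c = d.
Proof.
move=> hc hd; apply/eqP; rewrite -subr_eq0; apply/eqP/locm_const.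
have -> : cK (c - d) = (g - cK d) - (g - cK c) by rewrite cKB; ring.
exact: locmB.
Qed.

Lemma has_value0 g : has_value O g 0 <-> max_ideal O g.
Proof. by rewrite /has_value cK0 subr0. Qed.

Lemma has_value_loc g c : has_value O g c -> O g.
Proof.
move=> [h _]; have -> : g = (g - cK c) + cK c by ring.
by apply: locD => //; apply: locC.
Qed.

Lemma has_valueC c : has_value O (cK c) c.
Proof. by rewrite /has_value subrr; apply: locm0. Qed.

Lemma has_valueD g h c d :
  has_value O g c -> has_value O h d -> has_value O (g + h) (c + d).
Proof.
rewrite /has_value => hc hd.
have -> : g + h - cK (c + d) = (g - cK c) + (h - cK d) by rewrite cKD; ring.
exact: locmD.
Qed.

Lemma has_valueM g h c d :
  has_value O g c -> has_value O h d -> has_value O (g * h) (c * d).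
Proof.
rewrite /has_value => hc hd.
have -> : g * h - cK (c * d) = (g - cK c) * h + cK c * (h - cK d).
  by rewrite cKM; ring.
apply: (locmD L); last by apply: locmM => //; apply: locC.
by apply: locmMr => //; apply: has_value_loc hd.
Qed.

Lemma has_valueN g c : has_value O g c -> has_value O (- g) (- c).
Proof.
move=> h; rewrite -mulN1r -[- c]mulN1r; apply: has_valueM => //.
by rewrite -(cK1 F) -cKN; apply: has_valueC.
Qed.

Lemma has_valueB g h c d :
  has_value O g c -> has_value O h d -> has_value O (g - h) (c - d).
Proof. by move=> hc hd; apply: has_valueD => //; apply: has_valueN. Qed.

Lemma has_value_unit g c : has_value O g c -> c != 0 -> g != 0 /\ O g^-1.
Proof.
move=> h c0; apply: loc_unit; first exact: has_value_loc h.
move=> /has_value0 /(has_value_uniq h) c1; by rewrite c1 eqxx in c0.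
Qed.

Lemma has_valueV g c : has_value O g c -> c != 0 -> has_value O g^-1 c^-1.
Proof.
move=> h c0; have [g0 Og] := has_value_unit h c0.
have [d hd] := loc_val L Og.
have : has_value O (g * g^-1) (c * d) by apply: has_valueM.
rewrite divff // => h1; have := has_valueC 1; rewrite cK1.
move/(has_value_uniq h1) => e; suff -> : c^-1 = d by [].
by apply: (mulfI c0); rewrite divff.
Qed.

Lemma has_valueX g c n : has_value O g c -> has_value O (g ^+ n) (c ^+ n).
Proof.
move=> h; elim: n => [|n IH]; last by rewrite !exprS; apply: has_valueM.
by rewrite !expr0 -(cK1 F); apply: has_valueC.
Qed.

Lemma sb_value u v P : max_ideal O u -> max_ideal O v ->
  has_value O (sb u v P) (ev0 P).
Proof.
move=> mu mv; elim/(@Pol_ind _ F): P => [c| | |P Q IHP IHQ|P Q IHP IHQ].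
- by rewrite sbCK ev0C; apply: has_valueC.
- by rewrite sbX ev0X; apply/has_value0.
- by rewrite sbY ev0Y; apply/has_value0.
- by rewrite sbD ev0D; apply: has_valueD.
- by rewrite sbM ev0M; apply: has_valueM.
Qed.

(** A denominator [Q(u, v)] takes the nonzero value [Q(0, 0)] in [O], so it is a unit there.
    Inclusions between points are mostly proved by this test on two coordinates. *)
Lemma local_ring_sub u v : max_ideal O u -> max_ideal O v ->
  local_ring u v `<=` O.
Proof.
move=> mu mv _ [P [Q [Q0 ->]]]; apply: locM => //.
  by apply: has_value_loc (sb_value _ mu mv).
by have [] := has_value_unit (sb_value Q mu mv) Q0.
Qed.

End Loc.

(** If [g] had another value [d] in the larger ring, then [g - d] would be a unit of the smaller
    ring and hence of the larger one. *)
Lemma loc_le_value O O' g c : is_loc O -> is_loc O' -> O `<=` O' ->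
  has_value O g c -> has_value O' g c.
Proof.
move=> L L' sO h; have [d hd] := loc_val L' (sO _ (has_value_loc L h)).
suff -> : c = d by [].
apply/eqP/negPn/negP => cd.
have h' : has_value O (g - cK d) (c - d).
  by apply: has_valueB => //; apply: has_valueC.
rewrite -subr_eq0 in cd; have [n0 /sO o] := has_value_unit L h' cd.
exact: (locm_inv n0 hd).
Qed.

Lemma loc_le_max O O' g : is_loc O -> is_loc O' -> O `<=` O' ->
  max_ideal O g -> max_ideal O' g.
Proof.
by move=> L L' s /(has_value0 O) /(loc_le_value L L' s) /has_value0.
Qed.

Section LocalRing.
Variables u v : K.
Hypothesis J : jac u v != 0.
Local Notation p := (local_ring u v).

Lemma lr_sb P : p (sb u v P).
Proof. by exists P, 1; rewrite ev0_1 oner_neq0 sb1 divr1. Qed.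

Lemma lrl : p u. Proof. by rewrite -[X in p X](sbX u v); apply: lr_sb. Qed.
Lemma lrr : p v. Proof. by rewrite -[X in p X](sbY u v); apply: lr_sb. Qed.

Lemma ev0_neq0 Q : ev0 Q != 0 -> Q != 0.
Proof. by apply: contraNneq => ->; rewrite ev0_0. Qed.

Lemma lr_max P Q : ev0 Q != 0 ->
  max_ideal p (sb u v P / sb u v Q) <-> ev0 P = 0.
Proof.
move=> Q0; split=> [[_ h]|P0].
  apply/eqP/negPn/negP => P0; apply: h; split.
    by rewrite mulf_neq0 ?invr_eq0 // sb_eq0 // ev0_neq0.
  by exists Q, P; rewrite invf_div.
split; first by exists P, Q.
move=> [n0 [P' [Q' [Q0' /eqP]]]]; rewrite invf_div.
have sP : sb u v P != 0 by apply: contraNneq n0 => ->; rewrite mul0r.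
rewrite eqr_div ?sb_eq0 ?(ev0_neq0 Q0') //; last by rewrite -(sb_eq0 _ J).
rewrite -!sbM -subr_eq0 -rmorphB sb_eq0 // subr_eq0 => /eqP/(congr1 (@ev0 _ F)).
by rewrite !ev0M P0 mulr0 => /eqP; rewrite mulf_eq0 (negPf Q0) (negPf Q0').
Qed.

Lemma lr_value P Q : ev0 Q != 0 ->
  has_value p (sb u v P / sb u v Q) (ev0 P / ev0 Q).
Proof.
move=> Q0; rewrite /has_value.
have -> : sb u v P / sb u v Q - cK (ev0 P / ev0 Q) =
  sb u v (P - cP F (ev0 P / ev0 Q) * Q) / sb u v Q.
  have h : sb u v Q != 0 by rewrite sb_eq0 // ev0_neq0.
  by rewrite sbD sbN sbM sbCK mulrBl mulfK.
by apply/lr_max => //; rewrite ev0D ev0N ev0M ev0C mulfVK // subrr.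
Qed.

Lemma lr_loc : is_loc p.
Proof.
split.
- by move=> c; rewrite -(sbCK u v); apply: lr_sb.
- move=> _ _ [P [Q [Q0 ->]]] [P' [Q' [Q0' ->]]].
  exists (P * Q' + P' * Q), (Q * Q'); rewrite ev0M mulf_neq0 //; split=> //.
  by rewrite addf_div ?sb_eq0 ?ev0_neq0 // sbD !sbM.
- move=> _ _ [P [Q [Q0 ->]]] [P' [Q' [Q0' ->]]].
  exists (P * P'), (Q * Q'); rewrite ev0M mulf_neq0 //; split=> //.
  by rewrite mulf_div !sbM.
- by move=> _ [P [Q [Q0 ->]]]; exists (ev0 P / ev0 Q); apply: lr_value.
- move=> g h mg mh; have [P [Q [Q0 eg]]] := max_ideal_sub mg.
  have [P' [Q' [Q0' eh]]] := max_ideal_sub mh; move: mg mh; rewrite eg eh !lr_max // => P0 P0'.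
  rewrite addf_div ?sb_eq0 ?ev0_neq0 // -!sbM -sbD lr_max; last first.
    by rewrite ev0M mulf_neq0.
  by rewrite ev0D !ev0M P0 P0' !mul0r addr0.
- move=> _ h [P [Q [Q0 ->]]] mh.
  have [P' [Q' [Q0' eh]]] := max_ideal_sub mh; move: mh; rewrite eh !lr_max // => P0'.
  rewrite mulf_div -!sbM lr_max; last by rewrite ev0M mulf_neq0.
  by rewrite ev0M P0' mulr0.
Qed.

Lemma lrml : max_ideal p u.
Proof.
by have := @lr_max (XP F) 1; rewrite ev0_1 oner_neq0 sbX sb1 divr1 => ->;
  rewrite ?ev0X.
Qed.
Lemma lrmr : max_ideal p v.
Proof.
by have := @lr_max (YP F) 1; rewrite ev0_1 oner_neq0 sbY sb1 divr1 => ->;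
  rewrite ?ev0Y.
Qed.

(** By induction on the polynomial, [P(u, v) - P(0, 0)] lies in the ideal generated by the
    coordinates. *)
Lemma lr_max_gen g : max_ideal p g -> exists a b, [/\ p a, p b & g = a * u + b * v].
Proof.
have gen P : exists a b, sb u v P = cK (ev0 P) + sb u v a * u + sb u v b * v.
  elim/(@Pol_ind _ F): P => [c| | |P Q [a [b e]] [a' [b' e']]|P Q [a [b e]] [a' [b' e']]].
  - by exists 0, 0; rewrite sbCK ev0C sb0; ring.
  - by exists 1, 0; rewrite sbX ev0X sb0 sb1 cK0; ring.
  - by exists 0, 1; rewrite sbY ev0Y sb0 sb1 cK0; ring.
  - by exists (a + a'), (b + b'); rewrite !sbD ev0D cKD e e'; ring.
  - exists (cP F (ev0 P) * a' + Q * a), (cP F (ev0 P) * b' + Q * b).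
    rewrite !sbD !sbM ev0M cKM !sbCK e.
    have -> : cK (ev0 Q) = sb u v Q - sb u v a' * u - sb u v b' * v.
      by rewrite e'; ring.
    ring.
move=> mg; have [P [Q [Q0 eg]]] := max_ideal_sub mg; move: mg; rewrite eg lr_max // => P0.
have [a [b e]] := gen P; exists (sb u v a / sb u v Q), (sb u v b / sb u v Q).
split; [by exists a, Q|by exists b, Q|].
by rewrite e P0 cK0 add0r mulrDl; congr (_ + _); rewrite mulrAC.
Qed.

Lemma lr_diff g : p g ->
  exists a b, [/\ p a, p b & forall w, jac g w = a * jac u w + b * jac v w].
Proof.
move=> [P [Q [Q0 ->]]]; have sQ : sb u v Q != 0 by rewrite sb_eq0 // ev0_neq0.
exists (sb u v (dP ord0 P * Q - P * dP ord0 Q) / sb u v (Q ^+ 2)).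
exists (sb u v (dP ord_max P * Q - P * dP ord_max Q) / sb u v (Q ^+ 2)).
have Q2 : ev0 (Q ^+ 2) != 0 by rewrite expr2 ev0M mulf_neq0.
split; [by eexists; eexists; split; first exact: Q2|
        by eexists; eexists; split; first exact: Q2|] => w.
rewrite jacMl jacVl // !jac_sbl !(rmorphB (sb u v)) /= expr2 !sbM.
by field.
Qed.

(** Differentials of elements of the ring are combinations of du and dv with coefficients in the
    ring ([lr_diff]). Two coordinate systems of a point therefore have Jacobians that differ by a
    unit. *)
Lemma lr_jac g h : p g -> p h -> exists2 e, p e & jac g h = e * jac u v.
Proof.
move=> /lr_diff [a [b [pa pb eg]]] /lr_diff [a' [b' [pa' pb' eh]]].
have L := lr_loc.
exists (a * b' - b * a'); first by apply: locB => //; apply: locM.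
rewrite eg [jac u h]jacC [jac v h]jacC !eh !jac_diag [jac v u]jacC; ring.
Qed.
End LocalRing.

Lemma jac_lr0 u v g h : jac u v = 0 -> local_ring u v g -> local_ring u v h ->
  jac g h = 0.
Proof.
move=> J.
have diff k : local_ring u v k -> exists a b, forall w,
    jac k w = a * jac u w + b * jac v w.
  (* For dependent [u], [v] the denominator [Q(u, v)] can vanish although [Q(0, 0)] does not; the
     quotient is then 0 by convention. *)
  move=> [P [Q [Q0 ->]]]; have [sQ|sQ] := eqVneq (sb u v Q) 0.
    by rewrite sQ invr0 mulr0; exists 0, 0 => w; rewrite jac0l !mul0r addr0.
  exists ((sb u v (dP ord0 P) * sb u v Q - sb u v P * sb u v (dP ord0 Q))
          / sb u v Q ^+ 2).
  exists ((sb u v (dP ord_max P) * sb u v Q - sb u v P * sb u v (dP ord_max Q))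
          / sb u v Q ^+ 2).
  by move=> w; rewrite jacMl jacVl // !jac_sbl; field.
move=> /diff [a [b eg]] /diff [a' [b' eh]].
rewrite eg [jac u h]jacC [jac v h]jacC !eh !jac_diag [jac v u]jacC J; ring.
Qed.

(** Since [local_ring u v] makes sense for all [u], [v], genuine points are singled out by a nonzero
    Jacobian. By [good_jac] it is nonzero for every pair presenting the same ring, in particular for
    the pair that a blowup uses. *)
Definition good p := exists u v, jac u v != 0 /\ p = local_ring u v.

Lemma good_loc p : good p -> is_loc p.
Proof. by move=> [u [v [J ->]]]; apply: lr_loc. Qed.

Lemma good_jac u v : good (local_ring u v) -> jac u v != 0.
Proof.
move=> [u' [v' [J' e]]]; apply: contra_neq J' => J.
by apply: (jac_lr0 J); rewrite e; [apply: lrl|apply: lrr].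
Qed.

Lemma good_jac_unit u v u' v' : jac u v != 0 ->
  local_ring u v = local_ring u' v' ->
  exists e, [/\ e != 0, local_ring u v e, local_ring u v e^-1 &
    jac u' v' = e * jac u v].
Proof.
move=> J E; have J' : jac u' v' != 0.
  by apply: good_jac; rewrite -E; exists u, v.
have [e pe je] : exists2 e, local_ring u v e & jac u' v' = e * jac u v.
  by apply: lr_jac => //; rewrite E; [apply: lrl|apply: lrr].
have [e' pe' je'] : exists2 e, local_ring u v e & jac u v = e * jac u' v'.
  by rewrite E; apply: lr_jac => //; rewrite -E; [apply: lrl|apply: lrr].
have ee : e' * e = 1.
  by apply: (mulIf J); rewrite mul1r -mulrA -je -je'.
have e0 : e != 0 by apply: contraTneq (oner_neq0 K) => e0; rewrite -ee e0 mulr0 eqxx.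
by exists e; split=> //; rewrite -[e^-1]mul1r -ee mulfK.
Qed.

Lemma lr_eq u v u' v' : jac u v != 0 -> jac u' v' != 0 ->
  max_ideal (local_ring u v) u' -> max_ideal (local_ring u v) v' ->
  max_ideal (local_ring u' v') u -> max_ideal (local_ring u' v') v ->
  local_ring u v = local_ring u' v'.
Proof.
move=> J J' *; apply/seteqP; split; apply: local_ring_sub => //; exact: lr_loc.
Qed.

End LocalRings.

(** * Infinitely near points and blowups *)

Section Towers.
Variables (C : numClosedFieldType) (F : ratField C).
Local Notation K := (ratFun F).
Local Notation A := (Pol F).
Local Notation cK := (@cK C F).
Local Notation xF := (xF F).
Local Notation yF := (yF F).
Implicit Types (g h u v w : K) (P Q : A) (c d : C) (O p q z : point F).
Implicit Types (X Y Z : surface F).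

Lemma jac_neq0l u v : jac u v != 0 -> u != 0.
Proof. by apply: contra_neq => ->; rewrite jac0l. Qed.
Lemma jac_neq0r u v : jac u v != 0 -> v != 0.
Proof. by apply: contra_neq => ->; rewrite jac0r. Qed.

Lemma jacBcl u v c : jac (u - cK c) v = jac u v.
Proof. by rewrite jacDl jacNl jacCl oppr0 addr0. Qed.
Lemma jacBcr u v c : jac u (v - cK c) = jac u v.
Proof. by rewrite jacDr jacNr jacCr oppr0 addr0. Qed.

Lemma jac_chart1 u v c : u != 0 -> jac u (v / u - cK c) = jac u v / u.
Proof. by move=> u0; rewrite jacBcr jacMr jacVr // jac_diag; field. Qed.
Lemma jac_chart2 u v : v != 0 -> jac (u / v) v = jac u v / v.
Proof. by move=> v0; rewrite jacMl jacVl // jac_diag; field. Qed.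

Lemma xF0 : xF != 0.
Proof. by apply: (@jac_neq0l _ yF); rewrite jac_xy oner_neq0. Qed.
Lemma yF0 : yF != 0.
Proof. by apply: (@jac_neq0r xF); rewrite jac_xy oner_neq0. Qed.

Definition child u v q : Prop :=
  (exists c : C, q = local_ring u (v / u - cK c)) \/ q = local_ring (u / v) v.

Lemma child_good u v q : jac u v != 0 -> child u v q -> good q.
Proof.
move=> J; have u0 := jac_neq0l J; have v0 := jac_neq0r J.
case=> [[c ->]|->].
  exists u, (v / u - cK c); split=> //.
  by rewrite jac_chart1 // mulf_neq0 ?invr_eq0.
by exists (u / v), v; split=> //; rewrite jac_chart2 // mulf_neq0 ?invr_eq0.
Qed.

Lemma child1_value u v c : jac u v != 0 ->
  let q := local_ring u (v / u - cK c) in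
  [/\ is_loc q, max_ideal q u, has_value q (v / u) c & max_ideal q v].
Proof.
move=> J q; have u0 := jac_neq0l J.
have J' : jac u (v / u - cK c) != 0.
  by rewrite jac_chart1 // mulf_neq0 ?invr_eq0.
have L : is_loc q by apply: lr_loc.
have mu : max_ideal q u by apply: lrml.
have hv : has_value q (v / u) c by apply: lrmr.
split=> //; have -> : v = (v / u) * u by rewrite mulfVK.
by apply: locmM => //; apply: has_value_loc hv.
Qed.

Lemma child2_value u v : jac u v != 0 ->
  let q := local_ring (u / v) v in
  [/\ is_loc q, max_ideal q u, max_ideal q (u / v) & max_ideal q v].
Proof.
move=> J q; have v0 := jac_neq0r J.
have J' : jac (u / v) v != 0 by rewrite jac_chart2 // mulf_neq0 ?invr_eq0.
have L : is_loc q by apply: lr_loc.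
have mv : max_ideal q v by apply: lrmr.
have hu : max_ideal q (u / v) by apply: lrml.
split=> //; have -> : u = (u / v) * v by rewrite mulfVK.
by apply: locmM => //; apply: max_ideal_sub hu.
Qed.

Lemma child_sub u v q : jac u v != 0 -> child u v q -> local_ring u v `<=` q.
Proof.
move=> J [[c ->]|->].
  by have [L mu _ mv] := child1_value c J; apply: local_ring_sub.
by have [L mu _ mv] := child2_value J; apply: local_ring_sub.
Qed.

(** The direction is determined by [O]: it is the value of [v / u] there, or infinity if [u / v] is
    a non-unit. *)
Lemma child_sep u v q q' O : jac u v != 0 -> is_loc O ->
  child u v q -> child u v q' -> q `<=` O -> q' `<=` O -> q = q'.
Proof.
move=> J LO; have u0 := jac_neq0l J; have v0 := jac_neq0r J.
have absurd12 c : local_ring u (v / u - cK c) `<=` O ->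
    local_ring (u / v) v `<=` O -> False.
  move=> s s'.
  have [L _ /has_value_loc h _] := child1_value c J.
  have [L' _ h' _] := child2_value J.
  apply: (locm_inv _ (loc_le_max L' LO s' h')).
    by rewrite mulf_neq0 ?invr_eq0.
  by rewrite invf_div; apply: s; apply: h.
case=> [[c ->]|->] [[d ->]|->] // s s'.
- have [L _ h _] := child1_value c J.
  have [L' _ h' _] := child1_value d J.
  rewrite (has_value_uniq LO (loc_le_value L LO s h) (loc_le_value L' LO s' h')) //.
- by case: (absurd12 c).
- by case: (absurd12 d).
Qed.

(** At an exceptional point [q] the ideal of the center becomes principal, generated by [s], one of
    [u] and [v]. Expressing [s] by [u'] and [v'] shows that [u' / v'] or [v' / u'] is regular at
    [q], and its value selects a point of the blowup in the new coordinates. *)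
Lemma child_sub_change u v u' v' q : jac u v != 0 -> jac u' v' != 0 ->
  local_ring u v = local_ring u' v' -> child u v q ->
  exists2 q', child u' v' q' & q' `<=` q.
Proof.
move=> J J' E ch; have Lq := good_loc (child_good J ch).
have L : is_loc (local_ring u v) by apply: lr_loc.
have sq := child_sub J ch.
have mu' : max_ideal q u'.
  by apply: (loc_le_max L Lq sq); rewrite E; apply: lrml.
have mv' : max_ideal q v'.
  by apply: (loc_le_max L Lq sq); rewrite E; apply: lrmr.
have u0 := jac_neq0l J; have v0 := jac_neq0r J.
have u0' := jac_neq0l J'; have v0' := jac_neq0r J'.
have [s es [us vs]] : exists2 s, s = u \/ s = v & q (u / s) /\ q (v / s).
  case: ch => [[c ->]|->].
    have [? _ h _] := child1_value c J.
    exists u; [by left|split; last exact: has_value_loc h].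
    by rewrite divff //; apply: loc1.
  have [? _ h _] := child2_value J.
  exists v; [by right|split; first exact: max_ideal_sub h].
  by rewrite divff //; apply: loc1.
have s0 : s != 0 by case: es => ->.
have ms : max_ideal (local_ring u v) s.
  by case: es => ->; [apply: lrml|apply: lrmr].
have div g : max_ideal (local_ring u v) g -> q (g / s).
  move=> /(lr_max_gen J) [a [b [pa pb ->]]].
  by rewrite mulrDl -!mulrA; apply: (locD Lq); apply: (locM Lq) => //; apply: sq.
have u's : q (u' / s) by apply: div; rewrite E; apply: lrml.
have v's : q (v' / s) by apply: div; rewrite E; apply: lrmr.
(* [u' / s] and [v' / s] cannot both vanish at [q], because [s] is a combination of [u'] and
   [v']. *)
have nm : ~ (max_ideal q (u' / s) /\ max_ideal q (v' / s)).
  move=> [mu1 mv1]; apply: (locm1 Lq).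
  move: ms; rewrite E => /(lr_max_gen J') [a [b [pa pb e]]].
  have -> : 1 = a * (u' / s) + b * (v' / s).
    by rewrite !mulrA -mulrDl -e divff.
  rewrite -E in pa pb.
  by apply: (locmD Lq); apply: (locmM Lq) => //; apply: sq.
have [m1|m1] := pselect (max_ideal q (u' / s)).
  have [_ i2] := loc_unit v's (fun m2 => nm (conj m1 m2)).
  exists (local_ring (u' / v') v'); first by right.
  apply: local_ring_sub => //.
  have -> : u' / v' = (u' / s) * (v' / s)^-1 by field; rewrite s0 v0'.
  exact: locmMr.
have [_ i1] := loc_unit u's m1.
have h : q (v' / u').
  have -> : v' / u' = (v' / s) * (u' / s)^-1 by field; rewrite s0 u0'.
  exact: locM.
have [c hc] := loc_val Lq h.
exists (local_ring u' (v' / u' - cK c)); first by left; exists c.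
exact: local_ring_sub.
Qed.

(** Changing coordinates and back yields inclusions of [q2] in [q'] and of [q'] in [q]. As [q2] and
    [q] are exceptional in the same coordinates, [child_sep] makes all three equal. *)
Lemma child_change u v u' v' q : jac u v != 0 ->
  local_ring u v = local_ring u' v' -> child u v q -> child u' v' q.
Proof.
move=> J E ch; have J' : jac u' v' != 0.
  by apply: good_jac; rewrite -E; exists u, v.
have [q' ch' s] := child_sub_change J J' E ch.
have [q2 ch2 s2] := child_sub_change J' J (esym E) ch'.
have e : q2 = q.
  apply: (child_sep J (good_loc (child_good J ch)) ch2 ch) => //.
  exact: subset_trans s2 s.
suff -> : q = q' by [].
by apply/seteqP; split=> //; rewrite -e.
Qed.

Lemma blowup_change X u v u' v' : jac u v != 0 ->
  local_ring u v = local_ring u' v' -> blowup X u v = blowup X u' v'.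
Proof.
move=> J E; have J' : jac u' v' != 0.
  by apply: good_jac; rewrite -E; exists u, v.
rewrite /blowup -E; congr (_ `|` _); apply/seteqP; split=> q.
- exact: (child_change J E).
- exact: (child_change J' (esym E)).
Qed.

Lemma P2_good p : P2 F p -> good p.
Proof.
have x0 := xF0; have y0 := yF0.
move=> [a [b [->|->|->]]]; eexists; eexists; (split; last by []).
- by rewrite jacBcl jacBcr jac_xy oner_neq0.
- rewrite jacBcl jacBcr jacMr !jacVl // !jacVr // jac_diag jac_xy.
  rewrite (_ : _ + _ = - xF ^- 3) ?oppr_eq0 ?invr_eq0 ?expf_neq0 //.
  by field.
- rewrite jacBcl jacBcr jacMr !jacVl // !jacVr // jac_diag jacC jac_xy.
  rewrite (_ : _ + _ = yF ^- 3) ?oppr_eq0 ?invr_eq0 ?expf_neq0 //.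
  by field.
Qed.

Lemma loc_inv_in p O g : is_loc p -> is_loc O -> p `<=` O -> g != 0 ->
  p g -> O g^-1 -> p g^-1.
Proof.
move=> L LO s g0 pg Og; have [m|m] := pselect (max_ideal p g).
  by case: (locm_inv g0 (loc_le_max L LO s m)).
by have [] := loc_unit pg m.
Qed.

Lemma lr_sub_in p O u v : is_loc O -> is_loc p -> p `<=` O -> jac u v != 0 ->
  local_ring u v `<=` O -> p u -> p v -> local_ring u v `<=` p.
Proof.
move=> LO L s J s' pu pv; have L' := lr_loc J.
have in_m g : max_ideal (local_ring u v) g -> p g -> max_ideal p g.
  move=> m pg; have [c hc] := loc_val L pg.
  have := loc_le_value L LO s hc.
  move/(has_value_uniq LO ((has_value0 O g).2 (loc_le_max L' LO s' m))) => e.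
  by apply/(has_value0 p); rewrite e.
apply: local_ring_sub => //; apply: in_m => //; [exact: lrml|exact: lrmr].
Qed.

(** The valuative form of separatedness, with local rings [O] in place of valuation rings. *)
Definition separated X := forall O p q, is_loc O -> X p -> X q ->
  p `<=` O -> q `<=` O -> p = q.

Lemma separated_incl X p q : separated X -> good q -> X p -> X q ->
  p `<=` q -> p = q.
Proof. by move=> S G Xp Xq s; apply: (S q) => //; apply: good_loc. Qed.

Lemma locBK p g c : is_loc p -> p (g - cK c) -> p g.
Proof.
move=> L h; have -> : g = (g - cK c) + cK c by ring.
by apply: (locD L) => //; apply: locC.
Qed.

Lemma P2_separated : separated (P2 F).
Proof.
move=> O p q LO Xp Xq s s'.
have Gp := P2_good Xp; have Gq := P2_good Xq.
have Lp := good_loc Gp; have Lq := good_loc Gq.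
have x0 := xF0; have y0 := yF0.
(* The coordinates of the chart of [q] are monomials in those of the chart of [p]. Factors that
   occur inverted are units of [O], hence of [p] by [loc_inv_in]. *)
suff sub : forall p q, P2 F p -> P2 F q -> p `<=` O -> q `<=` O -> q `<=` p.
  by apply/seteqP; split; apply: sub.
move=> {p q Xp Xq s s' Gp Gq Lp Lq} p q Xp Xq s s'.
have Gp := P2_good Xp; have Gq := P2_good Xq.
have Lp := good_loc Gp; have Lq := good_loc Gq.
have Cp c : p (cK c) by apply: locC.
have inv g : g != 0 -> p g -> O g^-1 -> p g^-1 by apply: loc_inv_in.
have mul g h : p g -> p h -> p (g * h) by apply: locM.
have sub2 u v a b : q = local_ring (u - cK a) (v - cK b) -> p u -> p v ->
    q `<=` p.
  move=> E pu pv; have J : jac (u - cK a) (v - cK b) != 0.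
    by apply: good_jac; rewrite -E.
  by rewrite E; apply: (lr_sub_in LO) => //; rewrite -?E //; apply: locB.
have coord u v a b r : r = local_ring (u - cK a) (v - cK b) -> good r ->
    r u /\ r v.
  move=> E G; have J : jac (u - cK a) (v - cK b) != 0.
    by apply: good_jac; rewrite -E.
  have L := good_loc G.
  by split; apply: (locBK (c := _) L); rewrite E; [exact: lrl|exact: lrr].
case: Xp => a [b Ep]; case: Xq => c [d Eq].
have [p1|p2|p3] : [\/ p xF /\ p yF, p xF^-1 /\ p (yF / xF)
    | p yF^-1 /\ p (xF / yF)].
- case: Ep => Ep; [apply: Or31|apply: Or32|apply: Or33]; exact: coord Ep Gp.
- case: p1 => px py; case: Eq => Eq; have [qu qv] := coord _ _ _ _ _ Eq Gq;
    apply: (sub2 _ _ _ _ Eq) => //.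
  + exact: inv (s' _ qu).
  + by apply: (mul) => //; apply: inv (s' _ qu).
  + exact: inv (s' _ qu).
  + by apply: (mul) => //; apply: inv (s' _ qu).
- case: p2 => px py; case: Eq => Eq; have [qu qv] := coord _ _ _ _ _ Eq Gq;
    apply: (sub2 _ _ _ _ Eq) => //.
  + by rewrite -[xF]invrK; apply: inv; rewrite ?invr_eq0 ?invrK //; apply: s'.
  + rewrite (_ : yF = (yF / xF) * xF^-1^-1); last by rewrite invrK mulfVK.
    by apply: (mul) => //; apply: inv; rewrite ?invr_eq0 ?invrK //; apply: s'.
  + rewrite (_ : yF^-1 = xF^-1 * (yF / xF)^-1); last by field; rewrite x0 y0.
    apply: (mul) => //; apply: inv => //; first by rewrite mulf_neq0 ?invr_eq0.
    by rewrite invf_div; apply: s'.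
  + rewrite -invf_div; apply: inv => //; first by rewrite mulf_neq0 ?invr_eq0.
    by rewrite invf_div; apply: s'.
- case: p3 => px py; case: Eq => Eq; have [qu qv] := coord _ _ _ _ _ Eq Gq;
    apply: (sub2 _ _ _ _ Eq) => //.
  + rewrite (_ : xF = (xF / yF) * yF^-1^-1); last by rewrite invrK mulfVK.
    by apply: (mul) => //; apply: inv; rewrite ?invr_eq0 ?invrK //; apply: s'.
  + by rewrite -[yF]invrK; apply: inv; rewrite ?invr_eq0 ?invrK //; apply: s'.
  + rewrite (_ : xF^-1 = yF^-1 * (xF / yF)^-1); last by field; rewrite x0 y0.
    apply: (mul) => //; apply: inv => //; first by rewrite mulf_neq0 ?invr_eq0.
    by rewrite invf_div; apply: s'.
  + rewrite -invf_div; apply: inv => //; first by rewrite mulf_neq0 ?invr_eq0.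
    by rewrite invf_div; apply: s'.
Qed.

(* Points infinitely near to points of P^2, with their level *)
Inductive node : nat -> point F -> Prop :=
| node0 p : P2 F p -> node 0 p
| nodeS n u v q : node n (local_ring u v) -> child u v q -> node n.+1 q.

Lemma node_good n p : node n p -> good p.
Proof.
elim=> [q /P2_good//|{}n u v q _ G ch].
exact: child_good (good_jac G) ch.
Qed.

Lemma node_loc n p : node n p -> is_loc p.
Proof. by move=> /node_good/good_loc. Qed.

(** The predecessors agree by induction, and [child_sep] decides among the points of one exceptional
    curve. *)
Lemma node_uniq n a b O : is_loc O -> node n a -> node n b ->
  a `<=` O -> b `<=` O -> a = b.
Proof.
move=> LO; elim: n a b => [|n IH] a b na nb.
  inversion na; inversion nb; subst; exact: P2_separated.
inversion na as [|? u v ? na' cha]; inversion nb as [|? u' v' ? nb' chb]; subst.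
move=> sa sb.
have J := good_jac (node_good na'); have J' := good_jac (node_good nb').
have E : local_ring u v = local_ring u' v'.
  by apply: IH => //; [apply: subset_trans sa|apply: subset_trans sb];
    apply: child_sub.
exact: child_sep (child_change J' (esym E) chb) sa sb.
Qed.

Lemma node_anc n p k : node n p -> (k <= n)%N -> exists2 a, node k a & a `<=` p.
Proof.
elim=> [q Xq|{}n u v q nn IH ch].
  by rewrite leqn0 => /eqP ->; exists q => //; apply: node0.
rewrite leq_eqVlt => /orP[/eqP ->|]; first by exists q => //; apply: nodeS ch.
rewrite ltnS => /IH [a na s]; exists a => //; apply: subset_trans s _.
exact: child_sub (good_jac (node_good nn)) ch.
Qed.

(* The step in the factorization of a birational morphism into blowups *)
Lemma node_child n m z u v : node n z -> node m (local_ring u v) ->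
  local_ring u v `<=` z -> z <> local_ring u v ->
  exists2 q, child u v q & q `<=` z.
Proof.
move=> nz nw s ne; have J := good_jac (node_good nw).
have [mn|nm] := ltnP m n.
  have [b nb sb] := node_anc nz mn.
  inversion nb as [|? u' v' ? nb' chb]; subst.
  have J' := good_jac (node_good nb').
  have E : local_ring u v = local_ring u' v'.
    apply: (node_uniq (node_loc nz) nw nb') => //.
    by apply: subset_trans sb; apply: child_sub.
  by exists b => //; apply: child_change (esym E) chb.
have [a na sa] := node_anc nw nm.
have E : a = z by apply: (node_uniq (node_loc nz) na nz) => //;
  apply: subset_trans sa s.
by case: ne; apply/seteqP; split=> //; rewrite -E.
Qed.

Section Tower.
Variable adm : point F -> Prop.

Lemma tower_node X p : blowup_tower adm X -> X p -> exists n, node n p.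
Proof.
move=> T; elim: T p => [p Xp|{}X u v T IH Xo _ p]; first by exists 0%N; apply: node0.
have [n no] := IH _ Xo.
by case=> [[/IH//]|ch]; exists n.+1; apply: nodeS ch.
Qed.

Lemma tower_good X p : blowup_tower adm X -> X p -> good p.
Proof. by move=> T Xp; have [n /node_good] := tower_node T Xp. Qed.

Lemma tower_loc X p : blowup_tower adm X -> X p -> is_loc p.
Proof. by move=> T Xp; apply: good_loc (tower_good T Xp). Qed.

Lemma tower_separated X : blowup_tower adm X -> separated X.
Proof.
elim=> [|{}X u v T S Xo _]; first exact: P2_separated.
have J := good_jac (tower_good T Xo).
move=> O p q LO [[Xp np]|chp] [[Xq nq]|chq] sp sq.
- exact: (S O).
- case: np; apply: (S O) => //.
  by apply: subset_trans sq; apply: child_sub.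
- case: nq; apply: (S O) => //.
  by apply: subset_trans sp; apply: child_sub.
- exact: child_sep chp chq sp sq.
Qed.

(** The list [l] collects the centers blown up on the way to [Z]. By [node_child] a point strictly
    above a center lies above a point of its exceptional curve. *)
Lemma tower_cover Z : blowup_tower adm Z ->
  exists l : seq (point F), forall n p, node n p ->
    p \in l \/ exists2 z, Z z & z `<=` p.
Proof.
elim=> [|{}Z u v T [l IH] Xo _].
  exists [::] => n p np; right; have [a na s] := node_anc np (leq0n n).
  by exists a => //; inversion na.
exists (local_ring u v :: l) => n p np; rewrite in_cons.
have [pl|[z Zz s]] := IH _ _ np; first by rewrite pl orbT; left.
have [E|ne] := pselect (z = local_ring u v); last by right; exists z => //; left.
have [E'|ne'] := pselect (p = local_ring u v); first by rewrite E' eqxx; left.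
have [m no] := tower_node T Xo.
have so : local_ring u v `<=` p by rewrite -E.
right; have [q ch sq] := node_child np no so ne'.
by exists q => //; right.
Qed.

End Tower.

Lemma maps_to_id p q : is_loc p -> is_loc q -> maps_to id p q <-> q `<=` p.
Proof.
move=> L L'; split=> [[] //|s]; split=> // g; exact: loc_le_max.
Qed.

Lemma tower_dominates X Z : modification Z -> modification X ->
  dominates Z X <-> forall q, Z q -> exists2 p, X p & p `<=` q.
Proof.
move=> TZ TX; split=> D q Zq; have [p Xp h] := D q Zq; exists p => //.
  by case: h.
by apply/maps_to_id => //; [apply: tower_loc TZ Zq|apply: tower_loc TX Xp].
Qed.

Lemma tower_join X Y : modification X -> modification Y ->
  exists Z, [/\ modification Z, Z `<=` X `|` Y,
    forall q, Z q -> exists2 p, X p & p `<=` q &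
    forall q, Z q -> exists2 p, Y p & p `<=` q].
Proof.
move=> TX; elim=> [|{}Y u v TY [Z [TZ ZXY ZX ZY]] Yo _].
  exists X; split; [exact: TX|by move=> q Xq; left|by move=> q Xq; exists q|].
  move=> q /(tower_node TX) [n nq].
  have [a na s] := node_anc nq (leq0n n).
  by exists a => //; inversion na.
have [n no] := tower_node TY Yo; have J := good_jac (node_good no).
have [Zo|nZo] := pselect (Z (local_ring u v)).
  exists (blowup Z u v); split.
  - exact: tower_blowup.
  - by move=> q [[/ZXY [Xq|Yq] nq]|ch]; [left|right; left|right; right].
  - move=> q [[/ZX//]|ch]; have [p Xp s] := ZX _ Zo.
    by exists p => //; apply: subset_trans s _; apply: child_sub.
  - move=> q [[Zq nq]|ch]; last by exists q => //; right.
    have [p Yp s] := ZY _ Zq; exists p => //; left; split=> // E.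
    apply: nq; rewrite -E /= in Zo *.
    by apply: esym; apply: (separated_incl (tower_separated TZ)) => //;
      apply: tower_good TZ Zq.
exists Z; split=> //.
  by move=> q Zq; case: (ZXY _ Zq) => [Xq|Yq]; [left|right; left; split=> // E;
    apply: nZo; rewrite -E].
move=> q Zq; have [p Yp s] := ZY _ Zq.
have [E|ne] := pselect (p = local_ring u v); last by exists p => //; left.
have nq : q <> local_ring u v by move=> E'; apply: nZo; rewrite -E'.
have [m nq'] := tower_node TZ Zq.
have so : local_ring u v `<=` q by rewrite -E.
have [a ch sa] := node_child nq' no so nq.
by exists a => //; right.
Qed.

End Towers.

(** * Curves and their local rings *)

Section Curves.
Variables (C : numClosedFieldType) (F : ratField C).
Local Notation K := (ratFun F).
Implicit Types (g h : K) (p q : point F) (X Y Z : surface F).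
Implicit Types (D E S : set (point F)) (s : seq K) (l : seq (point F)).

(** The finite lists [s] index the basic open sets of the Zariski topology. *)
Definition all_in p s := forall g, g \in s -> p g.

Lemma all_in_cat p s1 s2 : all_in p (s1 ++ s2) <-> all_in p s1 /\ all_in p s2.
Proof.
split=> [h|[h1 h2] g]; last by rewrite mem_cat => /orP[/h1|/h2].
by split=> g gs; apply: h; rewrite mem_cat gs ?orbT.
Qed.

Lemma all_in1 p g : all_in p [:: g] <-> p g.
Proof.
split=> [h|pg h]; first by apply: h; rewrite inE.
by rewrite inE => /eqP ->.
Qed.

Lemma zclosed_all_in X D s : zariski_closed X D ->
  zariski_closed X [set p | D p /\ ~ all_in p s].
Proof.
move=> [DX [_ o]]; split; first by move=> p [/DX].
split=> [p []//|p [Xp np]]; have [Dp|nD] := pselect (D p).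
  have h : all_in p s by apply: contrapT => h; apply: np.
  by exists s; split=> // q Xq hq; split=> // -[_ ].
have [t [pt ot]] := o p (conj Xp nD).
by exists t; split=> // q Xq /(ot _ Xq) [_ nDq]; split=> // -[].
Qed.

Lemma zclosedU X D E : zariski_closed X D -> zariski_closed X E ->
  zariski_closed X (D `|` E).
Proof.
move=> [DX [_ oD]] [EX [_ oE]]; split; first by move=> p [/DX|/EX].
split=> [p []//|p [Xp np]].
have [|s [ps os]] := oD p; first by split=> // Dp; apply: np; left.
have [|t [pt ot]] := oE p; first by split=> // Dp; apply: np; right.
exists (s ++ t); split; first exact/all_in_cat.
move=> q Xq /all_in_cat [/(os _ Xq) [_ n1] /(ot _ Xq) [_ n2]].
by split=> // -[].
Qed.

Lemma zclosed0 X : zariski_closed X set0.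
Proof.
split=> [p []|]; split=> [p []//|p [Xp _]].
by exists [::]; split=> // q Xq _; split=> // -[].
Qed.

Definition all_good X := forall p, X p -> good p.

Lemma zclosed1 X p : separated X -> all_good X -> X p ->
  zariski_closed X [set p].
Proof.
move=> S G Xp; split=> [_ ->//|]; split=> [q []//|q [Xq nq]].
have [g qg pg] : exists2 g, q g & ~ p g.
  apply: contrapT => h; apply: nq; apply: (separated_incl S (G _ Xp) Xq Xp).
  by move=> g qg; apply: contrapT => pg; apply: h; exists g.
exists [:: g]; split; first by apply/all_in1.
by move=> r Xr /all_in1 rg; split=> // E; apply: pg; rewrite -E.
Qed.

Lemma zclosed_seq X l : separated X -> all_good X ->
  zariski_closed X [set p | X p /\ p \in l].
Proof.
move=> S G; elim: l => [|q l IH].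
  rewrite (_ : [set _ | _] = set0); first exact: zclosed0.
  by apply/seteqP; split=> p // -[].
have [Xq|nXq] := pselect (X q).
  rewrite (_ : [set _ | _] = [set q] `|` [set p | X p /\ p \in l]).
    by apply: zclosedU => //; apply: zclosed1.
  apply/seteqP; split=> p /=; rewrite inE.
    by case=> Xp /orP[/eqP ->|pl]; [left|right].
  by case=> [->|[Xp ->]]; rewrite ?eqxx ?orbT.
rewrite (_ : [set _ | _] = [set p | X p /\ p \in l]) //.
apply/seteqP; split=> p /= [Xp]; rewrite ?inE => h; split=> //.
  by case/orP: h => // /eqP e; case: nXq; rewrite -e.
by rewrite h orbT.
Qed.

Lemma zclosureP X S p : S `<=` X ->
  zariski_closure X S p <->
  X p /\ forall s, all_in p s -> exists2 q, S q & all_in q s.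
Proof.
move=> SX; split=> [[Xp h]|[Xp h]]; split=> //.
  move=> s ps; apply: contrapT => n.
  have cl : zariski_closed X [set q | X q /\ ~ all_in q s].
    apply: zclosed_all_in; split=> //; split=> [q []//|q []//].
  case: (h _ cl) => [q Sq|_]; last by apply.
  by split; [apply: SX|move=> qs; apply: n; exists q].
move=> Z [ZX [_ o]] SZ; apply: contrapT => nZ.
have [s [ps os]] := o p (conj Xp nZ).
have [q Sq qs] := h s ps.
by have [_] := os q (SX _ Sq) qs; apply; apply: SZ.
Qed.

(* The local ring of the generic point of D *)
Definition ring_of D : set K := [set g | exists2 p, D p & p g].

Definition infinite_pts D := forall l, exists2 p, D p & p \notin l.

Section Irreducible.
Variables (X : surface F) (D : set (point F)).
Hypothesis I : irreducible_closed X D.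

Lemma irr_sub : D `<=` X. Proof. by case: I => -[]. Qed.

(** Nonempty open subsets of an irreducible set meet, so functions each defined somewhere on [D] are
    defined at a common point. This is why [ring_of D] is closed under products. *)
Lemma irr_dir s : (forall g, g \in s -> ring_of D g) ->
  exists2 p, D p & all_in p s.
Proof.
case: I => cD [p0 Dp0] irr; elim: s => [|g s IH] h; first by exists p0.
have [|p Dp ps] := IH; first by move=> f fs; apply: h; rewrite inE fs orbT.
have [q Dq qg] : ring_of D g by apply: h; rewrite inE eqxx.
apply: contrapT => n.
have := irr _ _ (zclosed_all_in [:: g] cD) (zclosed_all_in s cD).
case=> [r Dr|/(_ _ Dq) [_]|/(_ _ Dp) [_]].
- have [rg|rg] := pselect (r g); last by left; split=> // /all_in1.
  right; split=> // rs; apply: n; exists r => // f.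
  by rewrite inE => /orP[/eqP ->|/rs].
- by apply; apply/all_in1.
- by apply.
Qed.

(** A point outside the closed set [D] has a basic neighbourhood that misses [D]; if its functions
    all belonged to the ring of [D], then [irr_dir] would give a point of [D] in it. *)
Lemma irr_char : D = [set p | X p /\ p `<=` ring_of D].
Proof.
case: (I) => -[DX [_ o]] _ _; apply/seteqP; split=> p.
  by move=> Dp; split; [apply: DX|move=> g pg; exists p].
move=> [Xp h]; apply: contrapT => nD.
have [s [ps os]] := o p (conj Xp nD).
have [q Dq qs] : exists2 q, D q & all_in q s by apply: irr_dir => g /ps /h.
by have [_] := os q (DX _ Dq) qs.
Qed.

Hypotheses (S : separated X) (G : all_good X).

Lemma irr_dir_avoid l s : infinite_pts D ->
  (forall g, g \in s -> ring_of D g) ->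
  exists p, [/\ D p, p \notin l & all_in p s].
Proof.
move=> inf hs; have [p Dp ps] := irr_dir hs.
have [q Dq ql] := inf l.
case: I => cD [p0 Dp0] irr; apply: contrapT => n.
have := irr _ _ (zclosed_seq l S G) (zclosed_all_in s cD).
case=> [r Dr|/(_ _ Dq) [_]|/(_ _ Dp) [_]].
- have [rl|rl] := boolP (r \in l); first by left; split=> //; apply: irr_sub.
  by right; split=> // rs; apply: n; exists r.
- by rewrite (negPf ql).
- by apply.
Qed.

Lemma irr_infinite : (forall p, D <> [set p]) -> infinite_pts D.
Proof.
move=> npt l; apply: contrapT => n.
have Dl p : D p -> p \in l.
  by move=> Dp; apply/negPn/negP => pl; apply: n; exists p.
have [cD [p0 Dp0] irr] := I.
have key l' : (exists2 p, D p & p \notin l') \/ exists2 p, p \in l' & D `<=` [set p].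
  elim: l' => [|q l' [[p Dp pl]|[p pl Dp]]].
  - by left; exists p0.
  - have [Dq|nDq] := pselect (D q); last first.
      left; exists p => //; rewrite inE negb_or pl andbT.
      by apply: contra_notN nDq => /eqP <-.
    have [sub|nsub] := pselect (D `<=` [set q] `|` [set r | X r /\ r \in l']).
      have c1 : zariski_closed X [set q] by apply: zclosed1 => //; apply: irr_sub.
      have [h|h] := irr _ _ c1 (zclosed_seq l' S G) sub.
        by right; exists q => //; rewrite inE eqxx.
      by have [_] := h _ Dp; rewrite (negPf pl).
    left; apply: contrapT => h; apply: nsub => r Dr.
    have [rq|rq] := eqVneq r q; first by left.
    right; split; first exact: irr_sub.
    apply/negPn/negP => rl; apply: h; exists r => //.
    by rewrite inE negb_or rq.
  - by right; exists p => //; rewrite inE pl orbT.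
have [[p Dp pl]|[p pl Dp]] := key l; first by apply: n; exists p.
apply: (npt p); apply/seteqP; split=> // _ ->.
by have e := Dp _ Dp0; rewrite -e.
Qed.

End Irreducible.

Lemma irr_proper X D : irreducible_closed X D -> all_good X -> D <> X ->
  exists g, ~ ring_of D g.
Proof.
move=> I G ne; apply: contrapT => n; apply: ne; rewrite (irr_char I).
apply/seteqP; split=> [p []//|p Xp]; split=> // g _.
by apply: contrapT => h; apply: n; exists g.
Qed.

Lemma placed_tower (XD : placed_curve F) : is_placed_curve XD ->
  [/\ modification XD.1, separated XD.1, all_good XD.1,
      irreducible_closed XD.1 XD.2 & infinite_pts XD.2].
Proof.
move=> [[T _] [I _ np]].
have S := tower_separated T; have G : all_good XD.1 by move=> p; apply: tower_good T.
by split=> //; apply: irr_infinite I S G np.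
Qed.

Section Domination.
Variables (X Z : surface F) (D : set (point F)).
Hypotheses (PD : is_placed_curve (X, D)) (TZ : modification Z).
Hypothesis ZX : forall q, Z q -> exists2 p, X p & p `<=` q.

(** Outside the centers, a point [p] of [X] contains some [z] of [Z], and [z] contains a point of
    [X], which is [p] by separatedness. So [p] and [z] are the same local ring. *)
Lemma dominated_cofinite : exists l, forall p, X p -> p \notin l -> Z p.
Proof.
have [/= TX S G _ _] := placed_tower PD; have [l hl] := tower_cover TZ.
exists l => p Xp pl; have [n np] := tower_node TX Xp.
have [h|[z Zz s]] := hl _ _ np; first by rewrite h in pl.
have [x Xx sx] := ZX Zz.
have e : x = p by apply: (separated_incl S (G _ Xp)) => //; apply: subset_trans sx s.
suff -> : p = z by [].
by apply/seteqP; split=> //; rewrite -e.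
Qed.

Lemma strict_transformE :
  strict_transform Z D = [set q | Z q /\ q `<=` ring_of D].
Proof.
have [/= TX S G I inf] := placed_tower PD.
have LZ q : Z q -> is_loc q by apply: tower_loc TZ.
have LX q : X q -> is_loc q by move=> /G/good_loc.
(* A point of [X] has an image in [Z] only if it is itself a point of [Z], since [Z] lies over
   [X]. *)
have im : proper_image id Z D = D `&` Z.
  apply/seteqP; split=> [q [Zq [p Dp /maps_to_id s]]|p [Dp Zp]]; last first.
    split=> //; exists p => //; apply/maps_to_id => //; exact: LZ.
  have Xp := irr_sub I Dp; split=> //.
  have {}s := s (LX _ Xp) (LZ _ Zq).
  have [x Xx sx] := ZX Zq.
  have e : x = p.
    by apply: (separated_incl S (G _ Xp)) => //; apply: subset_trans sx s.
  suff -> : q = p by [].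
  by apply/seteqP; split=> //; rewrite -e.
have [l hl] := dominated_cofinite.
rewrite /strict_transform /image_closure im; apply/seteqP; split=> q.
  move=> /zclosureP [p []//|Zq h]; split=> // g qg.
  have [|p [Dp _] pg] := h [:: g]; first exact/all_in1.
  by exists p => //; apply/all_in1.
move=> [Zq h]; apply/zclosureP; first by move=> p [].
split=> // s qs.
have [p [Dp pl ps]] : exists p, [/\ D p, p \notin l & all_in p s].
  by apply: (irr_dir_avoid I) => // g /qs /h.
by exists p => //; split=> //; apply: hl => //; apply: irr_sub I _ Dp.
Qed.

Lemma ring_of_strict : ring_of (strict_transform Z D) = ring_of D.
Proof.
have [/= TX S G I inf] := placed_tower PD.
rewrite strict_transformE; apply/seteqP; split=> g; first by case=> p [_ /(_ g)].
move=> hg; have [l hl] := dominated_cofinite.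
have [p [Dp pl pg]] : exists p, [/\ D p, p \notin l & all_in p [:: g]].
  by apply: (irr_dir_avoid I) => // f; rewrite inE => /eqP ->.
exists p; last exact/all_in1.
split; first by apply: hl => //; apply: irr_sub I _ Dp.
by move=> f pf; exists p.
Qed.
End Domination.

(** Strict transforms keep the ring and are determined by it on a given [Z]; [tower_join] supplies
    the common elaboration. *)
Lemma equivalent_ring (XD YE : placed_curve F) :
  is_placed_curve XD -> is_placed_curve YE ->
  equivalent_curves XD YE <-> ring_of XD.2 = ring_of YE.2.
Proof.
case: XD => X D; case: YE => Y E PD PE /=.
have [/= TX SX GX ID infD] := placed_tower PD.
have [/= TY SY GY IE infE] := placed_tower PE.
split=> [[Z [[TZ _] /= /tower_dominates ZX /tower_dominates ZY e]]|e].
  have {}ZX := ZX TZ TX; have {}ZY := ZY TZ TY.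
  by rewrite -(ring_of_strict PD TZ ZX) e (ring_of_strict PE TZ ZY).
have [Z [TZ ZXY ZX ZY]] := tower_join TX TY.
exists Z; split.
- split=> // p /ZXY [Xp|Yp]; first by case: PD => -[_ h] _; apply: h.
  by case: PE => -[_ h] _; apply: h.
- exact/tower_dominates.
- exact/tower_dominates.
- by rewrite /= (strict_transformE PD TZ ZX) (strict_transformE PE TZ ZY) e.
Qed.

(* Two curves are equivalent if and only if they have the same local ring. *)
Definition prime_of (V : set K) : set (placed_curve F) :=
  [set XD | is_placed_curve XD /\ ring_of XD.2 = V].

Lemma eta_prime_of (P : set (placed_curve F)) :
  is_eta_prime P <-> exists V, P = prime_of V /\ P !=set0.
Proof.
split=> [[XD PD ->]|[V [-> [XD [PD e]]]]].
  exists (ring_of XD.2); split.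
    apply/seteqP; split=> YE [PE].
      by move/(equivalent_ring PD PE) => e; split.
    by move=> e; split=> //; apply/equivalent_ring.
  by exists XD; split=> //; apply/equivalent_ring.
exists XD => //; apply/seteqP; split=> YE [PE].
  by move=> e'; split=> //; apply/(equivalent_ring PD PE); rewrite e e'.
by move/(equivalent_ring PD PE) => e'; split=> //; rewrite -e' e.
Qed.

End Curves.

(** * Monomial valuations *)

Lemma closed_roots (C : closedFieldType) (p : {poly C}) : p != 0 ->
  exists rs : seq C, forall c, root p c -> c \in rs.
Proof.
move=> p0; have [rs e] := closed_field_poly_normal p; exists rs => c.
by rewrite e rootZ ?lead_coef_eq0 // root_prod_XsubC.
Qed.

Lemma avoid_seq (D : numDomainType) (B : seq D) : exists c, c \notin B.
Proof.
apply: contrapT => n; pose r := [seq (i%:R : D) | i <- iota 0 (size B).+1].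
have ur : uniq r.
  by rewrite map_inj_uniq ?iota_uniq //; apply: mulrIn; apply: oner_neq0.
have rB : {subset r <= B}.
  by move=> c _; apply/negPn/negP => cB; apply: n; exists c.
by have := uniq_leq_size ur rB; rewrite size_map size_iota ltnn.
Qed.

Definition dot (l m : int * int) : int := l.1 * m.1 + l.2 * m.2.
Definition det (l m : int * int) : int := l.1 * m.2 - l.2 * m.1.
(* The monomials of exponents sdual l and tdual l are local coordinates along the
   divisor of weight l. *)
Definition sdual (l : int * int) : int * int := egcdz l.1 l.2.
Definition tdual (l : int * int) : int * int := (- l.2, l.1).
Definition primitive (l : int * int) : bool := coprimez l.1 l.2.
Definition nvec (m : nat * nat) : int * int := (m.1%:Z, m.2%:Z).

Lemma dot_tdual l : dot l (tdual l) = 0.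
Proof. by rewrite /dot /tdual /=; ring. Qed.
Lemma dot_sdual l : primitive l -> dot l (sdual l) = 1.
Proof.
rewrite /primitive /coprimez /dot /sdual => /eqP e; case: egcdzP => u v e' _ /=.
by rewrite -e -e'; ring.
Qed.
Lemma det_st l : primitive l -> det (sdual l) (tdual l) = 1.
Proof. by move/dot_sdual => <-; rewrite /det /dot /tdual /=; ring. Qed.

Lemma vecE l s m : dot l s = 1 ->
  m = (dot l m * s.1 - l.2 * det s m, dot l m * s.2 + l.1 * det s m).
Proof.
case: l s m => a b [c d] [x y]; rewrite /dot /det /= => e.
by congr pair; rewrite -[LHS]mul1r -e; ring.
Qed.

Section Monomials.
Variables (C : numClosedFieldType) (F : ratField C).
Local Notation K := (ratFun F).
Local Notation A := (Pol F).
Local Notation cK := (@cK C F).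
Local Notation xF := (xF F).
Local Notation yF := (yF F).
Implicit Types (g h u v w : K) (P Q : A) (c d : C) (O p q z : point F).
Implicit Types (l m n : int * int).

Definition mon m : K := xF ^ m.1 * yF ^ m.2.

Lemma monD m n : mon (m + n) = mon m * mon n.
Proof. by rewrite /mon !expfzDr ?xF0 ?yF0 // mulrACA. Qed.
Lemma mon0 : mon 0 = 1. Proof. by rewrite /mon !expr0z mulr1. Qed.
Lemma mon_neq0 m : mon m != 0.
Proof. by rewrite mulf_neq0 // expfz_neq0 ?xF0 ?yF0. Qed.
Lemma monN m : mon (- m) = (mon m)^-1.
Proof.
by apply: (mulfI (mon_neq0 m)); rewrite -monD subrr mon0 divff ?mon_neq0.
Qed.
Lemma mon_z m (k : int) : mon m ^ k = mon (k * m.1, k * m.2).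
Proof. by rewrite /mon expfzMl !exprz_exp ![k * _]mulrC. Qed.
Lemma mon_x : mon (1, 0) = xF. Proof. by rewrite /mon expr1z expr0z mulr1. Qed.
Lemma cKint (k : int) : cK k%:~R = k%:~R. Proof. exact: rmorph_int. Qed.

Lemma jacXn u w (k : nat) : u != 0 -> jac (u ^+ k) w = k%:R * u ^+ k * (jac u w / u).
Proof.
move=> u0; elim: k => [|k IH].
  by rewrite expr0 -[X in jac X]cK1 jacCl; ring.
rewrite exprS jacMl IH -addn1 natrD; by field.
Qed.

Lemma jacXz u w (k : int) : u != 0 -> jac (u ^ k) w = k%:~R * u ^ k * (jac u w / u).
Proof.
move=> u0; case: (intP k) => [|n|n].
- by rewrite expr0z -[X in jac X]cK1 jacCl; ring.
- by rewrite -exprnP jacXn.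
- have h : u ^+ n.+1 != 0 by rewrite expf_neq0.
  rewrite -invr_expz -exprnP jacVl ?expf_neq0 // jacXn // mulrNz -pmulrn.
  by move: h; set a := u ^+ n.+1 => h; field; rewrite u0 h.
Qed.

Lemma jac_monl m w :
  jac (mon m) w = mon m * (m.1%:~R * (jac xF w / xF) + m.2%:~R * (jac yF w / yF)).
Proof.
rewrite /mon jacMl !jacXz ?xF0 ?yF0 //; move: (xF ^ _) (yF ^ _) => a b; ring.
Qed.

Lemma jac_mon m n : jac (mon m) (mon n) = (det m n)%:~R * mon (m + n) / (xF * yF).
Proof.
have x0 := xF0 F; have y0 := yF0 F.
rewrite jac_monl [jac xF _]jacC [jac yF _]jacC !jac_monl.
rewrite !jac_diag [jac yF xF]jacC jac_xy monD /det rmorphB !rmorphM /=.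
by field; rewrite x0 y0.
Qed.

Lemma mon_st l m : primitive l ->
  mon m = mon (sdual l) ^ (dot l m) * mon (tdual l) ^ (det (sdual l) m).
Proof.
move=> /dot_sdual e; rewrite !mon_z -monD [m in LHS](vecE m e); congr mon.
by rewrite /tdual; congr pair => /=; ring.
Qed.

Lemma sb_mon P : toFun P = \sum_(m <- supp P) cK (cf P m) * mon (nvec m).
Proof. by rewrite -sb_id sb_sum. Qed.

(* The point of the divisor of weight l where the monomial of exponent
   tdual l takes the value c. *)
Definition pt l c : point F := local_ring (mon (sdual l)) (mon (tdual l) - cK c).

(* The local ring of the divisor of weight l *)
Definition V l : set K :=
  [set g | exists B : seq C, forall c, c != 0 -> c \notin B -> pt l c g].

Section Weight.
Variable l : int * int.
Hypothesis pl : primitive l.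
Local Notation s := (mon (sdual l)).
Local Notation t := (mon (tdual l)).

Lemma s_neq0 : s != 0. Proof. exact: mon_neq0. Qed.
Lemma t_neq0 : t != 0. Proof. exact: mon_neq0. Qed.

Lemma jac_st : jac s t = s * t / (xF * yF).
Proof. by rewrite jac_mon det_st // monD mul1r. Qed.

Lemma jac_pt c : jac s (t - cK c) != 0.
Proof.
rewrite jacBcr jac_st; apply: mulf_neq0.
  by apply: mulf_neq0; apply: mon_neq0.
by rewrite invr_eq0; apply: mulf_neq0; [apply: xF0|apply: yF0].
Qed.

Lemma pt_good c : good (pt l c).
Proof. by exists s, (t - cK c); split=> //; apply: jac_pt. Qed.
Lemma pt_loc c : is_loc (pt l c).
Proof. by apply: good_loc; apply: pt_good. Qed.
Lemma pt_s c : max_ideal (pt l c) s.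
Proof. by apply: lrml; apply: jac_pt. Qed.
Lemma pt_t c : has_value (pt l c) t c.
Proof. by apply: lrmr; apply: jac_pt. Qed.
Lemma pt_tV c : c != 0 -> pt l c t^-1.
Proof.
by move=> c0; have [] := has_value_unit (pt_loc c) (pt_t c) c0.
Qed.
Lemma pt_tz c k : c != 0 -> has_value (pt l c) (t ^ k) (c ^ k).
Proof.
move=> c0; have h := pt_t c; case: (intP k) => [|n|n].
- by rewrite !expr0z -(cK1 F); apply: has_valueC; apply: pt_loc.
- by rewrite -!exprnP; apply: has_valueX => //; apply: pt_loc.
- rewrite -!invr_expz -!exprnP; apply: has_valueV; last exact: expf_neq0.
    exact: pt_loc.
  by apply: has_valueX => //; apply: pt_loc.
Qed.

Lemma pt_V_dir g1 g2 h : V l g1 -> V l g2 ->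
  (forall c, c != 0 -> pt l c g1 -> pt l c g2 -> pt l c h) -> V l h.
Proof.
move=> [B1 h1] [B2 h2] hh; exists (B1 ++ B2) => c c0.
by rewrite mem_cat negb_or => /andP[/(h1 _ c0) i1 /(h2 _ c0) i2]; apply: hh.
Qed.

Lemma V_pt g : (forall c, c != 0 -> pt l c g) -> V l g.
Proof. by move=> h; exists [::] => c c0 _; apply: h. Qed.

Lemma VC c : V l (cK c).
Proof. by apply: V_pt => d _; apply: locC; apply: pt_loc. Qed.
Lemma V1 : V l 1. Proof. by rewrite -(cK1 F); apply: VC. Qed.
Lemma V0 : V l 0. Proof. by rewrite -(cK0 F); apply: VC. Qed.
Lemma VM g h : V l g -> V l h -> V l (g * h).
Proof.
move=> Vg Vh; apply: (pt_V_dir Vg Vh) => c _ pg ph.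
by apply: locM => //; apply: pt_loc.
Qed.
Lemma VX g (n : nat) : V l g -> V l (g ^+ n).
Proof.
move=> h; elim: n => [|n IH]; first by rewrite expr0; apply: V1.
by rewrite exprS; apply: VM.
Qed.
Lemma Vs : V l s. Proof. by apply: V_pt => c _; case: (pt_s c). Qed.
Lemma Vtz k : V l (t ^ k).
Proof.
by apply: V_pt => c c0; apply: has_value_loc (pt_tz k c0); apply: pt_loc.
Qed.

Lemma Vs_inv : ~ V l s^-1.
Proof.
move=> [B h]; have [c] := avoid_seq (0 :: B).
rewrite inE negb_or => /andP[c0 cB].
exact: (locm_inv s_neq0 (pt_s c) (h c c0 cB)).
Qed.

(** [f] is the restriction of [g] to the divisor with parameter [c]. It has finitely many roots, so
    [g] is invertible at almost all points. *)
Lemma V_unit g (f : {poly C}) : f != 0 ->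
  (forall c, c != 0 -> has_value (pt l c) g f.[c]) -> V l g /\ V l g^-1.
Proof.
move=> f0 h; split.
  by apply: V_pt => c c0; apply: has_value_loc (h c c0); apply: pt_loc.
have [rs hr] := closed_roots f0; exists rs => c c0 cr.
have [] // := has_value_unit (pt_loc c) (h c c0).
by apply: contraNneq cr => e; apply: hr; apply/eqP.
Qed.

End Weight.

Definition low (D : numDomainType) (k : nat * nat -> D) P (m : nat * nat) :=
  m \in supp P /\ forall n : nat * nat, n \in supp P -> k m <= k n.

Lemma cf0 (m : nat * nat) : cf (0 : A) m = 0.
Proof. by rewrite -[0 : A](mulr0 (cP F 0)) cfZ mul0r. Qed.

Lemma supp_neq0 P : P != 0 -> supp P != [::].
Proof.
by apply: contraNneq => e; rewrite [P]polE e big_nil.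
Qed.

Lemma low_exists (D : realDomainType) (k : nat * nat -> D) P : P != 0 ->
  exists m : nat * nat, low k P m.
Proof.
move=> /supp_neq0; rewrite /low; elim: (supp P) => // a r IH _.
have [->|/IH [m [mr hm]]] := eqVneq r [::].
  by exists a; rewrite inE eqxx; split=> // n; rewrite inE => /eqP ->.
have [am|ma] := leP (k a) (k m).
  exists a; rewrite inE eqxx; split=> // n; rewrite inE => /orP[/eqP ->//|/hm].
  exact: le_trans.
exists m; rewrite inE mr orbT; split=> // n; rewrite inE => /orP[/eqP ->|/hm //].
exact: ltW.
Qed.

Section Weight2.
Variable l : int * int.
Hypothesis pl : primitive l.
Local Notation s := (mon (sdual l)).
Local Notation t := (mon (tdual l)).
Local Notation V := (V l).
Local Notation k := (fun m : nat * nat => dot l (nvec m)).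

(** After division by [s ^ d], the terms of weight [d] restrict to a nonzero Laurent polynomial in
    [t], because equal weights and equal exponents of [t] mean equal monomials. The remaining terms
    vanish on the divisor. *)
Lemma V_low P (m : nat * nat) : low k P m ->
  exists e, [/\ V e, V e^-1, e != 0 & toFun P = s ^ (dot l (nvec m)) * e].
Proof.
move=> [mP hm]; set d := dot l (nvec m).
pose j (n : nat * nat) := det (sdual l) (nvec n).
(* [N] bounds the exponents of [t]; the factor [t ^ N] turns the Laurent polynomial into the
   polynomial [f]. *)
pose N := (\sum_(n <- supp P) `|j n|)%N.
have jN (n : nat * nat) : n \in supp P -> 0 <= j n + N%:Z.
  move=> nP; have : (`|j n| <= N)%N.
    by rewrite /N (big_rem n) //= leq_addr.
  by move=> h; lia.
pose f : {poly C} := \sum_(n <- supp P | k n == d) cf P n *: 'X^(`|j n + N%:Z|).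
pose e := \sum_(n <- supp P) cK (cf P n) * s ^ (k n - d) * t ^ (j n + N%:Z).
have f0 : f != 0.
  apply/eqP => /(congr1 (fun q : {poly C} => q`_(`|j m + N%:Z|))).
  rewrite coef0 coef_sum (big_rem m) //= eqxx coefZ coefXn eqxx mulr1.
  rewrite big1_seq ?addr0; first by move=> /eqP; rewrite -[_ == _]negbK -mem_supp mP.
  move=> n /andP[/eqP kn]; rewrite mem_rem_uniq ?supp_uniq // inE => /andP[nm nP].
  rewrite coefZ coefXn; case: eqP => [E|_]; last by rewrite mulr0.
  have jmn : j m = j n by have := jN _ mP; have := jN _ nP; lia.
  have em : nvec n = nvec m.
    rewrite (vecE (nvec n) (dot_sdual pl)) (vecE (nvec m) (dot_sdual pl)).
    by rewrite -/(j n) -/(j m) kn jmn.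
  by case/eqP: nm; move: em; case: (n) => ? ?; case: (m) => ? ? [-> ->].
have ve c : c != 0 -> has_value (pt l c) e f.[c].
  move=> c0; rewrite /e /f horner_sum [X in has_value _ _ X]big_mkcond /=.
  have L := pt_loc pl c.
  rewrite big_seq [X in has_value _ _ X]big_seq.
  elim/big_ind2: _ => [|x1 x2 y1 y2|n nP].
  - by rewrite -(cK0 F); apply: has_valueC.
  - exact: has_valueD.
  have tv : has_value (pt l c) (t ^ (j n + N%:Z)) (c ^+ `|j n + N%:Z|).
    rewrite -(_ : c ^ (j n + N%:Z) = c ^+ `|j n + N%:Z|); first exact: pt_tz.
    by rewrite exprnP; congr (c ^ _); have := jN _ nP; lia.
  case: eqP => [->|ne].
    rewrite subrr expr0z mulr1 hornerZ hornerXn.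
    by apply: has_valueM => //; apply: has_valueC.
  apply/has_value0; apply: locmMr => //; last exact: has_value_loc tv.
  apply: locmM => //; first exact: locC.
  have := hm _ nP; rewrite -/d => hd.
  have -> : k n - d = (`|k n - d|.-1.+1)%:Z by lia.
  rewrite -exprnP exprS; apply: locmMr => //; first exact: pt_s.
  by apply: locX => //; case: (pt_s pl c).
have [Ve Vie] := V_unit pl f0 ve.
have tN0 : t ^ (- N%:Z) != 0 by rewrite expfz_neq0 // t_neq0.
have eP : toFun P = s ^ d * (e * t ^ (- N%:Z)).
  rewrite sb_mon /e mulr_suml mulr_sumr; apply: eq_bigr => n _.
  rewrite (mon_st (nvec n) pl) -/(j n).
  have -> : t ^ (j n) = t ^ (j n + N%:Z) * t ^ (- N%:Z).
    by rewrite -expfzDr ?t_neq0 // addrK.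
  have -> : s ^ (dot l (nvec n)) = s ^ d * s ^ (k n - d).
    by rewrite -expfzDr ?s_neq0 // addrC subrK.
  ring.
have P0 : toFun P != 0.
  rewrite toFun_eq0; apply: contraTneq mP => ->.
  by rewrite mem_supp cf0 eqxx.
exists (e * t ^ (- N%:Z)); split=> //.
- by apply: VM => //; apply: Vtz.
- by rewrite invfM; apply: VM => //; rewrite invr_expz; apply: Vtz.
- by apply: contraNneq P0 => e0; rewrite eP e0 mulr0.
Qed.

Lemma V_sz (i : int) : V (s ^ i) <-> 0 <= i.
Proof.
split=> [h|]; last by case: i => // n _; rewrite -exprnP; apply: VX => //; apply: Vs.
rewrite leNgt; apply/negP => i0; apply: (Vs_inv pl).
have -> : s^-1 = s ^ i * s ^+ (`|i|.-1).
  by rewrite exprnP -expfzDr ?s_neq0 // -exprN1; congr (s ^ _); lia.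
by apply: VM => //; apply: VX => //; apply: Vs.
Qed.

Lemma V_frac P Q (m n : nat * nat) : low k P m -> low k Q n ->
  V (toFun P / toFun Q) <-> dot l (nvec n) <= dot l (nvec m).
Proof.
move=> /V_low [e [Ve Vie e0 ->]] /V_low [e' [Ve' Vie' e0' ->]].
have E : s ^ dot l (nvec m) * e / (s ^ dot l (nvec n) * e') =
  s ^ (dot l (nvec m) - dot l (nvec n)) * (e / e').
  rewrite expfzDr ?s_neq0 // -invr_expz; have h := expfz_neq0 (dot l (nvec n)) (s_neq0 l).
  by field; rewrite h e0'.
rewrite E -subr_ge0 -V_sz; split=> h; last by apply: VM => //; apply: VM.
rewrite -[s ^ _](mulfK (mulf_neq0 e0 (invr_neq0 e0'))).
by rewrite invf_div; apply: VM => //; apply: VM.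
Qed.

Lemma V_mon m : V (mon m) <-> 0 <= dot l m.
Proof.
rewrite (mon_st m pl) -V_sz; split=> h; last by apply: VM => //; apply: Vtz.
have t0 := expfz_neq0 (det (sdual l) m) (t_neq0 l).
by rewrite -[s ^ _](mulfK t0) invr_expz; apply: VM => //; apply: Vtz.
Qed.

(** The monomial [s] is a uniformizer, so [V] is a discrete valuation ring. *)
Lemma V_unif g : g != 0 -> exists (i : int) e,
  [/\ V e, V e^-1, e != 0 & g = s ^ i * e].
Proof.
elim/fracF_ind: g => P Q Q0 g0.
have P0 : P != 0.
  by apply: contraNneq g0 => ->; rewrite toFun0 mul0r.
have [m /V_low [e [Ve Vie e0 ->]]] := low_exists k P0.
have [n /V_low [e' [Ve' Vie' e0' ->]]] := low_exists k Q0.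
exists (dot l (nvec m) - dot l (nvec n)), (e / e'); split.
- exact: VM.
- by rewrite invf_div; apply: VM.
- by rewrite mulf_neq0 ?invr_eq0.
- rewrite expfzDr ?s_neq0 // -invr_expz.
  have h := expfz_neq0 (dot l (nvec n)) (s_neq0 l).
  by field; rewrite h e0'.
Qed.

(** A discrete valuation ring is a maximal proper subring: an element outside [V] puts a negative
    power of [s] into [S], and its powers times [V] exhaust K. *)
Lemma V_max (S : set K) : V `<=` S -> (forall g h, S g -> S h -> S (g * h)) ->
  (exists g, ~ S g) -> S = V.
Proof.
move=> VS SM [g0 ng0]; apply/seteqP; split=> // g Sg; apply: contrapT => ng.
have gn0 : g != 0 by apply: contra_notN ng => /eqP ->; apply: V0.
have g00 : g0 != 0 by apply: contra_notN ng0 => /eqP ->; apply: VS; apply: V0.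
have [i [e [Ve Vie e0 eg]]] := V_unif gn0.
have [j [e' [Ve' Vie' e0' eg0]]] := V_unif g00.
have i0 : i < 0.
  rewrite ltNge; apply: contra_notN ng => i0; rewrite eg; apply: VM => //.
  exact/V_sz.
have SX f (n : nat) : S f -> S (f ^+ n).
  move=> Sf; elim: n => [|n IH]; first by rewrite expr0; apply: VS; apply: V1.
  by rewrite exprS; apply: SM.
apply: ng0; rewrite eg0.
have Ss : S (s ^ i).
  rewrite -[s ^ i](mulfK e0) -eg; apply: SM => //; exact: VS.
(* As [i] is at most -1, the exponent that remains is nonnegative. *)
have -> : s ^ j = (s ^ i) ^+ `|j| * s ^ (j - i * `|j|%:Z).
  by rewrite exprnP exprz_exp -expfzDr ?s_neq0 // addrC subrK.
apply: (SM) => //; last exact: VS.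
apply: SM; first exact: SX.
by apply: VS; apply/V_sz; nia.
Qed.

(** A denominator restricts to the divisor as a polynomial that is nonzero at [c]; it is therefore
    invertible at almost all points. *)
Lemma pt_sub_V c : c != 0 -> pt l c `<=` V.
Proof.
move=> c0 _ [P [Q [Q0 ->]]].
have val (T : A) : exists f : {poly C}, forall d, d != 0 ->
    has_value (pt l d) (sb s (t - cK c) T) f.[d].
  elim/(@Pol_ind _ F): T => [d| | |T T' [f hf] [f' hf']|T T' [f hf] [f' hf']].
  - exists d%:P => e e0; rewrite hornerC sbCK; apply: has_valueC.
    exact: pt_loc.
  - exists 0 => e e0; rewrite horner0 sbX; apply/has_value0; exact: pt_s.
  - exists ('X - c%:P) => e e0; rewrite hornerXsubC sbY.
    apply: has_valueB; [exact: pt_loc|exact: pt_t|].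
    by apply: has_valueC; apply: pt_loc.
  - exists (f + f') => e e0; rewrite hornerD sbD.
    by apply: has_valueD; [exact: pt_loc|exact: hf|exact: hf'].
  - exists (f * f') => e e0; rewrite hornerM sbM.
    by apply: has_valueM; [exact: pt_loc|exact: hf|exact: hf'].
have [f hf] := val P; have [f' hf'] := val Q.
have f0 : f' != 0.
  apply: contraNneq Q0 => f'0; have := hf' c c0; rewrite f'0 horner0.
  have h := sb_value (pt_loc pl c) Q (pt_s pl c) (lrmr (jac_pt pl c)).
  by move/(has_value_uniq (pt_loc pl c) h) ->.
apply: VM => //; last by have [] := V_unit pl f0 hf'.
apply: V_pt => d d0; apply: has_value_loc (hf d d0); exact: pt_loc.
Qed.

End Weight2.

(** If the monomial of exponent [tdual l] is a unit of [V m], then [m] is an integer multiple of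
    [l], and by primitivity the factor is 1 or -1. The monomial of exponent [sdual l] decides the
    sign. *)
Lemma V_inj_mon l m : primitive l -> primitive m -> V m (mon (tdual l)) ->
  V m (mon (- tdual l)) -> V m (mon (sdual l)) -> l = m.
Proof.
move=> pl pm /(V_mon pm) h1 /(V_mon pm) h2 /(V_mon pm) h3.
have e1 := dot_sdual pl; have e2 := dot_sdual pm.
move: h1 h2 h3 e1 e2; rewrite /dot /tdual.
case: l m {pl pm} => a b [c d]; case: (sdual _) => s t; case: (sdual _) => s' t'.
rewrite /= => h1 h2 h3 e1 e2.
have dt : a * d = b * c by lia.
(* The factor [k] in [m = k * l] is the pairing of [m] with [sdual l]. *)
have [k ek] : exists k, k = c * s + d * t by eexists.
rewrite -ek in h3.
have ck : c = k * a.
  by rewrite ek -[LHS]mulr1 -e1; transitivity (a * c * s + (b * c) * t); [ring|rewrite -dt; ring].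
have dk : d = k * b.
  by rewrite ek -[LHS]mulr1 -e1; transitivity ((a * d) * s + b * d * t); [ring|rewrite dt; ring].
have k1 : k * (a * s' + b * t') = 1 by rewrite -e2 [in RHS]ck [in RHS]dk; ring.
have kk : k = 1.
  move: k1 h3; move: (a * s' + b * t') => z /(congr1 absz).
  by rewrite abszM => /eqP; rewrite muln_eq1 => /andP[/eqP h _] k0; lia.
by rewrite ck dk kk !mul1r.
Qed.

Lemma V_inj l m : primitive l -> primitive m -> V l `<=` V m -> l = m.
Proof.
move=> pl pm h; apply: V_inj_mon => //; apply/h/(V_mon pl).
- by rewrite dot_tdual.
- by rewrite /dot /tdual /=; lia.
- by rewrite dot_sdual.
Qed.

(* In the coordinates s, t along the divisor, eta = ds dt / (s t). *)
Lemma V_pole l p : primitive l -> good p -> p `<=` V l ->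
  ~ regular_form_at (eta F) p.
Proof.
move=> pl G pV [u [v [E pe]]].
have J : jac u v != 0 by apply: good_jac; rewrite -E.
have [Bu hu] : V l u by apply: pV; rewrite E; apply: lrl.
have [Bv hv] : V l v by apply: pV; rewrite E; apply: lrr.
have [Be he] := pV _ pe.
apply: (Vs_inv pl); exists (Bu ++ Bv ++ Be) => c c0; rewrite !mem_cat !negb_or.
move=> /and3P[cu cv ce].
have L := pt_loc pl c; have Jc := jac_pt pl c.
have [e pce je] := lr_jac Jc (hu _ c0 cu) (hv _ c0 cv).
have := he _ c0 ce; rewrite /form_coef /eta je jacBcr jac_st //.
move=> h; have x0 := xF0 F; have y0 := yF0 F; have s0 := s_neq0 l; have t0 := t_neq0 l.
have e0 : e != 0 by apply: contraNneq J; rewrite je => ->; rewrite mul0r.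
have -> : (mon (sdual l))^-1 = (xF * yF)^-1
   / (e * (mon (sdual l) * mon (tdual l) / (xF * yF))) * e * mon (tdual l).
  by field; rewrite e0 s0 t0 x0 y0.
apply: locM => //; first exact: locM.
by apply: has_value_loc (pt_t pl c).
Qed.

End Monomials.

Lemma fiber_seq (T U : eqType) (f : T -> U) (l : seq U) : injective f ->
  exists B : seq T, forall c, f c \in l -> c \in B.
Proof.
move=> fi; elim: l => [|a l [B hB]]; first by exists [::].
have [[c0 e]|n] := pselect (exists c, f c = a).
  exists (c0 :: B) => c; rewrite !inE => /orP[/eqP h|/hB ->]; last by rewrite orbT.
  by rewrite (fi c c0) ?eqxx // e.
exists B => c; rewrite inE => /orP[/eqP h|/hB //]; by case: n; exists c.
Qed.

(** * Crossings and smooth boundary points of toric surfaces *)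

Section Classification.
Variables (C : numClosedFieldType) (F : ratField C).
Local Notation K := (ratFun F).
Local Notation A := (Pol F).
Local Notation cK := (@cK C F).
Local Notation xF := (xF F).
Local Notation yF := (yF F).
Local Notation mon := (@mon C F).
Local Notation pt := (@pt C F).
Local Notation V := (@V C F).
Local Notation eta := (eta F).
Local Notation torus_point := (@torus_point C F).
Implicit Types (g h u v w : K) (P Q : A) (c d : C) (O p q z : point F).
Implicit Types (l m n : int * int) (X D E : set (point F)).

Lemma pt_inj l : primitive l -> injective (pt l).
Proof.
move=> pl c d e; apply: (has_value_uniq (pt_loc F pl c) (pt_t F pl c)).
by rewrite e; apply: pt_t.
Qed.

Lemma lrC u v : jac u v != 0 -> local_ring u v = local_ring v u.
Proof.
move=> J; have J' : jac v u != 0 by rewrite jacC oppr_eq0.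
by apply: lr_eq => //; [apply: lrmr|apply: lrml|apply: lrmr|apply: lrml].
Qed.

(** On the divisor [u] vanishes and [v + c0] is the parameter [d] or its inverse, so [phi] is the
    identity or inversion in the applications. A denominator restricts to a polynomial in [phi d]
    with the nonzero value [Q(0, 0)] at [c0]. *)
Lemma lr_sub_V l u v (phi : C -> C) c0 : primitive l -> involutive phi ->
  (forall d, d != 0 -> max_ideal (pt l d) u) ->
  (forall d, d != 0 -> has_value (pt l d) v (phi d - c0)) ->
  local_ring u v `<=` V l.
Proof.
move=> pl inv hu hv _ [P [Q [Q0 ->]]].
have val (T : A) : exists f : {poly C}, f.[c0] = ev0 T /\ forall d, d != 0 ->
    has_value (pt l d) (sb u v T) f.[phi d].
  elim/(@Pol_ind _ F): T => [d| | |T T' [f [e hf]] [f' [e' hf']]|T T' [f [e hf]] [f' [e' hf']]].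
  - exists d%:P; rewrite hornerC ev0C; split=> // b b0.
    by rewrite hornerC sbCK; apply: has_valueC; apply: pt_loc.
  - exists 0; rewrite horner0 ev0X; split=> // b b0.
    by rewrite horner0 sbX; apply/has_value0; apply: hu.
  - exists ('X - c0%:P); rewrite hornerXsubC subrr ev0Y; split=> // b b0.
    by rewrite hornerXsubC sbY; apply: hv.
  - exists (f + f'); rewrite hornerD e e' ev0D; split=> // b b0; rewrite hornerD sbD.
    by apply: has_valueD; [exact: pt_loc|exact: hf|exact: hf'].
  - exists (f * f'); rewrite hornerM e e' ev0M; split=> // b b0; rewrite hornerM sbM.
    by apply: has_valueM; [exact: pt_loc|exact: hf|exact: hf'].
have [f [_ hf]] := val P; have [f' [e' hf']] := val Q.
have f0 : f' != 0.
  by apply: contraNneq Q0 => f'0; rewrite -e' f'0 horner0.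
apply: VM => //.
  by apply: V_pt => d d0; apply: has_value_loc (hf d d0); exact: pt_loc.
have [rs hr] := closed_roots f0; exists (map phi rs) => c c1 cr.
have [] // := has_value_unit (pt_loc F pl c) (hf' c c1).
by apply: contraNneq cr => e; rewrite -[c]inv; apply: map_f; apply: hr; apply/eqP.
Qed.

Lemma pt_mon_max l m c : primitive l -> c != 0 -> 0 < dot l m ->
  max_ideal (pt l c) (mon m).
Proof.
move=> pl c0 h; rewrite (mon_st F m pl); apply: (locmMr (pt_loc F pl c)).
  have -> : dot l m = (`|dot l m|.-1.+1)%:Z by lia.
  rewrite -exprnP exprS; apply: (locmMr (pt_loc F pl c)); first exact: pt_s.
  by apply: locX; [exact: pt_loc|case: (pt_s F pl c)].
by apply: has_value_loc (pt_tz F pl _ c0); apply: pt_loc.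
Qed.

(* The intersection point of the divisors of weights l1 and l2 *)
Definition cross l1 l2 : point F :=
  local_ring (mon (- tdual l2)) (mon (tdual l1)).

Section Cross.
Variables (l1 l2 : int * int).
Hypothesis d1 : det l1 l2 = 1.

Lemma det1_primitivel : primitive l1.
Proof.
apply/coprimezP; exists (l2.2, - l2.1); move: d1; rewrite /det /= => <-; ring.
Qed.
Lemma det1_primitiver : primitive l2.
Proof.
apply/coprimezP; exists (- l1.2, l1.1); move: d1; rewrite /det /= => <-; ring.
Qed.
Let p1 := det1_primitivel.
Let p2 := det1_primitiver.

Lemma jac_cross : jac (mon (- tdual l2)) (mon (tdual l1)) =
  mon (- tdual l2) * mon (tdual l1) / (xF * yF).
Proof.
rewrite jac_mon monD (_ : det _ _ = 1) ?mul1r // -d1.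
by rewrite /det /tdual /=; ring.
Qed.

Lemma jac_cross_neq0 : jac (mon (- tdual l2)) (mon (tdual l1)) != 0.
Proof.
rewrite jac_cross; apply: mulf_neq0.
  by apply: mulf_neq0; apply: mon_neq0.
by rewrite invr_eq0; apply: mulf_neq0; [apply: xF0|apply: yF0].
Qed.

Lemma cross_good : good (cross l1 l2).
Proof. by do 2!eexists; split; first exact: jac_cross_neq0. Qed.

Lemma cross_sub_l : cross l1 l2 `<=` V l1.
Proof.
apply: (lr_sub_V (phi := id) (c0 := 0)) => // d d0.
  apply: pt_mon_max => //; rewrite (_ : dot _ _ = 1) // -d1.
  by rewrite /dot /det /tdual /=; ring.
by rewrite subr0; apply: pt_t.
Qed.

Lemma cross_sub_r : cross l1 l2 `<=` V l2.
Proof.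
rewrite /cross lrC; last exact: jac_cross_neq0.
apply: (lr_sub_V (phi := GRing.inv) (c0 := 0)) => //; first exact: invrK.
  move=> d d0; apply: pt_mon_max => //; rewrite (_ : dot _ _ = 1) // -d1.
  by rewrite /dot /det /tdual /=; ring.
move=> d d0; rewrite subr0 monN; apply: has_valueV => //; first exact: pt_loc.
exact: pt_t.
Qed.

(** The monomial of exponent [tdual l] is a unit at [pt l c]. Were it one at the crossing, its
    weights for [l1] and [l2] would both be 0, although [l1] and [l2] are independent. *)
Lemma pt_not_cross l c : primitive l -> c != 0 -> pt l c <> cross l1 l2.
Proof.
move=> pl c0 e.
have h k : cross l1 l2 (mon (tdual l) ^ k).
  rewrite -e; apply: has_value_loc (pt_tz F pl k c0); exact: pt_loc.
have := cross_sub_l (h 1); have := cross_sub_l (h (-1)).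
have := cross_sub_r (h 1); have := cross_sub_r (h (-1)).
rewrite exprN1 expr1z -monN !(V_mon F p1) !(V_mon F p2) => a1 a2 a3 a4.
have b1 : dot l1 (tdual l) = 0 by move: a3 a4; rewrite /dot /=; lia.
have b2 : dot l2 (tdual l) = 0 by move: a1 a2; rewrite /dot /=; lia.
have : l.1 = 0 /\ l.2 = 0.
  move: b1 b2 d1; rewrite /dot /det /tdual /= => b1 b2 dd; split.
    rewrite -[LHS]mulr1 -dd.
    transitivity ((l1.1 * - l.2 + l1.2 * l.1) * - l2.1 + l1.1 * (l2.1 * - l.2 + l2.2 * l.1)).
      by ring.
    by rewrite b1 b2; ring.
  rewrite -[LHS]mulr1 -dd.
  transitivity ((l1.1 * - l.2 + l1.2 * l.1) * - l2.2 + l1.2 * (l2.1 * - l.2 + l2.2 * l.1)).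
    by ring.
  by rewrite b1 b2; ring.
by have := dot_sdual pl; rewrite /dot => e1 [e2 e3]; move: e1; rewrite e2 e3 !mul0r.
Qed.
End Cross.

Section PtE.
Variables (l m : int * int) (c : C).
Hypotheses (pl : primitive l) (dlm : dot l m = 1) (c0 : c != 0).

Lemma mon_weight1 : exists k : int, mon m = mon (sdual l) * mon (tdual l) ^ k.
Proof.
by exists (det (sdual l) m); rewrite [LHS](mon_st F m pl) dlm expr1z.
Qed.

Lemma pt_eq v : jac (mon m) v != 0 -> max_ideal (pt l c) v ->
  max_ideal (local_ring (mon m) v) (mon (tdual l) - cK c) ->
  local_ring (mon m) v = pt l c.
Proof.
move=> J hv ht; apply: lr_eq => //; first exact: jac_pt; last first.
- by apply: pt_mon_max => //; rewrite dlm.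
- have L := lr_loc J; have [k e] := mon_weight1.
  have -> : mon (sdual l) = mon m * mon (tdual l) ^ (- k).
    by rewrite e -mulrA -expfzDr ?mon_neq0 // subrr expr0z mulr1.
  apply: locmMr => //; first exact: lrml.
  have tc : has_value (local_ring (mon m) v) (mon (tdual l)) c by [].
  case: (- k) => n; first by rewrite -exprnP; apply: locX => //; apply: has_value_loc tc.
  rewrite NegzE -invr_expz -exprnP -exprVn; apply: locX => //.
  by have [] := has_value_unit L tc c0.
Qed.

Lemma ptE : local_ring (mon m) (mon (tdual l) - cK c) = pt l c.
Proof.
have J : jac (mon m) (mon (tdual l) - cK c) != 0.
  rewrite jacBcr jac_mon (_ : det m _ = 1); last first.
    by rewrite -dlm /det /dot /tdual /=; ring.
  rewrite mul1r; apply: mulf_neq0; first exact: mon_neq0.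
  by rewrite invr_eq0; apply: mulf_neq0; [apply: xF0|apply: yF0].
apply: pt_eq => //; [exact: pt_t|exact: lrmr].
Qed.

Lemma ptEV : local_ring (mon m) (mon (- tdual l) - cK c^-1) = pt l c.
Proof.
have J : jac (mon m) (mon (- tdual l) - cK c^-1) != 0.
  rewrite jacBcr jac_mon (_ : det m _ = -1); last first.
    by rewrite -dlm /det /dot /tdual /=; ring.
  rewrite mulN1r; apply: mulf_neq0; first by rewrite oppr_eq0; exact: mon_neq0.
  by rewrite invr_eq0; apply: mulf_neq0; [apply: xF0|apply: yF0].
apply: pt_eq => //.
  by rewrite monN; apply: has_valueV => //; [exact: pt_loc|exact: pt_t].
have h : has_value (local_ring (mon m) (mon (- tdual l) - cK c^-1))
    (mon (- tdual l)) c^-1 by apply: lrmr.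
have := has_valueV (lr_loc J) h; rewrite invr_eq0 invrK => /(_ c0).
by rewrite [X in has_value _ X^-1 _]monN invrK.
Qed.
End PtE.

Lemma mon_cases : [/\ xF = mon (1, 0), yF = mon (0, 1), xF^-1 = mon (-1, 0) &
  yF^-1 = mon (0, -1)] /\ yF / xF = mon (-1, 1) /\ xF / yF = mon (1, -1).
Proof.
by rewrite /mon /= !expr0z !expr1z !exprN1 !mulr1 !mul1r mulrC.
Qed.

Definition e1 : int * int := (1, 0).
Definition e2 : int * int := (0, 1).
Definition e3 : int * int := (-1, -1).

(* X is the toric surface whose fan has the given maximal cones and rays. *)
Definition toric X (cones : seq ((int * int) * (int * int))) (rays : seq (int * int)) :=
  [/\ forall k, k \in cones -> [/\ det k.1 k.2 = 1, k.1 \in rays & k.2 \in rays],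
      forall l, l \in rays -> primitive l &
      forall p, X p <-> [\/ torus F p,
        exists2 k, k \in cones & p = cross k.1 k.2 |
        exists l c, [/\ l \in rays, c != 0 & p = pt l c]]].

Lemma torus_point_good a b : good (torus_point a b).
Proof.
by exists (xF - cK a), (yF - cK b); rewrite jacBcl jacBcr jac_xy oner_neq0.
Qed.

Lemma lr_torus u v a b : a != 0 -> b != 0 -> jac u v != 0 ->
  max_ideal (torus_point a b) u -> max_ideal (torus_point a b) v ->
  has_value (local_ring u v) xF a -> has_value (local_ring u v) yF b ->
  local_ring u v = torus_point a b.
Proof.
move=> a0 b0 J hu hv hx hy; apply: lr_eq => //.
by rewrite jacBcl jacBcr jac_xy oner_neq0.
Qed.

(** In each affine chart the vanishing of the coordinates [a], [b] decides the kind of point: a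
    crossing if both are 0, a smooth boundary point if one is, a torus point otherwise. *)
Lemma P2_toric : toric (P2 F) [:: (e1, e2); (e2, e3); (e3, e1)] [:: e1; e2; e3].
Proof.
have [[ex ey exV eyV] [eyx exy]] := mon_cases.
split.
- by move=> k; rewrite !inE => /or3P[] /eqP ->.
- by move=> l; rewrite !inE => /or3P[] /eqP ->.
have x0 := xF0 F; have y0 := yF0 F.
have chart2 a b : a != 0 -> b != 0 ->
    local_ring (xF^-1 - cK a) (yF / xF - cK b) = torus_point a^-1 (b / a).
  move=> a0 b0; set u := _ - _; set v := _ - _.
  have J : jac u v != 0 by apply: good_jac; apply: P2_good; exists a, b; apply: Or32.
  have L := lr_loc J; have L' := good_loc (torus_point_good a^-1 (b / a)).
  have hx : has_value (torus_point a^-1 (b / a)) xF a^-1.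
    by apply: lrml; rewrite jacBcl jacBcr jac_xy oner_neq0.
  have hy : has_value (torus_point a^-1 (b / a)) yF (b / a).
    by apply: lrmr; rewrite jacBcl jacBcr jac_xy oner_neq0.
  have hxV : has_value (torus_point a^-1 (b / a)) xF^-1 a.
    by rewrite -[a in X in has_value _ _ X]invrK; apply: has_valueV; rewrite ?invr_eq0.
  have ux : has_value (local_ring u v) xF a^-1.
    by rewrite -[xF]invrK; apply: has_valueV => //; apply: lrml.
  apply: lr_torus => //; rewrite ?invr_eq0 ?mulf_neq0 ?invr_eq0 //.
    by have := has_valueM L' hy hxV; rewrite mulfVK.
  by have := has_valueM L (lrmr J) ux; rewrite mulfVK.
have chart3 a b : a != 0 -> b != 0 ->
    local_ring (yF^-1 - cK a) (xF / yF - cK b) = torus_point (b / a) a^-1.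
  move=> a0 b0; set u := _ - _; set v := _ - _.
  have J : jac u v != 0 by apply: good_jac; apply: P2_good; exists a, b; apply: Or33.
  have L := lr_loc J; have L' := good_loc (torus_point_good (b / a) a^-1).
  have hx : has_value (torus_point (b / a) a^-1) xF (b / a).
    by apply: lrml; rewrite jacBcl jacBcr jac_xy oner_neq0.
  have hy : has_value (torus_point (b / a) a^-1) yF a^-1.
    by apply: lrmr; rewrite jacBcl jacBcr jac_xy oner_neq0.
  have hyV : has_value (torus_point (b / a) a^-1) yF^-1 a.
    by rewrite -[a in X in has_value _ _ X]invrK; apply: has_valueV; rewrite ?invr_eq0.
  have uy : has_value (local_ring u v) yF a^-1.
    by rewrite -[yF]invrK; apply: has_valueV => //; apply: lrml.
  apply: lr_torus => //; rewrite ?invr_eq0 ?mulf_neq0 ?invr_eq0 //.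
    by have := has_valueM L' hx hyV; rewrite mulfVK.
  by have := has_valueM L (lrmr J) uy; rewrite mulfVK.
have J u v a b : (exists c d, [\/ local_ring (u - cK a) (v - cK b) = local_ring (xF - cK c) (yF - cK d),
         local_ring (u - cK a) (v - cK b) = local_ring ((xF)^-1 - cK c) (yF / xF - cK d)
       | local_ring (u - cK a) (v - cK b) = local_ring ((yF)^-1 - cK c) (xF / yF - cK d)]) ->
    jac (u - cK a) (v - cK b) != 0.
  by move=> h; apply: good_jac; apply: P2_good.
have K0 g : g - cK 0 = g by rewrite cK0 subr0.
move=> p; split.
- move=> [a [b [->|->|->]]]; have [->|a0] := eqVneq a 0; have [->|b0] := eqVneq b 0.
  + by apply: Or32; exists (e1, e2); rewrite ?inE ?eqxx // !K0 ex ey.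
  + by apply: Or33; exists e1, b; split=> //; rewrite K0 -(@ptE _ (1, 0)) // ex ey.
  + apply: Or33; exists e2, a^-1; split=> //; first by rewrite invr_eq0.
    rewrite K0 lrC; last first.
      by rewrite jacBcl jac_xy oner_neq0.
    by rewrite -(@ptEV _ (0, 1)) ?invr_eq0 // invrK ex ey.
  + by apply: Or31; exists a, b.
  + apply: Or32; exists (e2, e3); rewrite ?inE ?eqxx ?orbT // !K0 eyx exV /cross.
    by rewrite [RHS]lrC //; apply: (@jac_cross_neq0 e2 e3).
  + apply: Or33; exists e3, b^-1; split=> //; first by rewrite invr_eq0.
    by rewrite K0 -(@ptEV _ (-1, 0)) ?invr_eq0 // invrK eyx exV.
  + apply: Or33; exists e2, a; split=> //.
    rewrite K0 lrC; last first.
      by rewrite -[yF / xF]K0; apply: J; exists a, 0; apply: Or32.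
    by rewrite -(@ptE _ (-1, 1)) // eyx exV.
  + by rewrite chart2 //; apply: Or31; exists a^-1, (b / a);
      rewrite invr_eq0 mulf_neq0 ?invr_eq0.
  + by apply: Or32; exists (e3, e1); rewrite ?inE ?eqxx ?orbT // !K0 exy eyV.
  + apply: Or33; exists e3, b; split=> //.
    by rewrite K0 -(@ptE _ (0, -1)) // exy eyV.
  + apply: Or33; exists e1, a^-1; split=> //; first by rewrite invr_eq0.
    rewrite K0 lrC; last first.
      by rewrite -[xF / yF]K0; apply: J; exists a, 0; apply: Or33.
    by rewrite -(@ptEV _ (1, -1)) ?invr_eq0 // invrK exy eyV.
  + by rewrite chart3 //; apply: Or31; exists (b / a), a^-1;
      rewrite invr_eq0 mulf_neq0 ?invr_eq0.
- case=> [[a [b [a0 b0 ->]]]|[k]|[l [c [lr c0 ->]]]].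
  + by exists a, b; apply: Or31.
  + rewrite !inE => /or3P[] /eqP -> -> /=; exists 0, 0.
    * by apply: Or31; rewrite !K0 ex ey.
    * apply: Or32; rewrite !K0 /cross lrC; last exact: jac_cross_neq0.
      by rewrite eyx exV.
    * by apply: Or33; rewrite !K0 exy eyV.
  + move: lr; rewrite !inE => /or3P[] /eqP ->.
    * by exists 0, c; apply: Or31; rewrite K0 -(@ptE _ (1, 0)) // ex ey.
    * exists c^-1, 0; apply: Or31; rewrite K0 lrC.
        by rewrite -(@ptEV _ (0, 1)) // ex ey.
      by rewrite jacBcl jac_xy oner_neq0.
    * by exists 0, c; apply: Or33; rewrite K0 -(@ptE _ (0, -1)) // exy eyV.
Qed.

End Classification.

(** * Poles of eta on elaborations *)

Section Types.
Variables (C : numClosedFieldType) (F : ratField C).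
Local Notation K := (ratFun F).
Local Notation A := (Pol F).
Local Notation cK := (@cK C F).
Local Notation xF := (xF F).
Local Notation yF := (yF F).
Local Notation mon := (@mon C F).
Local Notation pt := (@pt C F).
Local Notation cross := (@cross C F).
Local Notation V := (@V C F).
Local Notation eta := (eta F).
Local Notation torus_point := (@torus_point C F).
Implicit Types (g h u v w : K) (P Q : A) (c d : C) (O p q z : point F).
Implicit Types (l m n : int * int) (X : surface F) (D E : set (point F)).

(** The local normal forms of eta on an elaboration: a unit times du dv, a unit times du dv / u, and
    a crossing. Crossings carry monomial coordinates, so that their exceptional curves are
    recognized as divisors of a definite weight. *)
Definition regular_pt p := exists u v,
  [/\ jac u v != 0, p = local_ring u v, form_coef eta u v != 0,
      p (form_coef eta u v) & p (form_coef eta u v)^-1].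
Definition smooth_pole p := exists u v e,
  [/\ jac u v != 0, p = local_ring u v, form_coef eta u v = e / u, e != 0 &
      p e /\ p e^-1].
Definition node_pole p := exists l1 l2, det l1 l2 = 1 /\ p = cross l1 l2.

Lemma eta_div g : eta / (g / (xF * yF)) = g^-1.
Proof. by rewrite invfM mulrCA divff ?mulr1 // invr_eq0 mulf_neq0 ?xF0 ?yF0. Qed.

Lemma eta_neq0 : eta != 0.
Proof. by rewrite /eta invr_eq0 mulf_neq0 ?xF0 ?yF0. Qed.

Lemma form_coef_neq0 u v : jac u v != 0 -> form_coef eta u v != 0.
Proof. by move=> J; rewrite mulf_neq0 ?eta_neq0 ?invr_eq0. Qed.

Lemma form_coef_change u v u' v' : jac u v != 0 ->
  local_ring u v = local_ring u' v' -> exists e,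
  [/\ e != 0, local_ring u v e, local_ring u v e^-1 &
      form_coef eta u' v' = form_coef eta u v * e].
Proof.
move=> J E; have [e [e0 pe pei j]] := good_jac_unit J E.
exists e^-1; rewrite invr_eq0 invrK; split=> //.
by rewrite /form_coef j; field; rewrite e0 J.
Qed.

(** Other coordinates change the coefficient of eta by a unit, so one pair in which its inverse is
    regular excludes a zero. *)
Lemma not_vanishing p u v : jac u v != 0 -> p = local_ring u v ->
  p (form_coef eta u v)^-1 -> ~ form_vanishes_at eta p.
Proof.
move=> J -> h [u' [v' [E m]]].
have [e [e0 pe pei j]] := form_coef_change J E.
have L := lr_loc J.
have : max_ideal (local_ring u v) (form_coef eta u v).
  rewrite (_ : form_coef eta u v = form_coef eta u' v' * e^-1).
    exact: locmMr.
  by rewrite j mulfK.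
by move/(locm_inv (form_coef_neq0 J)); apply.
Qed.

Lemma regular_pt_nv p : regular_pt p -> ~ form_vanishes_at eta p.
Proof. by move=> [u [v [J E _ _ h]]]; apply: not_vanishing J E h. Qed.

Lemma regular_pt_reg p : regular_pt p -> regular_form_at eta p.
Proof. by move=> [u [v [J E _ h _]]]; exists u, v. Qed.

Lemma smooth_pole_nv p : smooth_pole p -> ~ form_vanishes_at eta p.
Proof.
move=> [u [v [e [J E h e0 [pe pei]]]]]; apply: (not_vanishing J E).
rewrite h invf_div E in pei *; apply: (locM (lr_loc J)) => //; exact: lrl.
Qed.

Lemma node_pole_nv p : node_pole p -> ~ form_vanishes_at eta p.
Proof.
move=> [l1 [l2 [d1 E]]]; have J := jac_cross_neq0 F d1.
apply: (not_vanishing J E); rewrite /form_coef jac_cross // eta_div invrK E.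
by apply: (locM (lr_loc J)); [apply: lrl|apply: lrr].
Qed.

Lemma pt_smooth l c : primitive l -> c != 0 -> smooth_pole (pt l c).
Proof.
move=> pl c0; exists (mon (sdual l)), (mon (tdual l) - cK c), (mon (tdual l))^-1.
have h k := has_value_loc (pt_loc F pl c) (pt_tz F pl k c0).
split=> //; first exact: jac_pt.
- by rewrite /form_coef jacBcr jac_st // eta_div invfM mulrC.
- by rewrite invr_eq0 mon_neq0.
- by split; [apply: (h (-1))|rewrite invrK; apply: (h 1)].
Qed.

Lemma torus_regular a b : a != 0 -> b != 0 -> regular_pt (torus_point a b).
Proof.
move=> a0 b0; exists (xF - cK a), (yF - cK b).
have J : jac (xF - cK a) (yF - cK b) != 0.
  by rewrite jacBcl jacBcr jac_xy oner_neq0.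
have L := lr_loc J.
have hx : has_value (torus_point a b) xF a by apply: lrml.
have hy : has_value (torus_point a b) yF b by apply: lrmr.
have [_ hxi] := has_value_unit L hx a0; have [_ hyi] := has_value_unit L hy b0.
split=> //; first exact: form_coef_neq0.
- rewrite /form_coef jacBcl jacBcr jac_xy divr1 /eta invfM.
  exact: (locM L).
- rewrite /form_coef jacBcl jacBcr jac_xy divr1 /eta invrK.
  by apply: (locM L); [apply: has_value_loc hx|apply: has_value_loc hy].
Qed.

Lemma child1_jac u v c : jac u v != 0 -> jac u (v / u - cK c) != 0.
Proof.
by move=> J; have u0 := jac_neq0l J; rewrite jac_chart1 // mulf_neq0 ?invr_eq0.
Qed.
Lemma child2_jac u v : jac u v != 0 -> jac (u / v) v != 0.
Proof.
by move=> J; have v0 := jac_neq0r J; rewrite jac_chart2 // mulf_neq0 ?invr_eq0.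
Qed.

(** With [w = v / u] one has du dv = u du dw, which vanishes where u = 0. *)
Lemma regular_child p u v c : regular_pt p -> p = local_ring u v ->
  form_vanishes_at eta (local_ring u (v / u - cK c)).
Proof.
move=> [u' [v' [J' E' n0 pe pei]]] E; have J : jac u v != 0.
  by apply: good_jac; rewrite -E E'; exists u', v'.
have J1 := child1_jac c J; have u0 := jac_neq0l J.
exists u, (v / u - cK c); split=> //.
have E2 : local_ring u' v' = local_ring u v by rewrite -E E'.
have [e [e0 q1 q2 j]] := form_coef_change J' E2.
have ch : child u v (local_ring u (v / u - cK c)) by left; exists c.
rewrite (_ : form_coef eta u (v / u - cK c) = form_coef eta u v * u); last first.
  by rewrite /form_coef jac_chart1 //; field; rewrite u0 J.
apply: (locmM (lr_loc J1)); last exact: lrml.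
apply: (child_sub J ch); rewrite -E2 j; apply: (locM (lr_loc J')) => //.
by rewrite -E'.
Qed.

(** With [w = v / u] the form e du dv / u becomes e du dw, without a pole. A pole survives only at
    the exceptional point where the strict transform of u = 0 passes; with [w = u / v] it is e dw dv
    / w there. *)
Lemma smooth_child u v e q : jac u v != 0 -> form_coef eta u v = e / u ->
  e != 0 -> local_ring u v e -> local_ring u v e^-1 -> child u v q ->
  regular_pt q \/ (q = local_ring (u / v) v /\ smooth_pole q).
Proof.
move=> J h e0 pe pei ch; have u0 := jac_neq0l J; have v0 := jac_neq0r J.
have s := child_sub J ch; case: ch s => [[c ->]|->] s.
  left; exists u, (v / u - cK c); have J1 := child1_jac c J.
  have E : form_coef eta u (v / u - cK c) = e.
    rewrite (_ : form_coef _ _ _ = form_coef eta u v * u); last first.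
      by rewrite /form_coef jac_chart1 //; field; rewrite u0 J.
    by rewrite h mulfVK.
  by split; rewrite ?E //; apply: s.
right; split=> //; exists (u / v), v, e; split=> //; first exact: child2_jac.
- rewrite (_ : form_coef _ _ _ = form_coef eta u v * v); last first.
    by rewrite /form_coef jac_chart2 //; field; rewrite v0 J.
  by rewrite h; field; rewrite u0 v0.
- by split; apply: s.
Qed.

(** The star subdivision of the cone of [l1] and [l2]: both coordinates of the crossing have weight
    1 for [l1 + l2], so their quotient is a parameter of the divisor of that weight. *)
Lemma cross_child l1 l2 q : det l1 l2 = 1 ->
  child (mon (- tdual l2)) (mon (tdual l1)) q <->
  [\/ q = cross (l1 + l2) l2, q = cross l1 (l1 + l2) |
      exists2 c, c != 0 & q = pt (l1 + l2) c].
Proof.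
move=> d1; have dl : det (l1 + l2) l2 = 1 by rewrite -d1 /det /=; ring.
have t12 : tdual (l1 + l2) = tdual l1 - - tdual l2.
  by rewrite opprK /tdual; congr pair; rewrite /= opprD.
have tm : mon (tdual l1) / mon (- tdual l2) = mon (tdual (l1 + l2)).
  by rewrite t12 monD (monN _ (- tdual l2)).
have tm' : mon (- tdual l2) / mon (tdual l1) = mon (- tdual (l1 + l2)).
  by rewrite -invf_div tm monN.
have c2 : local_ring (mon (- tdual l2) / mon (tdual l1)) (mon (tdual l1)) =
    cross l1 (l1 + l2).
  by rewrite tm'.
have c1 c : local_ring (mon (- tdual l2)) (mon (tdual l1) / mon (- tdual l2) - cK c)
    = if c == 0 then cross (l1 + l2) l2 else pt (l1 + l2) c.
  rewrite tm; case: eqP => [->|/eqP c0]; first by rewrite cK0 subr0.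
  rewrite ptE //; first exact: det1_primitivel dl.
  by rewrite -d1 /dot /det /tdual /=; ring.
split.
- case=> [[c]|]; last by rewrite c2; apply: Or32.
  rewrite c1; case: eqP => [_|/eqP c0] ->; first exact: Or31.
  by apply: Or33; exists c.
- case=> [->|->|[c c0 ->]].
  + by left; exists 0; rewrite c1 eqxx.
  + by right; rewrite c2.
  + by left; exists c; rewrite c1 (negPf c0).
Qed.

(** Quantifying over all finite sets makes the property stable under blowups, each of which removes
    a single point. *)
Definition many_zeros X := forall s : seq (point F),
  exists p, [/\ X p, p \notin s & form_vanishes_at eta p].

Definition typed X :=
  (forall p, X p -> [\/ regular_pt p, smooth_pole p | node_pole p]) /\
  exists (L : seq (int * int)) (s : seq (point F)),
    (forall l, l \in L -> primitive l) /\
    forall p, X p -> [\/ regular_pt p, p \in s |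
       exists l c, [/\ l \in L, c != 0 & p = pt l c]].

Lemma child1_inj u v : jac u v != 0 ->
  injective (fun c => local_ring u (v / u - cK c)).
Proof.
move=> J c d e.
have [L _ h _] := child1_value c J; have [_ _ h' _] := child1_value d J.
by rewrite -e in h'; apply: has_value_uniq h h'.
Qed.

Lemma node_change u v l1 l2 : det l1 l2 = 1 -> local_ring u v = cross l1 l2 ->
  child u v = child (mon (- tdual l2)) (mon (tdual l1)).
Proof.
move=> d1 E; have J0 := jac_cross_neq0 F d1.
have J : jac u v != 0 by apply: good_jac; rewrite E; apply: cross_good.
by apply/funext => q; apply/propext; split; [apply: child_change E|
  apply: child_change (esym E)].
Qed.

(** The center decides. A regular point creates infinitely many zeros, a smooth pole adds at most
    one pole, recorded in [s], and a crossing adds the weight [l1 + l2] and two crossings. *)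
Lemma modification_typed X : modification X -> many_zeros X \/ typed X.
Proof.
elim=> [|{}X u v T IH Xo _].
  right; have [k1 k2 k3] := P2_toric F; split.
    move=> p /k3 [[a [b [a0 b0 ->]]]|[k /k1 [d1 _ _] ->]|[l [c [lr c0 ->]]]].
    - by apply: Or31; apply: torus_regular.
    - by apply: Or33; exists k.1, k.2.
    - by apply: Or32; apply: pt_smooth => //; apply: k2.
  exists [:: e1; e2; e3], [seq cross k.1 k.2 | k <- [:: (e1, e2); (e2, e3); (e3, e1)]].
  split=> // p /k3 [[a [b [a0 b0 ->]]]|[k kc ->]|].
  - by apply: Or31; apply: torus_regular.
  - by apply: Or32; apply: (map_f (fun k => cross k.1 k.2)).
  - by move=> h; apply: Or33.
have J : jac u v != 0 by apply: good_jac; apply: tower_good T Xo.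
case: IH => [mz|[ty [L [s [pL cl]]]]].
  left=> s; have [p [Xp pn pv]] := mz (local_ring u v :: s).
  move: pn; rewrite inE negb_or => /andP[/eqP pn ps].
  by exists p; split=> //; left.
have old p : (X `\ local_ring u v) p -> X p by case.
case: (ty _ Xo) => [reg|[u' [v' [e [J' E h e0 [pe pei]]]]]|[l1 [l2 [d1 E]]]].
- left=> r; have [B hB] := fiber_seq r (child1_inj J).
  have [c cB] := avoid_seq B.
  exists (local_ring u (v / u - cK c)); split; first by right; left; exists c.
    by apply: contra cB => /hB.
  exact: regular_child reg _.
- right; have -> := blowup_change X J E; rewrite -> E in *.
  have ch q := @smooth_child u' v' e q J' h e0 pe pei.
  split.
    move=> p [/old /ty //|/ch [r|[_ r]]]; [exact: Or31|exact: Or32].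
  exists L, (local_ring (u' / v') v' :: s); split=> // p [/old /cl [r|ps|r]|/ch [r|[-> _]]].
  + exact: Or31.
  + by apply: Or32; rewrite inE ps orbT.
  + exact: Or33.
  + exact: Or31.
  + by apply: Or32; rewrite inE eqxx.
- have dl : det (l1 + l2) l2 = 1 by rewrite -d1 /det /=; ring.
  have dr : det l1 (l1 + l2) = 1 by rewrite -d1 /det /=; ring.
  have p12 := det1_primitivel dl.
  right; split.
    move=> p [/old /ty //|chp]; have : child u v p by [].
    rewrite (node_change d1 E) => /(cross_child _ d1) [->|->|[c c0 ->]].
    + by apply: Or33; exists (l1 + l2), l2.
    + by apply: Or33; exists l1, (l1 + l2).
    + by apply: Or32; apply: pt_smooth.
  exists (l1 + l2 :: L), [:: cross (l1 + l2) l2, cross l1 (l1 + l2) & s]; split.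
    by move=> l; rewrite inE => /orP[/eqP ->|/pL].
  move=> p [/old /cl [r|ps|[l [c [lL c0 ->]]]]|chp].
  + exact: Or31.
  + by apply: Or32; rewrite !inE ps !orbT.
  + by apply: Or33; exists l, c; rewrite inE lL orbT.
  + have : child u v p by [].
    rewrite (node_change d1 E) => /(cross_child _ d1) [->|->|[c c0 ->]].
    * by apply: Or32; rewrite !inE eqxx.
    * by apply: Or32; rewrite !inE eqxx orbT.
    * by apply: Or33; exists (l1 + l2), c; rewrite inE eqxx.
Qed.

Lemma elaboration_typed X : elaboration X -> typed X.
Proof.
move=> [T nv]; case: (modification_typed T) => // mz.
by have [p [Xp _ /nv]] := mz [::]; case.
Qed.

Definition generic_in l D := forall B : seq C,
  exists c, [/\ c != 0, c \notin B & D (pt l c)].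

(** Pigeonhole by induction on [L]: a weight that is not generic accounts for finitely many points
    of [D], which are moved to [s]. *)
Lemma generic_exists D (L : seq (int * int)) (s : seq (point F)) :
  infinite_pts D ->
  (forall p, D p -> p \in s \/ exists l c, [/\ l \in L, c != 0 & p = pt l c]) ->
  exists2 l, l \in L & generic_in l D.
Proof.
move=> inf; elim: L s => [|l L IH] s h.
  by have [p /h [->//|[l [c []]]]] := inf s.
have [g|ng] := pselect (generic_in l D); first by exists l => //; rewrite inE eqxx.
have [B hB] : exists B : seq C, forall c, c != 0 -> D (pt l c) -> c \in B.
  apply: contrapT => n; apply: ng => B; apply: contrapT => n'; apply: n.
  exists B => c c0 Dc; apply/negPn/negP => cB; apply: n'; by exists c.
have [|l' l'L g] := IH (s ++ [seq pt l c | c <- B]); last first.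
  by exists l' => //; rewrite inE l'L orbT.
move=> p Dp; have [ps|[l' [c [l'L c0 e]]]] := h _ Dp.
  by left; rewrite mem_cat ps.
move: l'L; rewrite inE => /orP[/eqP l'l|l'L]; last by right; exists l', c.
left; rewrite mem_cat e l'l map_f ?orbT //; apply: hB => //.
by rewrite -l'l -e.
Qed.

(** Every function of [V l] is regular at some [pt l c] on [D], so the ring of [D] contains [V l];
    it is not all of K, and [V_max] applies. *)
Lemma ring_of_generic X D l : irreducible_closed X D -> all_good X -> D <> X ->
  primitive l -> generic_in l D -> ring_of D = V l.
Proof.
move=> I G nX pl g; apply: (V_max pl).
- move=> h [B hB]; have [c [c0 cB Dc]] := g B.
  by exists (pt l c) => //; apply: hB.
- move=> a b ra rb; have [|p Dp ps] := irr_dir I (s := [:: a; b]).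
    by move=> k; rewrite !inE => /orP[] /eqP ->.
  exists p => //; apply: (locM (good_loc (G _ (irr_sub I Dp)))); apply: ps;
    by rewrite !inE eqxx ?orbT.
- exact: irr_proper I G nX.
Qed.

Lemma polar_ring X D : is_placed_curve (X, D) -> pole eta D ->
  exists l, [/\ primitive l, ring_of D = V l & generic_in l D].
Proof.
move=> PD po; have [/= T S G I inf] := placed_tower PD.
have [/elaboration_typed [_ [L [s [pL cl]]]] [_ nX _]] := PD.
have [|l lL g] := generic_exists (L := L) (s := s) inf.
  move=> p Dp; case: (cl p (irr_sub I Dp)); [|by left|by right].
  by move/regular_pt_reg => h; case: (po _ Dp).
by exists l; split=> //; [exact: pL|apply: ring_of_generic I G nX (pL _ lL) g].
Qed.

Lemma ring_polar X D l : is_placed_curve (X, D) -> primitive l ->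
  ring_of D = V l -> pole eta D.
Proof.
move=> PD pl e p Dp; have [/= T S G I inf] := placed_tower PD.
apply: (V_pole pl); first exact: G (irr_sub I Dp).
by rewrite -e => g pg; exists p.
Qed.

Lemma ring_generic X D l : is_placed_curve (X, D) -> primitive l ->
  ring_of D = V l -> generic_in l D.
Proof.
move=> PD pl e; have [m [pm e' g]] := polar_ring PD (ring_polar PD pl e).
suff -> : l = m by [].
by apply: (V_inj (F := F)) => //; rewrite -e -e'.
Qed.

(** A point lies on a curve exactly when its local ring is contained in that of the generic point,
    as in [irr_char]. *)
Definition divisor X l : set (point F) := [set p | X p /\ p `<=` V l].

Section Divisor.
Variables (X : surface F) (l : int * int).
Hypotheses (S : separated X) (G : all_good X) (pl : primitive l).
Hypothesis hX : generic_in l X.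

Lemma V_common (s : seq K) : (forall g, g \in s -> V l g) ->
  exists B : seq C, forall c, c != 0 -> c \notin B -> all_in (pt l c) s.
Proof.
elim: s => [|g s IH] h; first by exists [::].
have [|B hB] := IH; first by move=> k ks; apply: h; rewrite inE ks orbT.
have [B' hB'] : V l g by apply: h; rewrite inE eqxx.
exists (B ++ B') => c c0; rewrite mem_cat negb_or => /andP[cB cB'] k.
by rewrite inE => /orP[/eqP ->|]; [apply: hB'|apply: hB].
Qed.

Lemma divisor_pt c : c != 0 -> X (pt l c) -> divisor X l (pt l c).
Proof. by move=> c0 Xc; split=> //; apply: pt_sub_V. Qed.

Lemma divisor_ring : ring_of (divisor X l) = V l.
Proof.
apply/seteqP; split=> g; first by case=> p [_ h] /h.
move=> [B hB]; have [c [c0 cB Xc]] := hX B.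
by exists (pt l c); [apply: divisor_pt|apply: hB].
Qed.

Lemma divisor_closed : zariski_closed X (divisor X l).
Proof.
split; first by move=> p [].
split=> [p []//|p [Xp np]].
have [g pg ng] : exists2 g, p g & ~ V l g.
  apply: contrapT => h; apply: np; split=> // g pg; apply: contrapT => ng.
  by apply: h; exists g.
exists [:: g]; split; first exact/all_in1.
by move=> q Xq /all_in1 qg; split=> // -[_ /(_ _ qg)].
Qed.

Lemma divisor_irr : irreducible_closed X (divisor X l).
Proof.
split; first exact: divisor_closed.
  by have [c [c0 _ Xc]] := hX [::]; exists (pt l c); apply: divisor_pt.
move=> Z1 Z2 [_ [_ o1]] [_ [_ o2]] sub; apply: contrapT => n.
have [p1 Dp1 n1] : exists2 p, divisor X l p & ~ Z1 p.
  apply: contrapT => h; apply: n; left=> p Dp; apply: contrapT => np.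
  by apply: h; exists p.
have [p2 Dp2 n2] : exists2 p, divisor X l p & ~ Z2 p.
  apply: contrapT => h; apply: n; right=> p Dp; apply: contrapT => np.
  by apply: h; exists p.
have [s1 [ps1 os1]] := o1 p1 (conj (proj1 Dp1) n1).
have [s2 [ps2 os2]] := o2 p2 (conj (proj1 Dp2) n2).
have [B hB] : exists B : seq C, forall c, c != 0 -> c \notin B ->
    all_in (pt l c) (s1 ++ s2).
  apply: V_common => g; rewrite mem_cat => /orP[/ps1|/ps2].
    by case: Dp1 => _; apply.
  by case: Dp2 => _; apply.
have [c [c0 cB Xc]] := hX B.
have /all_in_cat [i1 i2] := hB c c0 cB.
have [_ m1] := os1 _ Xc i1; have [_ m2] := os2 _ Xc i2.
by case: (sub _ (divisor_pt c0 Xc)).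
Qed.

Lemma divisor_infinite : infinite_pts (divisor X l).
Proof.
move=> s; have [B hB] := fiber_seq s (@pt_inj _ F _ pl).
have [c [c0 cB Xc]] := hX B; exists (pt l c); first exact: divisor_pt.
by apply: contra cB => /hB.
Qed.
End Divisor.

End Types.

(** * Toric surfaces *)

Section Toric.
Variables (C : numClosedFieldType) (F : ratField C).
Local Notation K := (ratFun F).
Local Notation A := (Pol F).
Local Notation cK := (@cK C F).
Local Notation xF := (xF F).
Local Notation yF := (yF F).
Local Notation mon := (@mon C F).
Local Notation pt := (@pt C F).
Local Notation cross := (@cross C F).
Local Notation V := (@V C F).
Local Notation eta := (eta F).
Local Notation torus_point := (@torus_point C F).
Implicit Types (g h u v w : K) (P Q : A) (c d : C) (O p q z : point F).
Implicit Types (l m n : int * int) (X : surface F) (D E : set (point F)).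

Lemma pullbXz u v g (k : int) : jac u v != 0 ->
  pullb u v (g ^ k) = pullb u v g ^ k.
Proof.
move=> J; have nat_case (n : nat) : pullb u v (g ^+ n) = pullb u v g ^+ n.
  elim: n => [|n IH]; first by rewrite !expr0 pullb1.
  by rewrite !exprS pullbM // IH.
case: (intP k) => [|n|n]; first by rewrite !expr0z pullb1.
  by rewrite -!exprnP.
by rewrite -!invr_expz -!exprnP pullbV // nat_case.
Qed.

Lemma pullb_mon u v m : jac u v != 0 -> pullb u v (mon m) = u ^ m.1 * v ^ m.2.
Proof. by move=> J; rewrite /mon pullbM // !pullbXz // pullb_x // pullb_y. Qed.

Lemma jac_scale (s t : C) : s != 0 -> t != 0 ->
  jac (cK s * xF) (cK t * yF) != 0.
Proof.
move=> s0 t0; rewrite (_ : jac _ _ = cK s * cK t); last first.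
  by rewrite !jacMl !jacMr !jacCl !jacCr jac_xy; ring.
by rewrite mulf_neq0 ?cK_eq0.
Qed.

Lemma cKXz c (k : int) : cK (c ^ k) = cK c ^ k.
Proof.
case: (intP k) => [|n|n]; first by rewrite !expr0z cK1.
  by rewrite -!exprnP cKX.
by rewrite -!invr_expz -!exprnP cKV cKX.
Qed.

Lemma scale_mon (s t : C) m : s != 0 -> t != 0 ->
  pullb (cK s * xF) (cK t * yF) (mon m) = cK (s ^ m.1 * t ^ m.2) * mon m.
Proof.
move=> s0 t0; rewrite pullb_mon ?jac_scale // !expfzMl mulrACA cKM.
by rewrite !cKXz.
Qed.

(** The torus multiplies the two monomial coordinates by constants. *)
Lemma cross_fixed l1 l2 : det l1 l2 = 1 -> torus_fixed (cross l1 l2).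
Proof.
move=> d1 s t s0 t0 _ [P [Q [Q0 ->]]].
have J := jac_scale s0 t0; have Jc := jac_cross_neq0 F d1.
have L := lr_loc Jc.
rewrite pullbM // pullbV // !pullb_sb // !scale_mon //.
set u := cK _ * _; set v := cK _ * mon (tdual l1).
have mu : max_ideal (cross l1 l2) u.
  by apply: (locmM L); [apply: locC|apply: lrml].
have mv : max_ideal (cross l1 l2) v.
  by apply: (locmM L); [apply: locC|apply: lrmr].
apply: (locM L); first exact: has_value_loc (sb_value L P mu mv).
by have [] := has_value_unit L (sb_value L Q mu mv) Q0.
Qed.

Lemma two_exp (k : int) : (2 : C) ^ k = 1 -> k = 0.
Proof.
have two0 : (2 : C) != 0 by rewrite pnatr_eq0.
have nat_case (n : nat) : (2 : C) ^+ n = 1 -> n = 0%N.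
  rewrite -natrX => /eqP; rewrite (eqr_nat C _ 1) => /eqP.
  by case: n => // n; rewrite expnS; lia.
case: (intP k) => // n; first by rewrite -exprnP => /nat_case.
by rewrite -invr_expz -exprnP => /(congr1 GRing.inv); rewrite invrK invr1 => /nat_case.
Qed.

Lemma mon_nonconst m c : m != 0 -> mon m - cK c != 0.
Proof.
move=> m0; apply: (@jac_neq0l _ F _ (mon (- m.2, m.1))).
rewrite jacBcl jac_mon; apply: mulf_neq0; last first.
  by rewrite invr_eq0; apply: mulf_neq0; [apply: xF0|apply: yF0].
apply: mulf_neq0; last exact: mon_neq0.
rewrite -cKint cK_eq0 intr_eq0 /det /=; apply: contra_neq m0.
case: m => a b /=; rewrite mulrN opprK => e.
suff [-> ->] : a = 0 /\ b = 0 by [].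
by split; nia.
Qed.

(** A torus element scales the monomial by some [k] different from 1. Then [mon m - k c] is a unit
    at [p], but its pullback [k (mon m - c)] is not. So a toric modification blows up crossings
    only. *)
Lemma not_torus_fixed p m c : is_loc p -> m != 0 -> c != 0 ->
  has_value p (mon m) c -> ~ torus_fixed p.
Proof.
move=> L m0 c0 h fx.
(* As 2 is not a root of unity, it detects every nonzero exponent. *)
have [s [t [s0 t0 st]]] : exists s t : C,
    [/\ s != 0, t != 0 & s ^ m.1 * t ^ m.2 != 1].
  have two0 : (2 : C) != 0 by rewrite pnatr_eq0.
  have [m1|m1] := eqVneq m.1 0.
    exists 1, 2; rewrite oner_neq0 two0; split=> //.
    rewrite exp1rz mul1r; apply: contra_neq m0 => /two_exp.
    by case: (m) m1 => a b /= -> ->.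
  exists 2, 1; rewrite oner_neq0 two0; split=> //.
  by rewrite exp1rz mulr1; apply: contra_neq m1 => /two_exp.
set k := s ^ m.1 * t ^ m.2 in st.
have k0 : k != 0 by rewrite mulf_neq0 // expfz_neq0.
have hv : has_value p (mon m - cK (k * c)) (c - k * c).
  by apply: has_valueB => //; apply: has_valueC.
have n0 : c - k * c != 0.
  by rewrite -[X in X - _]mul1r -mulrBl mulf_neq0 // subr_eq0 eq_sym.
have [_ pg] := has_value_unit L hv n0.
have J := jac_scale s0 t0.
have := fx s t s0 t0 _ pg; rewrite pullbV // pullbB // pullbC // scale_mon //.
rewrite -/k [cK (k * c)]cKM -mulrBr invfM -cKV => pk.
apply: (locm_inv (mon_nonconst c m0) h).
rewrite -[_^-1]mul1r -(cK1 F) -(divff k0) cKM -mulrA.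
by apply: (locM L) => //; apply: (locC L).
Qed.

Lemma tdual_neq0 l : primitive l -> tdual l != 0.
Proof.
move=> pl; apply/eqP => e; have := dot_sdual pl.
by case: l e {pl} => a b [] /eqP; rewrite oppr_eq0 => /eqP -> ->; rewrite /dot /= !mul0r.
Qed.

Lemma toric_blowup X cones rays l1 l2 : toric X cones rays ->
  (l1, l2) \in cones ->
  toric (blowup X (mon (- tdual l2)) (mon (tdual l1)))
    [:: (l1 + l2, l2), (l1, l1 + l2) &
        [seq k <- cones | cross k.1 k.2 != cross l1 l2]] (l1 + l2 :: rays).
Proof.
move=> [k1 k2 k3] lc; have [/= d1 r1 r2] := k1 _ lc.
have dl : det (l1 + l2) l2 = 1 by rewrite -d1 /det /=; ring.
have dr : det l1 (l1 + l2) = 1 by rewrite -d1 /det /=; ring.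
split.
- move=> k; rewrite !inE => /or3P[/eqP -> /=|/eqP -> /=|].
  + by split=> //; rewrite ?inE ?eqxx // r2 orbT.
  + by split=> //; rewrite ?inE ?eqxx // r1 orbT.
  + by rewrite mem_filter => /andP[_ /k1 [? h1 h2]]; split=> //; rewrite ?h1 ?h2 orbT.
- move=> l; rewrite inE => /orP[/eqP ->|/k2 //]; exact: det1_primitivel dl.
move=> p; split.
- move=> [[/k3 Xp /= np]|chp].
    case: Xp => [tp|[k kc e]|[l [c [lr c0 e]]]]; first exact: Or31.
      apply: Or32; exists k => //; rewrite !inE mem_filter kc andbT.
      by apply/or3P/Or33; rewrite -e; apply/eqP.
    by apply: Or33; exists l, c; rewrite inE lr orbT.
  have /(cross_child _ d1) : child (mon (- tdual l2)) (mon (tdual l1)) p by [].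
  case=> [->|->|[c c0 ->]].
  + by apply: Or32; exists (l1 + l2, l2); rewrite // inE eqxx.
  + by apply: Or32; exists (l1, l1 + l2); rewrite // !inE eqxx orbT.
  + by apply: Or33; exists (l1 + l2), c; rewrite inE eqxx.
have ch q : [\/ q = cross (l1 + l2) l2, q = cross l1 (l1 + l2) |
      exists2 c, c != 0 & q = pt (l1 + l2) c] ->
    blowup X (mon (- tdual l2)) (mon (tdual l1)) q.
  by move/(cross_child _ d1) => h; right.
case=> [tp|[k]|[l [c []]]].
(* A torus point is not the center: eta is regular there and has a pole at each crossing. *)
- left; split; first by apply/k3/Or31.
  move=> /= e; case: tp => a [b [a0 b0 ep]].
  apply: (@V_pole _ F l1 p).
  + exact: det1_primitivel d1.
  + by rewrite e; apply: cross_good.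
  + by rewrite e; apply: cross_sub_l.
  + by rewrite ep; apply: regular_pt_reg; apply: torus_regular.
- rewrite !inE => /or3P[/eqP ->|/eqP ->|] /=.
  + by move=> e; apply/ch/Or31.
  + by move=> e; apply/ch/Or32.
  + rewrite mem_filter => /andP[ne kc] e; left; split.
      by apply/k3/Or32; exists k.
    by move=> /= e'; case/eqP: ne; rewrite -e.
- rewrite inE => /orP[/eqP ->|lr] c0 e; first by apply/ch/Or33; exists c.
  left; split; first by apply/k3/Or33; exists l, c.
  by rewrite e /=; apply: pt_not_cross => //; apply: k2.
Qed.

Lemma toric_tower X : toric_modification X -> exists cones rays, toric X cones rays.
Proof.
elim=> [|{}X u v T [cones [rays tX]] Xo fx]; first by do 2!eexists; apply: P2_toric.
have [k1 k2 k3] := tX.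
have Lo := tower_loc T Xo.
case/k3: (Xo) => [[a [b [a0 b0 e]]]|[[l1 l2] kc /= e]|[l [c [lr c0 e]]]].
- case: (@not_torus_fixed (local_ring u v) (1, 0) a) => //.
  by rewrite mon_x e; apply: lrml; rewrite jacBcl jacBcr jac_xy oner_neq0.
- have [d1 _ _] := k1 _ kc.
  have J : jac u v != 0 by apply: good_jac; rewrite e; apply: cross_good.
  rewrite (blowup_change X J e); do 2!eexists; exact: toric_blowup tX kc.
- have pl := k2 _ lr; case: (@not_torus_fixed (local_ring u v) (tdual l) c) => //.
    exact: tdual_neq0.
  by rewrite e; apply: pt_t.
Qed.

Lemma toric_mod X : toric_modification X -> modification X.
Proof. by elim=> [|{}X u v T TX Xo _]; [apply: tower_P2|apply: tower_blowup]. Qed.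

Lemma toric_nv X cones rays p : toric X cones rays -> X p ->
  ~ form_vanishes_at eta p.
Proof.
move=> [k1 k2 k3] /k3 [[a [b [a0 b0 ->]]]|[k /k1 [d1 _ _] ->]|[l [c [/k2 pl c0 ->]]]].
- by apply: regular_pt_nv; apply: torus_regular.
- by apply: node_pole_nv; exists k.1, k.2.
- by apply: smooth_pole_nv; apply: pt_smooth.
Qed.

Lemma toric_elaboration X : toric_modification X -> elaboration X.
Proof.
move=> T; split; first exact: toric_mod.
by have [cones [rays tX]] := toric_tower T; move=> p; apply: toric_nv tX.
Qed.

Lemma toric_subdivide (n : nat) X cones rays l1 l2 (a b : int) l :
  toric_modification X -> toric X cones rays -> (l1, l2) \in cones ->
  0 <= a -> 0 <= b -> (a + b <= n%:Z)%R -> primitive l ->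
  l = (a * l1.1 + b * l2.1, a * l1.2 + b * l2.2) ->
  exists X' cones' rays', [/\ toric_modification X', toric X' cones' rays' & l \in rays'].
Proof.
elim: n X cones rays l1 l2 a b => [|n IH] X cones rays l1 l2 a b T tX lc a0 b0 ab pl e.
  have [ea eb] : a = 0 /\ b = 0 by lia.
  have l0 : l = (0, 0) by rewrite e ea eb !mul0r addr0.
  by have := dot_sdual pl; rewrite /dot l0 !mul0r.
have [k1 k2 k3] := tX; have [/= d1 r1 r2] := k1 _ lc.
have unit_case (k : int) (l' : int * int) : 0 <= k -> l = (k * l'.1, k * l'.2) -> l = l'.
  move=> k0 el; have := dot_sdual pl; rewrite {1}el /dot /= -!mulrA -mulrDr.
  move=> /(congr1 absz); rewrite abszM => /eqP; rewrite muln_eq1 => /andP[/eqP h _].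
  by rewrite el (_ : k = 1) ?mul1r; [case: l' {el}|lia].
have [ea|an] := eqVneq a 0.
  exists X, cones, rays; split=> //; rewrite (unit_case b l2) //.
  by rewrite e ea !mul0r !add0r.
have [eb|bn] := eqVneq b 0.
  exists X, cones, rays; split=> //; rewrite (unit_case a l1) //.
  by rewrite e eb !mul0r !addr0.
have T' : toric_modification (blowup X (mon (- tdual l2)) (mon (tdual l1))).
  apply: tower_blowup => //; last exact: cross_fixed.
  by apply/k3/Or32; exists (l1, l2).
have tX' := toric_blowup tX lc.
have [ab'|ab'] := leP b a.
- apply: (IH _ _ _ l1 (l1 + l2) (a - b) b T' tX') => //; try lia.
    by rewrite !inE eqxx orbT.
  by rewrite e; congr pair => /=; ring.
- apply: (IH _ _ _ (l1 + l2) l2 a (b - a) T' tX') => //; try lia.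
    by rewrite !inE eqxx.
  by rewrite e; congr pair => /=; ring.
Qed.

Lemma toric_exists l : primitive l -> exists X cones rays,
  [/\ toric_modification X, toric X cones rays & l \in rays].
Proof.
move=> pl; have T := tower_P2 (@torus_fixed C F); have tX := P2_toric F.
have sub (n : nat) l1 l2 a b := @toric_subdivide n _ _ _ l1 l2 a b l T tX.
have [x0|x0] := leP 0 l.1; have [y0|y0] := leP 0 l.2.
- apply: (sub (absz (l.1 + l.2)%R) e1 e2 l.1 l.2) => //; first by lia.
  by case: (l) => x y; rewrite /= !mulr0 !mulr1 addr0 add0r.
(* Weights with a negative entry lie in one of the other two cones of P^2; the coefficients are the
   coordinates of [l] in the basis of that cone. *)
- apply: (sub (absz (l.1 - l.2 - l.2)%R) e3 e1 (- l.2) (l.1 - l.2)) => //; try lia.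
  by case: (l) => x y /=; congr pair; ring.
- apply: (sub (absz (l.2 - l.1 - l.1)%R) e2 e3 (l.2 - l.1) (- l.1)) => //; try lia.
  by case: (l) => x y /=; congr pair; ring.
have [xy|xy] := leP l.2 l.1.
- apply: (sub (absz (l.1 - l.2 - l.2)%R) e3 e1 (- l.2) (l.1 - l.2)) => //; try lia.
  by case: (l) => x y /=; congr pair; ring.
- apply: (sub (absz (l.2 - l.1 - l.1)%R) e2 e3 (l.2 - l.1) (- l.1)) => //; try lia.
  by case: (l) => x y /=; congr pair; ring.
Qed.

Section Components.
Variables (X : surface F) (cones : seq ((int * int) * (int * int))).
Variable rays : seq (int * int).
Hypotheses (T : toric_modification X) (tX : toric X cones rays).

Lemma toric_separated : separated X.
Proof. exact: tower_separated T. Qed.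
Lemma toric_good : all_good X.
Proof. by move=> p; apply: tower_good T. Qed.
Let S := toric_separated.
Let G := toric_good.

Lemma toric_ray_primitive l : l \in rays -> primitive l.
Proof. by case: tX => _ h _ /h. Qed.
Let pr := toric_ray_primitive.

Lemma toric_pt l c : l \in rays -> c != 0 -> X (pt l c).
Proof. by case: tX => _ _ h lr c0; apply/h/Or33; exists l, c. Qed.

Lemma toric_generic l : l \in rays -> generic_in l X.
Proof.
move=> lr B; have [c] := avoid_seq (0 :: B); rewrite inE negb_or => /andP[c0 cB].
by exists c; split=> //; apply: toric_pt.
Qed.

Lemma torus_not_V p l : torus F p -> primitive l -> ~ p `<=` V l.
Proof.
move=> [a [b [a0 b0 ->]]] pl h; apply: (V_pole pl _ h).
  exact: torus_point_good.
by apply: regular_pt_reg; apply: torus_regular.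
Qed.

Lemma torus1 : X (torus_point 1 1) /\ torus F (torus_point 1 1).
Proof.
have t : torus F (torus_point 1 1) by exists 1, 1; rewrite oner_neq0.
by split=> //; case: tX => _ _ h; apply/h/Or31.
Qed.

Lemma divisor_neqX l : l \in rays -> divisor X l <> X.
Proof.
move=> lr e; have [X1 t1] := torus1; move: X1; rewrite -e => -[_].
by apply: torus_not_V => //; apply: pr.
Qed.

Lemma divisor_placed l : l \in rays -> is_placed_curve (X, divisor X l).
Proof.
move=> lr; have g := toric_generic lr; have pl := pr lr.
split; first exact: toric_elaboration.
split; [exact: divisor_irr|exact: divisor_neqX|].
move=> p /= e; have [q] := divisor_infinite pl g [:: p].
by rewrite e => ->; rewrite inE eqxx.
Qed.

(** The boundary consists of finitely many crossings and of points [pt l c]. An infinite [E] is thus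
    generic for some ray, and its ring identifies it with the divisor. *)
Lemma toric_irreducible E : irreducible_closed X E -> E `<=` X `\` torus F ->
  (exists p, E = [set p]) \/ exists2 l, l \in rays & E = divisor X l.
Proof.
move=> I sub; have [k1 k2 k3] := tX.
have [h|np] := pselect (exists p, E = [set p]); first by left.
right; have inf : infinite_pts E.
  by apply: (irr_infinite I S G) => p e; apply: np; exists p.
have [|l lr g] := generic_exists (L := rays)
    (s := [seq cross k.1 k.2 | k <- cones]) inf.
  move=> p /sub [/k3 [//|[k kc ->]|h] nt]; [left|by right].
  exact: (map_f (fun k => cross k.1 k.2)).
exists l => //; rewrite [LHS](irr_char I).
suff -> : ring_of E = V l by [].
apply: ring_of_generic I G _ (pr lr) g => e.
by have [X1 t1] := torus1; rewrite -e in X1; have [] := sub _ X1.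
Qed.

Lemma divisor_component l : l \in rays ->
  irreducible_component X (X `\` torus F) (divisor X l).
Proof.
move=> lr; have g := toric_generic lr; have pl := pr lr.
split; first exact: divisor_irr.
  by move=> p [Xp h]; split=> // t; apply: torus_not_V t pl h.
move=> E I sub dE; case: (toric_irreducible I sub) => [[p e]|[m mr e]].
  have [q dq] := divisor_infinite pl g [:: p].
  by have := dE _ dq; rewrite e => ->; rewrite inE eqxx.
suff -> : l = m by [].
apply: (V_inj (F := F)) => //; first exact: pr.
move=> h; rewrite -(divisor_ring pl g) => -[p /dE]; rewrite e => -[_ s] /s.
exact.
Qed.

(** A single point is not maximal, as it lies in a divisor. If the component is the divisor of
    weight [m], the coordinates of [pt l c] identify [m] with [l] by [V_inj_mon]. *)
Lemma component_pt l c E : l \in rays -> c != 0 ->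
  irreducible_component X (X `\` torus F) E -> E (pt l c) -> E = divisor X l.
Proof.
move=> lr c0 [I sub mx] Ep; have g := toric_generic lr; have pl := pr lr.
have dp : divisor X l (pt l c) by apply: divisor_pt => //; apply: toric_pt.
case: (toric_irreducible I sub) => [[p e]|[m mr e]].
  have [I' sub' _] := divisor_component lr.
  by apply: esym; apply: mx => // q; rewrite e => ->; move: Ep; rewrite e => <-.
suff -> : l = m by [].
have pm := pr mr; move: Ep; rewrite e => -[_ s].
apply: (@V_inj_mon _ F) => //; apply: s.
- exact: (has_value_loc (pt_loc F pl c) (pt_t F pl c)).
- by rewrite monN; apply: pt_tV.
- by case: (pt_s F pl c).
Qed.

Lemma cross_component k : k \in cones ->
  divisor X k.1 (cross k.1 k.2) /\ divisor X k.2 (cross k.1 k.2).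
Proof.
case: tX => h1 _ h3 kc; have [d1 _ _] := h1 _ kc.
have Xk : X (cross k.1 k.2) by apply/h3/Or32; exists k.
by split; split=> //; [apply: cross_sub_l|apply: cross_sub_r].
Qed.
End Components.

End Toric.

(** * Lowest terms *)

Definition nadd (m n : nat * nat) : nat * nat := (m.1 + n.1, m.2 + n.2)%N.
Definition nmul (k : nat) (m : nat * nat) : nat * nat := (k * m.1, k * m.2)%N.

Lemma nvec_add m n : nvec (nadd m n) = nvec m + nvec n.
Proof. by rewrite /nvec /nadd; congr pair. Qed.
Lemma nvec_inj : injective nvec.
Proof. by move=> [a b] [c d] [-> ->]. Qed.

Section Flags.
Variables (R : realFieldType).
Implicit Types (t s : R * R) (m n a b : int * int).

Definition rdot t m : R := t.1 * m.1%:~R + t.2 * m.2%:~R.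

Lemma rdotD t m n : rdot t (m + n) = rdot t m + rdot t n.
Proof. by rewrite /rdot /= !rmorphD /=; ring. Qed.
Lemma rdotN t m : rdot t (- m) = - rdot t m.
Proof. by rewrite /rdot /= !rmorphN /=; ring. Qed.
Lemma rdotB t m n : rdot t (m - n) = rdot t m - rdot t n.
Proof. by rewrite rdotD rdotN. Qed.

Definition intv (l : int * int) : R * R := (l.1%:~R, l.2%:~R).

Lemma rdot_int l m : rdot (intv l) m = (dot l m)%:~R.
Proof. by rewrite /rdot /dot rmorphD !rmorphM. Qed.

Variables (t s : R * R).
Hypothesis ts : t.1 * s.2 - t.2 * s.1 != 0.

(** The lexicographic order of the flag [(t, s)]. For independent [t] and [s] it is a total order on
    Z^2 compatible with addition. *)
Definition fle m n : bool :=
  (rdot t m < rdot t n) || ((rdot t m == rdot t n) && (rdot s m <= rdot s n)).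

Lemma fle_refl m : fle m m.
Proof. by rewrite /fle eqxx lexx orbT. Qed.

Lemma fle_rdot m n : fle m n -> rdot t m <= rdot t n.
Proof. by case/orP => [/ltW//|/andP[/eqP -> _]]. Qed.

Lemma fle_trans : transitive fle.
Proof.
move=> b a c; rewrite /fle => /orP[h|/andP[/eqP e h]] /orP[h'|/andP[/eqP e' h']].
- by rewrite (lt_trans h h').
- by rewrite -e' h.
- by rewrite e h'.
- by rewrite e e' eqxx (le_trans h h') orbT.
Qed.

Lemma fle_total m n : fle m n || fle n m.
Proof.
by rewrite /fle; case: ltgtP => //= _; apply: le_total.
Qed.

Lemma fle_add a b m n : fle a m -> fle b n -> fle (a + b) (m + n).
Proof.
rewrite /fle !rdotD => /orP[h|/andP[/eqP -> h]] /orP[h'|/andP[/eqP -> h']].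
- by rewrite ltrD.
- by rewrite ltrD2r h.
- by rewrite ltrD2l h'.
- by rewrite eqxx lerD ?orbT.
Qed.

Lemma fle_anti m n : fle m n -> fle n m -> m = n.
Proof.
move=> h h'; have e : rdot t m = rdot t n.
  by apply/eqP; rewrite eq_le !fle_rdot.
move: h h'; rewrite /fle e ltxx eqxx /= => h h'.
have e' : rdot s m = rdot s n by apply/eqP; rewrite eq_le h.
have z x y : rdot t (x, y) = 0 -> rdot s (x, y) = 0 -> x = 0 /\ y = 0.
  rewrite /rdot /= => z1 z2; split; apply/eqP; rewrite -(intr_eq0 R);
    apply/eqP/(mulfI ts); rewrite mulr0.
    transitivity (s.2 * (t.1 * x%:~R + t.2 * y%:~R) - t.2 * (s.1 * x%:~R + s.2 * y%:~R)).
      by ring.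
    by rewrite z1 z2; ring.
  transitivity (t.1 * (s.1 * x%:~R + s.2 * y%:~R) - s.1 * (t.1 * x%:~R + t.2 * y%:~R)).
    by ring.
  by rewrite z1 z2; ring.
case: (m) (n) e e' => a b [c d] e e'.
have [h1 h2] : a - c = 0 /\ b - d = 0.
  apply: z; rewrite (_ : (a - c, b - d) = (a, b) - (c, d)) // rdotB ?e ?e' subrr //.
by congr pair; lia.
Qed.

(** Among all products of a term above [m] and a term above [n], only that of the lowest terms has
    exponent [m + n], so it cannot cancel. *)
Lemma fle_cancel a b m n : fle m a -> fle n b -> a + b = m + n -> m = a.
Proof.
move=> h h' e; apply: fle_anti => //.
have := fle_add h' (fle_refl (m - b)).
have -> : n + (m - b) = a by rewrite addrA [n + m]addrC -e addrK.
by rewrite addrC subrK.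
Qed.

End Flags.

Section Leading.
Variables (R : realFieldType) (C : numClosedFieldType) (F : ratField C).
Local Notation K := (ratFun F).
Local Notation A := (Pol F).
Local Notation cK := (@cK C F).
Local Notation xF := (xF F).
Local Notation yF := (yF F).
Implicit Types (g h u v w : K) (P Q : A) (c d : C) (m n : nat * nat).

Lemma cf_sum (I : Type) (r : seq I) (f : I -> A) m :
  cf (\sum_(i <- r) f i) m = \sum_(i <- r) cf (f i) m.
Proof.
elim: r => [|i r IH]; first by rewrite !big_nil cf0.
by rewrite !big_cons cfD IH.
Qed.

Lemma cfN P m : cf (- P) m = - cf P m.
Proof. by apply: (addrI (cf P m)); rewrite -cfD !subrr cf0. Qed.

Lemma cfM P Q m : cf (P * Q) m = \sum_(a <- supp P) cf P a *
  (if (a.1 <= m.1)%N && (a.2 <= m.2)%N then cf Q (m.1 - a.1, m.2 - a.2)%N else 0).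
Proof.
rewrite {1}[P]polE mulr_suml cf_sum; apply: eq_bigr => a _.
by rewrite -mulrA cfZ cfMX.
Qed.

Lemma cf_Xd P m : cf (XP F * dP ord0 P) m = m.1%:R * cf P m.
Proof.
have := cfMX (dP ord0 P) 1 0 m; rewrite expr1 expr0 mulr1 => ->.
case: m => [[|i] j] /=; first by rewrite mul0r.
by rewrite subn1 subn0 cf_dX mulr_natl.
Qed.

Lemma cf_Yd P m : cf (YP F * dP ord_max P) m = m.2%:R * cf P m.
Proof.
have := cfMX (dP ord_max P) 0 1 m; rewrite expr1 expr0 mul1r => ->.
case: m => [i [|j]] /=; first by rewrite mul0r.
by rewrite subn1 subn0 cf_dY mulr_natl.
Qed.

Section Flag.
Variables (t s : R * R).
Hypothesis ts : t.1 * s.2 - t.2 * s.1 != 0.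
Local Notation le := (fle t s).

(* m is a lower bound for the exponents of P, attained if c is not 0. *)
Definition bnd P m c := (forall n, n \in supp P -> le (nvec m) (nvec n)) /\ cf P m = c.

Lemma bnd0 m : bnd 0 m 0.
Proof. by split=> [n|]; rewrite ?mem_supp cf0 // eqxx. Qed.

Lemma bndD P Q m c d : bnd P m c -> bnd Q m d -> bnd (P + Q) m (c + d).
Proof.
move=> [h e] [h' e']; split; last by rewrite cfD e e'.
move=> n; rewrite mem_supp cfD => nz.
have [nP|nP] := boolP (n \in supp P); first exact: h.
have [nQ|nQ] := boolP (n \in supp Q); first exact: h'.
by move: nP nQ nz; rewrite !mem_supp !negbK => /eqP -> /eqP ->; rewrite addr0 eqxx.
Qed.

Lemma bndN P m c : bnd P m c -> bnd (- P) m (- c).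
Proof.
move=> [h e]; split; last by rewrite cfN e.
by move=> n; rewrite mem_supp cfN oppr_eq0 -mem_supp; apply: h.
Qed.

Lemma bndB P Q m c d : bnd P m c -> bnd Q m d -> bnd (P - Q) m (c - d).
Proof. by move=> h /bndN; apply: bndD. Qed.

Lemma bndZ P m c d : bnd P m c -> bnd (cP F d * P) m (d * c).
Proof.
move=> [h e]; split; last by rewrite cfZ e.
by move=> n; rewrite mem_supp cfZ mulf_eq0 negb_or -mem_supp => /andP[_ /h].
Qed.

Lemma bnd_sum (I : eqType) (r : seq I) (f : I -> A) m (c : I -> C) :
  (forall i, i \in r -> bnd (f i) m (c i)) ->
  bnd (\sum_(i <- r) f i) m (\sum_(i <- r) c i).
Proof.
elim: r => [|i r IH] h; first by rewrite !big_nil; apply: bnd0.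
rewrite !big_cons; apply: bndD; first by apply: h; rewrite inE eqxx.
by apply: IH => j jr; apply: h; rewrite inE jr orbT.
Qed.

Lemma bnd1 : bnd 1 (0, 0)%N 1.
Proof.
split=> [n|]; last by rewrite cf1 eqxx.
by rewrite mem_supp cf1 pnatr_eq0 eqb0 negbK => /eqP ->; apply: fle_refl.
Qed.

Lemma bndM P Q m n c d : bnd P m c -> bnd Q n d -> bnd (P * Q) (nadd m n) (c * d).
Proof.
move=> [h e] [h' e']; split=> [k|].
  rewrite mem_supp cfM => nz.
  have [a aP ha] : exists2 a, a \in supp P & cf P a *
     (if (a.1 <= k.1)%N && (a.2 <= k.2)%N then cf Q (k.1 - a.1, k.2 - a.2)%N else 0) != 0.
    apply: contrapT => N; case/eqP: nz; rewrite big1_seq // => a /andP[_ aP].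
    by apply/eqP/negPn/negP => nz; apply: N; exists a.
  move: ha; rewrite mulf_eq0 negb_or => /andP[_].
  case: ifP => [/andP[a1 a2]|]; last by rewrite eqxx.
  rewrite -mem_supp => /h' hb.
  have -> : nvec k = nvec a + nvec (k.1 - a.1, k.2 - a.2)%N.
    rewrite -nvec_add /nadd /=; congr nvec.
    by rewrite !subnKC //; case: (k).
  by rewrite nvec_add; apply: fle_add => //; apply: h.
rewrite cfM; have [mP|mP] := boolP (m \in supp P).
  rewrite (big_rem m) //= !leq_addr /= !addKn e -(surjective_pairing n) e'.
  rewrite big1_seq ?addr0 // => a /andP[_].
  rewrite mem_rem_uniq ?supp_uniq // inE => /andP[am aP].
  case: ifP => [/andP[a1 a2]|]; last by rewrite mulr0.
  have [bQ|] := boolP ((m.1 + n.1 - a.1, m.2 + n.2 - a.2)%N \in supp Q); last first.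
    by rewrite mem_supp negbK => /eqP ->; rewrite mulr0.
  case/eqP: am; apply: nvec_inj; apply: esym.
  apply: (fle_cancel ts (h _ aP) (h' _ bQ)); rewrite -!nvec_add /nadd /=.
  by rewrite !subnKC.
have c0 : c = 0 by move: mP; rewrite mem_supp negbK e => /eqP.
rewrite c0 mul0r big1_seq // => a /andP[_ aP].
case: ifP => [/andP[a1 a2]|]; last by rewrite mulr0.
have [bQ|] := boolP ((m.1 + n.1 - a.1, m.2 + n.2 - a.2)%N \in supp Q); last first.
  by rewrite mem_supp negbK => /eqP ->; rewrite mulr0.
have em : nvec m = nvec a.
  apply: (fle_cancel ts (h _ aP) (h' _ bQ)); rewrite -!nvec_add /nadd /=.
  by rewrite !subnKC.
by move/nvec_inj: em mP => ->; rewrite aP.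
Qed.

Lemma bndX P m c (k : nat) : bnd P m c -> bnd (P ^+ k) (nmul k m) (c ^+ k).
Proof.
move=> h; elim: k => [|k IH]; first by rewrite !expr0; apply: bnd1.
rewrite !exprS (_ : nmul k.+1 m = nadd m (nmul k m)); first exact: bndM.
by rewrite /nmul /nadd /= !mulSn.
Qed.

Lemma bnd_exists P : P != 0 -> exists m c, c != 0 /\ bnd P m c.
Proof.
move=> /supp_neq0; have key (r : seq (nat * nat)) : r != [::] ->
    exists2 m, m \in r & forall n, n \in r -> le (nvec m) (nvec n).
  elim: r => // a r IH _; have [->|/IH [m mr hm]] := eqVneq r [::].
    by exists a; rewrite ?inE // => n; rewrite inE => /eqP ->; apply: fle_refl.
  have /orP[am|ma] := fle_total t s (nvec a) (nvec m).
    exists a; rewrite ?inE ?eqxx // => n; rewrite inE => /orP[/eqP ->|/hm].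
      exact: fle_refl.
    exact: fle_trans.
  exists m; rewrite ?inE ?mr ?orbT // => n; rewrite inE => /orP[/eqP ->|/hm] //.
move/key => [m mP h]; exists m, (cf P m); rewrite -mem_supp.
by split=> //; split.
Qed.

Lemma bnd_low P m c : c != 0 -> bnd P m c ->
  low (fun n => rdot t (nvec n)) P m.
Proof.
move=> c0 [h e]; split; first by rewrite mem_supp e.
by move=> n /h /fle_rdot.
Qed.

Lemma bnd_uniq P m c d : bnd P m c -> bnd P m d -> c = d.
Proof. by move=> [_ <-] [_ <-]. Qed.

(** The Jacobian with respect to log x and log y. The operators x d/dx and y d/dy are diagonal on
    monomials, so the bracket of two monomials is the determinant of their exponents times their
    product. *)
Definition lbr P Q : A :=
  (XP F * dP ord0 P) * (YP F * dP ord_max Q) -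
  (YP F * dP ord_max P) * (XP F * dP ord0 Q).

Lemma lbrE P Q : xF * yF * jac (toFun P) (toFun Q) = toFun (lbr P Q).
Proof.
rewrite /jac !partial_toFun /lbr rmorphB /= !toFunM /xF /yF; ring.
Qed.

Lemma bnd_Xd P m c : bnd P m c -> bnd (XP F * dP ord0 P) m (m.1%:R * c).
Proof.
move=> [h e]; split; last by rewrite cf_Xd e.
by move=> n; rewrite mem_supp cf_Xd mulf_eq0 negb_or -mem_supp => /andP[_ /h].
Qed.

Lemma bnd_Yd P m c : bnd P m c -> bnd (YP F * dP ord_max P) m (m.2%:R * c).
Proof.
move=> [h e]; split; last by rewrite cf_Yd e.
by move=> n; rewrite mem_supp cf_Yd mulf_eq0 negb_or -mem_supp => /andP[_ /h].
Qed.

Lemma bnd_lbr P Q m n c d : bnd P m c -> bnd Q n d ->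
  bnd (lbr P Q) (nadd m n) ((det (nvec m) (nvec n))%:~R * (c * d)).
Proof.
move=> hP hQ; have -> : (det (nvec m) (nvec n))%:~R * (c * d) =
    (m.1%:R * c) * (n.2%:R * d) - (m.2%:R * c) * (n.1%:R * d).
  by rewrite /det /nvec /= rmorphB !rmorphM /= -!pmulrn; ring.
by apply: bndB; apply: bndM; [exact: bnd_Xd|exact: bnd_Yd|exact: bnd_Yd|exact: bnd_Xd].
Qed.

Lemma bnd_eqexp P m n c : m = n -> bnd P m c -> bnd P n c.
Proof. by move=> ->. Qed.

Section Map.
Variables (P1 Q1 P2 Q2 : A) (delta : C).
Hypotheses (Q10 : Q1 != 0) (Q20 : Q2 != 0).
Local Notation u := (toFun P1 / toFun Q1).
Local Notation v := (toFun P2 / toFun Q2).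

(* Compare the lowest terms in f^* eta = delta eta. *)
Lemma det_lead p1 q1 p2 q2 a1 b1 a2 b2 :
  xF * yF * jac u v = cK delta * (u * v) ->
  bnd P1 p1 a1 -> bnd Q1 q1 b1 -> bnd P2 p2 a2 -> bnd Q2 q2 b2 ->
  a1 != 0 -> b1 != 0 -> a2 != 0 -> b2 != 0 ->
  (det (nvec p1 - nvec q1) (nvec p2 - nvec q2))%:~R = delta.
Proof.
move=> e h1 k1 h2 k2 a10 b10 a20 b20.
(* The equation times [Q1 ^+ 2 * Q2 ^+ 2]. All five terms are bounded below by the exponent
   [p1 + p2 + q1 + q2], and the four determinants on the left combine to that of [p1 - q1] and
   [p2 - q2]. *)
have E : lbr P1 P2 * (Q1 * Q2) - lbr P1 Q2 * (Q1 * P2) - lbr Q1 P2 * (P1 * Q2)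
    + lbr Q1 Q2 * (P1 * P2) = cP F delta * (P1 * P2 * (Q1 * Q2)).
  apply: toFun_inj; rewrite !(rmorphD, rmorphN) /= !toFunM -!lbrE.
  have q1n : toFun Q1 != 0 by rewrite toFun_eq0.
  have q2n : toFun Q2 != 0 by rewrite toFun_eq0.
  have := congr1 (fun g => g * (toFun Q1 ^+ 2 * toFun Q2 ^+ 2)) e.
  rewrite /= !jacMl !jacMr !jacVl // !jacVr //.
  rewrite -/(cK delta).
  have -> : cK delta * (u * v) * (toFun Q1 ^+ 2 * toFun Q2 ^+ 2) =
     cK delta * (toFun P1 * toFun P2 * (toFun Q1 * toFun Q2)).
    by field; rewrite q1n q2n.
  by move=> <-; field; rewrite q1n q2n.
have B1 := bndM (bnd_lbr h1 h2) (bndM k1 k2).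
have B2 := bndM (bnd_lbr h1 k2) (bndM k1 h2).
have B3 := bndM (bnd_lbr k1 h2) (bndM h1 k2).
have B4 := bndM (bnd_lbr k1 k2) (bndM h1 h2).
have B5 := bndZ delta (bndM (bndM h1 h2) (bndM k1 k2)).
set m := nadd _ _ in B5; have ex m1 m2 m3 m4 :
    nadd (nadd m1 m2) (nadd m3 m4) =
    (m1.1 + m2.1 + (m3.1 + m4.1), m1.2 + m2.2 + (m3.2 + m4.2))%N by [].
have {}B2 := bnd_eqexp (n := m) _ B2; have {}B3 := bnd_eqexp (n := m) _ B3.
have {}B4 := bnd_eqexp (n := m) _ B4.
have B := bndD (bndB (bndB B1 (B2 _)) (B3 _)) (B4 _).
have := bnd_uniq (B _ _ _); rewrite E => /(_ _ _ _ _ B5) W.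
have n0 : a1 * a2 * (b1 * b2) != 0 by rewrite !mulf_neq0.
apply: (mulIf n0); rewrite -W.
- by rewrite /det /nvec /= !(rmorphB, rmorphM) /= -!pmulrn; ring.
all: by rewrite /m !ex; clear; congr pair; lia.
Qed.

End Map.
End Flag.
End Leading.

(** * Weights of pulled back functions *)

Section Pull.
Variables (R : realFieldType) (C : numClosedFieldType) (F : ratField C).
Local Notation K := (ratFun F).
Local Notation A := (Pol F).
Local Notation cK := (@cK C F).
Local Notation xF := (xF F).
Local Notation yF := (yF F).
Local Notation V := (@V C F).
Implicit Types (g h : K) (P Q : A) (c d : C) (l : int * int) (t s : R * R).

Section Lead.
Variables (t s : R * R).
Hypothesis ts : t.1 * s.2 - t.2 * s.1 != 0.
Variables (P1 Q1 P2 Q2 : A) (p1 q1 p2 q2 : nat * nat) (a1 b1 a2 b2 : C).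
Hypotheses (Q10 : Q1 != 0) (Q20 : Q2 != 0).
Local Notation u := (toFun P1 / toFun Q1).
Local Notation v := (toFun P2 / toFun Q2).
Hypotheses (h1 : bnd t s P1 p1 a1) (k1 : bnd t s Q1 q1 b1).
Hypotheses (h2 : bnd t s P2 p2 a2) (k2 : bnd t s Q2 q2 b2).
Hypotheses (a10 : a1 != 0) (b10 : b1 != 0) (a20 : a2 != 0) (b20 : b2 != 0).
Let e1 := nvec p1 - nvec q1.
Let e2 := nvec p2 - nvec q2.
Hypothesis d0 : det e1 e2 != 0.

(** The lowest exponent of [u ^+ m.1 * v ^+ m.2] after multiplication by [(Q1 * Q2) ^+ n]. It is
    affine in [m] with linear part given by [e1] and [e2], hence injective. *)
Let expo (n : nat) (m : nat * nat) : nat * nat :=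
  nadd (nadd (nmul m.1 p1) (nmul (n - m.1) q1))
       (nadd (nmul m.2 p2) (nmul (n - m.2) q2)).
Let base (n : nat) : int * int := nvec (nadd (nmul n q1) (nmul n q2)).

Let nvec_expo n m : (m.1 <= n)%N -> (m.2 <= n)%N -> nvec (expo n m) =
  (m.1%:Z * e1.1 + m.2%:Z * e2.1, m.1%:Z * e1.2 + m.2%:Z * e2.2) + base n.
Proof.
move=> n1 n2; rewrite /nvec /expo /base /nvec /nadd /nmul /e1 /e2 /nvec /=.
have z1 : ((n - m.1)%N)%:Z = n%:Z - m.1%:Z by lia.
have z2 : ((n - m.2)%N)%:Z = n%:Z - m.2%:Z by lia.
by congr pair; rewrite /= !PoszD !PoszM z1 z2; ring.
Qed.

Let rdot_expo n m : (m.1 <= n)%N -> (m.2 <= n)%N -> rdot t (nvec (expo n m)) =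
  rdot (rdot t e1, rdot t e2) (nvec m) + rdot t (base n).
Proof.
move=> n1 n2; rewrite nvec_expo // rdotD; congr (_ + _).
by rewrite /rdot /= !(rmorphD, rmorphM) /=; ring.
Qed.

Let expo_inj n m m' : (m.1 <= n)%N -> (m.2 <= n)%N -> (m'.1 <= n)%N ->
  (m'.2 <= n)%N -> expo n m = expo n m' -> m = m'.
Proof.
move=> x1 x2 x3 x4 /(congr1 nvec); rewrite !nvec_expo // => /addIr.
case: m m' x1 x2 x3 x4 => a b [c d] _ _ _ _ /= [y1 y2].
have z1 : (a%:Z - c%:Z) * det e1 e2 = 0.
  transitivity ((a%:Z * e1.1 + b%:Z * e2.1 - (c%:Z * e1.1 + d%:Z * e2.1)) * e2.2
     - (a%:Z * e1.2 + b%:Z * e2.2 - (c%:Z * e1.2 + d%:Z * e2.2)) * e2.1).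
    by rewrite /det; ring.
  by rewrite y1 y2 !subrr; ring.
have z2 : (b%:Z - d%:Z) * det e1 e2 = 0.
  transitivity ((a%:Z * e1.2 + b%:Z * e2.2 - (c%:Z * e1.2 + d%:Z * e2.2)) * e1.1
    - (a%:Z * e1.1 + b%:Z * e2.1 - (c%:Z * e1.1 + d%:Z * e2.1)) * e1.2).
    by rewrite /det; ring.
  by rewrite y1 y2 !subrr; ring.
move/eqP: z1; move/eqP: z2; rewrite !mulf_eq0 !(negPf d0) !orbF !subr_eq0.
by move=> /eqP[->] /eqP[->].
Qed.

(** The terms of [P(u, v)] have distinct lowest exponents, since [e1] and [e2] are independent, so
    the smallest one survives. Up to the common shift [base n], its weight is the lowest weight of
    [P] for the image of [t]. *)
Lemma pull_lead P n : P != 0 ->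
  (forall m, m \in supp P -> (m.1 <= n)%N /\ (m.2 <= n)%N) ->
  exists N m e c, [/\ low (fun i => rdot (rdot t e1, rdot t e2) (nvec i)) P m,
    c != 0, bnd t s N e c, toFun N = sb u v P * toFun ((Q1 * Q2) ^+ n) &
    rdot t (nvec e) = rdot (rdot t e1, rdot t e2) (nvec m) + rdot t (base n)].
Proof.
move=> P0 hn.
pose term (m : nat * nat) : A :=
  (P1 ^+ m.1 * Q1 ^+ (n - m.1)) * (P2 ^+ m.2 * Q2 ^+ (n - m.2)).
pose N := \sum_(m <- supp P) cP F (cf P m) * term m.
pose k (m : nat * nat) := (a1 ^+ m.1 * b1 ^+ (n - m.1)) * (a2 ^+ m.2 * b2 ^+ (n - m.2)).
have bt m : bnd t s (term m) (expo n m) (k m).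
  by apply: bndM => //; apply: bndM => //; apply: bndX.
have [m mP hm] : exists2 m, m \in supp P &
    forall i, i \in supp P -> fle t s (nvec (expo n m)) (nvec (expo n i)).
  have := supp_neq0 P0; elim: (supp P) => // a r IH _.
  have [->|/IH [m mr hm]] := eqVneq r [::].
    by exists a; rewrite ?inE // => i; rewrite inE => /eqP ->; apply: fle_refl.
  have /orP[am|ma] := fle_total t s (nvec (expo n a)) (nvec (expo n m)).
    exists a; rewrite ?inE ?eqxx // => i; rewrite inE => /orP[/eqP ->|/hm].
      exact: fle_refl.
    exact: fle_trans.
  by exists m; rewrite ?inE ?mr ?orbT // => i; rewrite inE => /orP[/eqP ->|/hm].
have [m1 m2] := hn _ mP.
exists N, m, (expo n m), (cf P m * k m); split.
- split=> // i iP; have [i1 i2] := hn _ iP.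
  by have /fle_rdot := hm _ iP; rewrite !rdot_expo // lerD2r.
- by rewrite !mulf_neq0 ?expf_neq0 // -mem_supp.
(* At the exponent [expo n m] only the term of [m] has a nonzero coefficient. *)
- have -> : cf P m * k m = \sum_(i <- supp P) (if i == m then cf P m * k m else 0).
    rewrite (big_rem m) //= eqxx big1_seq ?addr0 // => i /andP[_].
    by rewrite mem_rem_uniq ?supp_uniq // inE => /andP[/negPf ->].
  apply: bnd_sum => i iP; case: eqP => [->|/eqP im].
    by apply: bndZ; apply: bt.
  have [B e] := bndZ (cf P i) (bt i).
  have le_i := hm _ iP; have [i1 i2] := hn _ iP.
  split; first by move=> j /B; apply: fle_trans.
  apply/eqP; rewrite -[_ == _]negbK -mem_supp; apply/negP => /B le_m.
  case/eqP: im; apply: (expo_inj i1 i2 m1 m2); apply: nvec_inj.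
  exact: (fle_anti ts).
- rewrite sb_sum mulr_suml rmorph_sum; apply: eq_big_seq => i iP /=.
  have [i1 i2] := hn _ iP.
  rewrite /term !rmorphM /= !rmorphXn /= rmorphM /=.
  rewrite !expr_div_n exprMn.
  have x1 : toFun Q1 != 0 by rewrite toFun_eq0.
  have x2 : toFun Q2 != 0 by rewrite toFun_eq0.
  rewrite -[in toFun Q1 ^+ n](subnK i1) -[in toFun Q2 ^+ n](subnK i2) !exprD.
  rewrite /cK.
  by field; rewrite !expf_neq0.
- by rewrite rdot_expo.
Qed.

End Lead.

Lemma supp_bound P : exists n, forall m, m \in supp P -> (m.1 <= n)%N /\ (m.2 <= n)%N.
Proof.
exists (\sum_(m <- supp P) (m.1 + m.2))%N => m mP.
by rewrite (big_rem m) //=; split; lia.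
Qed.

(* The junk value nu t 0 is 0. *)
Definition nu t P : R :=
  xget 0 [set r | exists2 m, low (fun n => rdot t (nvec n)) P m & r = rdot t (nvec m)].

Lemma nuE t P m : low (fun n => rdot t (nvec n)) P m -> nu t P = rdot t (nvec m).
Proof.
move=> L; apply: xget_unique; first by exists m.
move=> r [m' [m'P h'] ->]; case: L => mP h.
by apply/eqP; rewrite eq_le h ?h'.
Qed.

Lemma low_exists_nu t P : P != 0 -> exists2 m,
  low (fun n => rdot t (nvec n)) P m & nu t P = rdot t (nvec m).
Proof.
move=> P0; have [m L] := low_exists (fun n => rdot t (nvec n)) P0.
by exists m => //; apply: nuE.
Qed.

(** A weight independent of a nonzero [t], to complete it to a flag. *)
Definition perp t : R * R := (- t.2, t.1).
Lemma perp_indep t : t != (0, 0) -> t.1 * (perp t).2 - t.2 * (perp t).1 != 0.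
Proof.
case: t => a b /=; apply: contra => /eqP e.
have : a ^+ 2 + b ^+ 2 == 0 by apply/eqP; rewrite -[RHS]e; ring.
by rewrite paddr_eq0 ?sqr_ge0 // !expf_eq0 /= => /andP[/eqP -> /eqP ->].
Qed.

Section Map.
Variables (P1 Q1 P2 Q2 : A) (delta : C).
Hypotheses (P10 : P1 != 0) (Q10 : Q1 != 0) (P20 : P2 != 0) (Q20 : Q2 != 0).
Local Notation u := (toFun P1 / toFun Q1).
Local Notation v := (toFun P2 / toFun Q2).
Hypothesis delta0 : delta != 0.
Hypothesis pres : xF * yF * jac u v = cK delta * (u * v).

Definition Tmap t : R * R := (nu t P1 - nu t Q1, nu t P2 - nu t Q2).

Lemma jac_uv : jac u v != 0.
Proof.
have : cK delta * (u * v) != 0.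
  apply: mulf_neq0; first by rewrite cK_eq0.
  by rewrite !mulf_eq0 !invr_eq0 !toFun_eq0 !negb_or P10 Q10 P20 Q20.
by rewrite -pres; apply: contraNneq => ->; rewrite mulr0.
Qed.

Lemma flag_leads t s : t.1 * s.2 - t.2 * s.1 != 0 ->
  exists p1 q1 p2 q2 a1 b1 a2 b2,
  [/\ [/\ bnd t s P1 p1 a1, bnd t s Q1 q1 b1, bnd t s P2 p2 a2 & bnd t s Q2 q2 b2],
      [/\ a1 != 0, b1 != 0, a2 != 0 & b2 != 0],
      (det (nvec p1 - nvec q1) (nvec p2 - nvec q2))%:~R = delta &
      Tmap t = (rdot t (nvec p1 - nvec q1), rdot t (nvec p2 - nvec q2))].
Proof.
move=> ts.
have [p1 [a1 [a10 h1]]] := bnd_exists t s P10.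
have [q1 [b1 [b10 k1]]] := bnd_exists t s Q10.
have [p2 [a2 [a20 h2]]] := bnd_exists t s P20.
have [q2 [b2 [b20 k2]]] := bnd_exists t s Q20.
exists p1, q1, p2, q2, a1, b1, a2, b2; split=> //.
  exact: (det_lead ts Q10 Q20 pres h1 k1 h2 k2).
rewrite /Tmap (nuE (bnd_low a10 h1)) (nuE (bnd_low b10 k1)).
by rewrite (nuE (bnd_low a20 h2)) (nuE (bnd_low b20 k2)) !rdotB.
Qed.

Lemma low_scale (k : int) l P m : 0 < k ->
  low (fun i => rdot (intv R (k * l.1, k * l.2)) (nvec i)) P m ->
  low (fun i => dot l (nvec i)) P m.
Proof.
move=> k0 [mP h]; split=> // i /h; rewrite !rdot_int ler_int.
have e n : dot (k * l.1, k * l.2) n = k * dot l n by rewrite /dot /=; ring.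
by rewrite !e ler_pM2l.
Qed.

Lemma primitive_multiple (l : int * int) : l != 0 ->
  exists (k : int) l', [/\ 0 < k, primitive l' & l = (k * l'.1, k * l'.2)].
Proof.
case: l => a b ab0; set k := gcdz a b.
have k0 : 0 < k.
  rewrite lt_def; apply/andP; split; last by [].
  by rewrite gcdz_eq0; apply: contraNN ab0 => /andP[/eqP -> /eqP ->].
have ea : a = k * (a %/ k)%Z by rewrite mulrC divzK ?dvdz_gcdl.
have eb : b = k * (b %/ k)%Z by rewrite mulrC divzK ?dvdz_gcdr.
exists k, ((a %/ k)%Z, (b %/ k)%Z); split=> //=; last by rewrite -ea -eb.
have := mulz_gcdr k (a %/ k)%Z (b %/ k)%Z; rewrite -ea -eb -/k => h.
have kn : k != 0 by rewrite gt_eqF.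
by rewrite /primitive /coprimez; apply/eqP/(mulfI kn); rewrite mulr1 -[RHS]h gez0_abs ?ltW.
Qed.

Lemma Tmap_int l : primitive l -> exists (k : int) l',
  [/\ 0 < k, primitive l', Tmap (intv R l) = intv R (k * l'.1, k * l'.2) &
      forall g, V l (pullb u v g) <-> V l' g].
Proof.
move=> pl; have t0 : intv R l != (0, 0).
  apply/eqP => -[/eqP]; rewrite intr_eq0 => /eqP x /eqP; rewrite intr_eq0 => /eqP y.
  by have := dot_sdual pl; rewrite /dot x y !mul0r.
have ts := perp_indep t0; set t := intv R l in t0 ts *; set s := perp t in ts *.
have [p1 [q1 [p2 [q2 [a1 [b1 [a2 [b2]]]]]]]] := flag_leads ts.
move=> [[h1 k1 h2 k2] [a10 b10 a20 b20] dl Tt].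
set e1 := nvec p1 - nvec q1 in dl Tt; set e2 := nvec p2 - nvec q2 in dl Tt.
have d0 : det e1 e2 != 0.
  by apply: contraNneq delta0 => d0; rewrite -dl d0.
(* The image of [l] under T, nonzero because [e1] and [e2] are independent. Division by the gcd of
   its entries gives [l']. *)
pose m := (dot l e1, dot l e2).
have m0 : m != 0.
  apply: contra_neq d0 => -[x y].
  have [z1 z2] : l.1 * det e1 e2 = 0 /\ l.2 * det e1 e2 = 0.
    split.
      transitivity (dot l e1 * e2.2 - dot l e2 * e1.2); first by rewrite /dot /det; ring.
      by rewrite x y; ring.
    transitivity (dot l e2 * e1.1 - dot l e1 * e2.1); first by rewrite /dot /det; ring.
    by rewrite x y; ring.
  rewrite -[LHS]mul1r -(dot_sdual pl) /dot.
  transitivity (l.1 * det e1 e2 * (sdual l).1 + l.2 * det e1 e2 * (sdual l).2).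
    by ring.
  by rewrite z1 z2; ring.
have [k [l' [k0 pl' em]]] := primitive_multiple m0.
have Tm : Tmap t = intv R (k * l'.1, k * l'.2) by rewrite Tt !rdot_int -em.
exists k, l'; split=> // g; have J := jac_uv.
elim/fracF_ind: g => P Q Q0.
have [->|P0] := eqVneq P 0.
  by rewrite toFun0 mul0r (pullb0 J); split=> _; apply: V0.
(* Numerator and denominator are both cleared with the power [n1 + n2], so that the factor and the
   shift of the weights cancel in the quotient. *)
have [n1 hn1] := supp_bound P; have [n2 hn2] := supp_bound Q.
have [|N [i [e [c [Li c0 B eN re]]]]] := pull_lead ts Q10 Q20 h1 k1 h2 k2 a10 b10 a20 b20
    d0 (n := (n1 + n2)%N) P0.
  by move=> j /hn1 [x1 x2]; split; apply: leq_trans (leq_addr _ _).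
have [|N' [i' [e' [c' [Li' c0' B' eN' re']]]]] := pull_lead ts Q10 Q20 h1 k1 h2 k2
    a10 b10 a20 b20 d0 (n := (n1 + n2)%N) Q0.
  by move=> j /hn2 [x1 x2]; split; apply: leq_trans (leq_addl _ _).
rewrite -Tt Tm in Li Li' re re'.
have lN := bnd_low c0 B; have lN' := bnd_low c0' B'.
have sc : (1 * l.1, 1 * l.2) = l by rewrite !mul1r; case: (l).
have lN1 : low (fun i => dot l (nvec i)) N e.
  by apply: (@low_scale 1) => //; rewrite sc.
have lN1' : low (fun i => dot l (nvec i)) N' e'.
  by apply: (@low_scale 1) => //; rewrite sc.
have Q12 : toFun ((Q1 * Q2) ^+ (n1 + n2)) != 0.
  by rewrite toFun_eq0 expf_neq0 // mulf_neq0.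
have -> : pullb u v (toFun P / toFun Q) = toFun N / toFun N'.
  rewrite pullb_frac // eN eN'; have sQ : sb u v Q != 0 by rewrite sb_eq0.
  by field; rewrite sQ Q12.
rewrite (V_frac pl lN1 lN1') (V_frac pl' (low_scale k0 Li) (low_scale k0 Li')).
move: re re'; rewrite !rdot_int -(ler_int R) => -> ->.
have ek j : dot (k * l'.1, k * l'.2) j = k * dot l' j by rewrite /dot /=; ring.
by rewrite lerD2r ler_int !ek ler_pM2l.
Qed.

End Map.
End Pull.

(** * Images of polar primes *)

Section Images.
Variables (C : numClosedFieldType) (F : ratField C).
Local Notation K := (ratFun F).
Local Notation A := (Pol F).
Local Notation cK := (@cK C F).
Local Notation V := (@V C F).
Local Notation mon := (@mon C F).
Local Notation pt := (@pt C F).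
Local Notation eta := (eta F).
Implicit Types (g h : K) (P Q : set (placed_curve F)) (c d : C) (l : int * int).
Implicit Types (X Y : surface F) (D E : set (point F)) (p q : point F).

Lemma V_max_pt l g : primitive l -> V l g -> g != 0 -> ~ V l g^-1 ->
  exists B : seq C, forall c, c != 0 -> c \notin B -> max_ideal (pt l c) g.
Proof.
move=> pl Vg g0 nV; have [i [e [Ve Vie e0 eg]]] := V_unif pl g0.
have i0 : 0 < i.
  rewrite ltNge; apply/negP => i0; apply: nV.
  rewrite eg invfM invr_expz; apply: VM => //; apply/V_sz => //.
  by rewrite oppr_ge0.
have [B hB] := Ve; exists B => c c0 cB; have L := pt_loc F pl c.
rewrite eg; apply: (locmMr L); last exact: hB.
have -> : i = (`|i|.-1.+1)%:Z by lia.
rewrite -exprnP exprS; apply: (locmMr L); first exact: pt_s.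
by apply: (locX L); case: (pt_s F pl c).
Qed.

Section Map.
Variables (u v : K) (l l' : int * int).
Hypotheses (J : jac u v != 0) (pl : primitive l) (pl' : primitive l').
Local Notation phi := (pullb u v).
Hypothesis hV : forall g, V l (phi g) <-> V l' g.

Section Image.
Variables (X : surface F) (D : set (point F)) (Y : surface F).
Hypotheses (PD : is_placed_curve (X, D)) (rD : ring_of D = V l).

Lemma proper_image_sub q : proper_image phi Y D q -> q `<=` V l'.
Proof.
move=> [_ [p Dp [s _]]] g /s pg; apply/hV; rewrite -rD; by exists p.
Qed.

Lemma proper_image_Y : proper_image phi Y D `<=` Y.
Proof. by move=> q []. Qed.

(** Being contained in [V l'] is a closed condition, so it passes from the image to its closure for
    every [Y]. *)
Lemma image_closure_sub q : image_closure phi Y D q -> Y q /\ q `<=` V l'.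
Proof.
move=> /(zclosureP _ proper_image_Y) [Yq h]; split=> // g qg.
have [|q' /proper_image_sub s /all_in1] := h [:: g]; first exact/all_in1.
exact: s.
Qed.

(** A basic open set that meets the divisor contains almost all points [pt l' c]. Almost every point
    [pt l c] of [D] maps to [pt l' c'], where [c'] is the value of the pullback of [t'], and [c']
    can be kept out of a finite set. *)
Lemma image_closureE : (forall c, c != 0 -> Y (pt l' c)) ->
  image_closure phi Y D = divisor Y l'.
Proof.
move=> hY; apply/seteqP; split; first by move=> q /image_closure_sub.
move=> q [Yq qV]; apply/(zclosureP _ proper_image_Y); split=> // s qs.
have [B1 hB1] : exists B : seq C, forall c, c != 0 -> c \notin B -> all_in (pt l' c) s.
  by apply: V_common => g /qs /qV.
set s' := mon (sdual l'); set t' := mon (tdual l').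
have tc0 b : t' - cK b != 0.
  by apply: mon_nonconst; apply: tdual_neq0.
(* Since [t' - b] is a unit of [V l'], its pullback is a unit at almost all points [pt l c]; there
   [c'] differs from [b]. *)
have Vtb b : V l' (t' - cK b)^-1.
  have [] // := V_unit pl' (g := t' - cK b) (f := 'X - b%:P).
    by rewrite polyXsubC_eq0.
  move=> c c0; rewrite hornerXsubC; apply: has_valueB; first exact: pt_loc.
    exact: pt_t.
  by apply: has_valueC; apply: pt_loc.
have s'0 : s' != 0 by apply: mon_neq0.
have [Bs hBs] : exists B : seq C, forall c, c != 0 -> c \notin B ->
    max_ideal (pt l c) (phi s').
  apply: V_max_pt => //; first by apply/hV; apply: Vs.
    by rewrite pullb_eq0.
  by rewrite -pullbV // => /hV; apply: Vs_inv.
have [Bt hBt] : V l (phi t') by apply/hV; apply: (Vtz F pl' 1).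
have [Bb hBb] : exists B : seq C, forall c, c != 0 -> c \notin B ->
    all_in (pt l c) [seq phi (t' - cK b)^-1 | b <- 0 :: B1].
  apply: V_common => g /mapP [b _ ->]; apply/hV; exact: Vtb.
have [c [c0]] := ring_generic PD pl rD (Bs ++ Bt ++ Bb).
rewrite !mem_cat !negb_or => /and3P[cs ct cb] Dc.
have L := pt_loc F pl c.
have [c' hc'] := loc_val L (hBt _ c0 ct).
have ne b : b \in 0 :: B1 -> c' != b.
  move=> bB; apply/eqP => e; have := hBb _ c0 cb (phi (t' - cK b)^-1).
  rewrite (map_f (fun b => phi (t' - cK b)^-1)) // => /(_ isT).
  rewrite pullbV // => h; apply: (locm_inv _ _ h); first by rewrite pullb_eq0.
  by rewrite pullbB // pullbC // -e.
have c'0 : c' != 0 by apply: ne; rewrite inE eqxx.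
have c'B : c' \notin B1.
  by apply/negP => h; have := ne c'; rewrite inE h orbT eqxx => /(_ isT).
exists (pt l' c'); last exact: hB1.
split; first exact: hY.
exists (pt l c) => //.
have mu : max_ideal (pt l c) (phi s') by apply: hBs.
have mv : max_ideal (pt l c) (phi (t' - cK c')) by rewrite pullbB // pullbC.
have J' := jac_pt F pl' c'.
(* The coordinates at [pt l' c'] pull back to functions vanishing at [pt l c], so pullback preserves
   values; both conditions of [maps_to] follow. *)
have val g : pt l' c' g -> exists2 d, has_value (pt l c) (phi g) d &
    has_value (pt l' c') g d.
  move=> [P [Q [Q0 ->]]]; exists (ev0 P / ev0 Q); last exact: lr_value.
  rewrite pullbM // pullbV // !pullb_sb //; apply: (has_valueM L).
    exact: sb_value.
  by apply: has_valueV => //; apply: sb_value.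
split=> g; first by move=> /val [d /(has_value_loc L)].
move=> mg; have [d hd hd'] := val _ (max_ideal_sub mg).
have : d = 0.
  apply: (has_value_uniq (pt_loc F pl' c') hd').
  by apply/(has_value0 (pt l' c') g).
by move: hd => /[swap] -> /(has_value0 (pt l c)).
Qed.

(** A single point is closed, whereas the closure of the image is an infinite divisor. *)
Lemma not_contracted : modification Y -> (forall c, c != 0 -> Y (pt l' c)) ->
  ~ contracts phi Y D.
Proof.
move=> TY hY [q e]; have gY : generic_in l' Y.
  move=> B; have [c] := avoid_seq (0 :: B); rewrite inE negb_or => /andP[c0 cB].
  by exists c; split=> //; apply: hY.
have [p dp] := divisor_infinite pl' gY [:: q]; rewrite inE => /eqP; apply.
move: dp; rewrite -image_closureE // /image_closure e => -[_ h].
have Yq : Y q by apply: proper_image_Y; rewrite e.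
apply: (h [set q]) => //; apply: zclosed1 => //; first exact: tower_separated TY.
by move=> r; apply: tower_good TY.
Qed.

End Image.
End Map.

Lemma polar_prime_of l : primitive l -> is_polar_prime (prime_of (F := F) (V l)).
Proof.
move=> pl; split.
  apply/eta_prime_of; exists (V l); split=> //.
  have [X [cones [rays [T tX lr]]]] := toric_exists F pl.
  exists (X, divisor X l); split; first exact: divisor_placed tX _ lr.
  apply: divisor_ring => //; exact: toric_generic tX _ lr.
by move=> [X D] [PD e]; apply: ring_polar PD pl e.
Qed.

Lemma polar_prime_ex P : is_polar_prime P ->
  exists2 l, primitive l & P = prime_of (V l).
Proof.
move=> [/eta_prime_of [W [eP [[X D] PXD]]] po].
have := PXD; rewrite {1}eP => -[PD e].
have [l [pl e' _]] := polar_ring PD (po _ PXD).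
by exists l => //; rewrite eP -e e'.
Qed.

Section Sharp.
Variables (u v : K) (l l' : int * int).
Hypotheses (J : jac u v != 0) (pl : primitive l) (pl' : primitive l').
Local Notation phi := (pullb u v).
Hypothesis hV : forall g, V l (phi g) <-> V l' g.

(** Uniqueness: the ring of the image is some [V m] contained in [V l'], and [V_inj] gives [m = l'].
    Existence: take for [Y] a toric surface with a divisor of weight [l']. *)
Lemma sharp_imageP Q :
  sharp_image phi (prime_of (V l)) Q <-> Q = prime_of (V l').
Proof.
split=> [[/eta_prime_of [W [eQ _]] [X [Y [D [[PD rD] [TY nvY] _ QE]]]]]|->].
  have := QE; rewrite eQ => -[PE rE]; rewrite /= in rE.
  have sub := image_closure_sub (Y := Y) hV rD.
  have po : pole eta (image_closure phi Y D).
    move=> p /sub [Yp h]; apply: (V_pole pl') => //; exact: tower_good TY Yp.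
  have [m [pm e _]] := polar_ring PE po.
  suff -> : l' = m by rewrite -rE e.
  apply: esym; apply: (V_inj (F := F)) => // g.
  by rewrite -e => -[p /sub [_ h] /h].
have [po _] := polar_prime_of pl'; split=> //.
have [/eta_prime_of [W [_ [[X D] [PD rD]]]] _] := polar_prime_of pl.
have [Y [cones [rays [T tY lr]]]] := toric_exists F pl'.
have hY c : c != 0 -> Y (pt l' c) by apply: toric_pt tY _ _ lr.
exists X, Y, D; split=> //.
- exact: toric_elaboration.
- exact: (not_contracted J pl pl' hV PD rD (toric_mod T) hY).
- rewrite (image_closureE J pl pl' hV PD rD hY); split.
    exact: divisor_placed tY _ lr.
  by apply: divisor_ring => //; apply: toric_generic tY _ lr.
Qed.
End Sharp.

End Images.

(** * Coverings of the punctured plane *)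

Lemma near_all_seq (I : eqType) (T : topologicalType) (x : T) (s : seq I)
    (P : I -> T -> Prop) :
  (forall i, i \in s -> \forall y \near x, P i y) ->
  \forall y \near x, forall i, i \in s -> P i y.
Proof.
elim: s => [|i s IH] h; first by near=> y.
have h1 : \forall y \near x, P i y by apply: h; rewrite inE eqxx.
have h2 : \forall y \near x, forall j, j \in s -> P j y.
  by apply: IH => j js; apply: h; rewrite inE js orbT.
near=> y => j; rewrite inE => /orP[/eqP ->|].
  by near: y.
by move: j; near: y.
Unshelve. all: by end_near. Qed.

Definition edet (R : realType) (a b : R * R) : R := a.1 * b.2 - a.2 * b.1.

Section Covering.
Variable R : realType.
Local Notation E := (R * R)%type.
Variables (T : E -> E) (k : nat) (G : 'I_k -> E -> E).
Hypothesis contT : continuous T.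
Hypothesis contG : forall j, continuous (G j).
Hypothesis T0 : T 0 = 0.
Hypothesis TN0 : forall x, x != 0 -> T x != 0.
Hypothesis branch : forall x, x != 0 -> exists j, x = G j (T x).
Hypothesis local : forall x, x != 0 -> exists S : E -> E,
  [/\ continuous S, S (T x) = x, \forall z \near x, S (T z) = z &
      \forall y \near T x, T (S y) = y].

(** The branches [G j] list all preimages; several of them may give the same one, whence [undup]. *)
Definition preimages (y : E) : seq E :=
  undup [seq G j y | j <- enum 'I_k & T (G j y) == y].

Lemma mem_preimages y x : y != 0 -> (x \in preimages y) = (T x == y).
Proof.
move=> y0; rewrite mem_undup; apply/mapP/eqP => [[j]|e].
  by rewrite mem_filter => /andP[/eqP e _] ->.
have x0 : x != 0 by apply: contraNneq y0 => x0; rewrite -e x0 T0.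
have [j ej] := branch x0; exists j; last by rewrite -e -ej.
by rewrite mem_filter mem_enum andbT -e -ej.
Qed.

Lemma near_neq0 (y : E) : y != 0 -> \forall z \near y, z != 0.
Proof.
move=> y0; apply: (@cvgr_neq0 R E _ (nbhs y) _ id y) => //; exact: cvg_id.
Qed.

(** Local inverses at the preimages of [y] give the sheets. Finiteness of the set of branches
    replaces properness: over points near [y], each branch either stays in the neighbourhood [N i]
    of a preimage or is not a preimage. *)
Lemma evenly_covered (y : E) : y != 0 -> exists V : set E,
  [/\ open V, V y, V `<=` [set z | z != 0] &
      exists S : 'I_(size (preimages y)) -> E -> E, exists N : 'I_(size (preimages y)) -> set E,
      [/\ forall i, open (N i), forall i, continuous (S i),
          forall i x, N i x -> S i (T x) = x,
          forall i z, V z -> N i (S i z) /\ T (S i z) = z &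
          (forall i j z, V z -> S i z = S j z -> i = j) /\
          forall x, V (T x) -> exists i, N i x ]].
Proof.
move=> y0; set xs := preimages y; set n := size xs.
have xi (i : 'I_n) : T (nth 0 xs i) = y.
  by apply/eqP; rewrite -mem_preimages // mem_nth.
have xi0 (i : 'I_n) : nth 0 xs i != 0.
  by apply: contraNneq y0 => e; rewrite -(xi i) e T0.
have /choice [S hS] := fun i => local (xi0 i).
pose N (i : 'I_n) := [set x | S i (T x) = x]°.
have nN (i : 'I_n) : nbhs (nth 0 xs i) (N i).
  by apply: nbhs_interior; have [_ _ h _] := hS i.
have Sy (i : 'I_n) : S i y = nth 0 xs i by have [_ h _ _] := hS i; rewrite -(xi i) h.
have cS (i : 'I_n) : continuous (S i) by have [] := hS i.
pose W := [set z : E | [/\ z != 0,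
   forall i, i \in enum 'I_n -> N i (S i z) /\ T (S i z) = z,
   forall p, p \in [seq (i, j) | i <- enum 'I_n, j <- enum 'I_n] ->
      p.1 != p.2 -> S p.1 z != S p.2 z &
   forall j, j \in enum 'I_k -> T (G j z) = z -> exists i, N i (G j z) ]].
have nW : nbhs y W.
  have w1 := near_neq0 y0.
  have w2 : \forall z \near y, forall i, i \in enum 'I_n -> N i (S i z) /\ T (S i z) = z.
    apply: near_all_seq => i _; near=> z; split; near: z.
      apply: (cS i y); rewrite /= Sy; exact: nN.
    by rewrite -(xi i); have [] := hS i.
  have w3 : \forall z \near y, forall p,
      p \in [seq (i, j) | i <- enum 'I_n, j <- enum 'I_n] ->
      p.1 != p.2 -> S p.1 z != S p.2 z.
    apply: near_all_seq => -[i j] _ /=; have [->|ij] := eqVneq i j.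
      by near=> z.
    have d0 : S i y - S j y != 0.
      rewrite subr_eq0 !Sy nth_uniq ?undup_uniq //.
    have c : {for y, continuous (fun z => S i z - S j z)}.
      by apply: continuousB; [apply: cS|apply: cS].
    have nz : \forall z \near y, S i z - S j z != 0 := c _ (near_neq0 d0).
    by apply: filterS nz => z h _; rewrite -subr_eq0.
  have w4 : \forall z \near y, forall j, j \in enum 'I_k ->
      T (G j z) = z -> exists i, N i (G j z).
    apply: near_all_seq => j _; have [e|ne] := eqVneq (T (G j y)) y.
      have : G j y \in xs by rewrite mem_preimages // e.
      move=> /(nthP 0) [i ni ei].
      have hn : nbhs (G j y) (N (Ordinal ni)) by rewrite -ei; apply: (nN (Ordinal ni)).
      have nz : \forall z \near y, N (Ordinal ni) (G j z) := contG hn.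
      by apply: filterS nz => z h _; exists (Ordinal ni).
    have d0 : T (G j y) - y != 0 by rewrite subr_eq0.
    have c : {for y, continuous (fun z => T (G j z) - z)}.
      apply: continuousB; last exact: cvg_id.
      by apply: (@continuous_comp _ _ _ (G j) T); [exact: contG|exact: contT].
    have nz : \forall z \near y, T (G j z) - z != 0 := c _ (near_neq0 d0).
    by apply: filterS nz => z + h; rewrite h subrr eqxx.
  by near=> z; split; near: z.
exists W°; split.
- exact: open_interior.
- exact: nW.
- by move=> z /interior_subset [].
exists S, N; split=> //.
- by move=> i; apply: open_interior.
- by move=> i x /interior_subset.
- by move=> i z /interior_subset [_ h _ _]; apply: h; rewrite mem_enum.
split.
  move=> i j z /interior_subset [_ _ h _] e; apply/eqP/negPn/negP => ij.
  have := h (i, j) (allpairs_f _ _ _) ij; rewrite !mem_enum /= e eqxx.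
  by move=> /(_ isT isT).
move=> x /interior_subset [z0 _ _ h].
have x0 : x != 0 by apply: contraNneq z0 => ->; rewrite T0.
have [j ej] := branch x0.
have := h j; rewrite mem_enum -ej => /(_ isT erefl) [i Ni]; by exists i.
Unshelve. all: by end_near. Qed.

(** The sections [S i] enumerate each nearby fibre without repetition. *)
Lemma size_preimages_local (y : E) : y != 0 ->
  \forall z \near y, size (preimages z) = size (preimages y).
Proof.
move=> y0; have [V [oV Vy V0 [S [N [_ _ h1 h2 [h3 h4]]]]]] := evenly_covered y0.
have nV : nbhs y V by apply: open_nbhs_nbhs.
apply: filterS nV => z Vz; have z0 := V0 z Vz.
rewrite -[RHS](size_enum_ord (size (preimages y))) -(size_map (fun i => S i z)).
apply/perm_size/uniq_perm.
- exact: undup_uniq.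
- rewrite map_inj_in_uniq ?enum_uniq // => i j _ _; exact: h3.
move=> x; rewrite (mem_preimages _ z0); apply/eqP/mapP => [e|[i _ ->]].
  have [|i Ni] := h4 x; first by rewrite e.
  by exists i; rewrite ?mem_enum // -(h1 i x Ni) e.
by have [] := h2 i z Vz.
Qed.

(** The segment between independent vectors avoids 0, and a locally constant function on a segment
    is constant. *)
Lemma size_preimages_segment (a b : E) : edet a b != 0 ->
  size (preimages a) = size (preimages b).
Proof.
move=> d0; pose g (s : R) : E := a + s *: (b - a).
have cg : continuous g.
  move=> s; apply: cvgD; first exact: cvg_cst.
  by apply: cvgZr_tmp; apply: cvg_id.
have g0 s : g s != 0.
  apply: contraNneq d0 => e; have e1 : edet a (g s) = 0 by rewrite e /edet /=; ring.
  have ga : g s = (a.1 + s * (b.1 - a.1), a.2 + s * (b.2 - a.2)) by [].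
  have e2 : s * edet a b = 0 by rewrite -[RHS]e1 ga /edet /=; ring.
  move/eqP: e2; rewrite mulf_eq0 => /orP[/eqP s0|//].
  by rewrite /edet; move: e; rewrite /g s0 scale0r addr0 => -> /=; rewrite !mul0r subrr.
have loc s : \forall s' \near s, size (preimages (g s')) = size (preimages (g s)).
  exact: (cg s _ (size_preimages_local (g0 s))).
pose c := size (preimages (g 0)).
pose U := [set s | size (preimages (g s)) = c].
have oU : open U.
  by rewrite openE => s Us; have := loc s; apply: filterS => s' e; rewrite /U /= e.
have oU' : open (~` U).
  by rewrite openE => s Us; have := loc s; apply: filterS => s' e; rewrite /U /= e.
have ca : `[(0 : R), 1] `&` U = `[0, 1]%classic.
  apply: (@segment_connected R 0 1).
  - by exists 0; split => //=; rewrite in_itv /= lexx ler01.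
  - by exists U.
  - by exists U => //; rewrite -[U]setCK; apply: open_closedC.
have : U 1.
  have : `[(0 : R), 1]%classic 1 by rewrite /= in_itv /= lexx ler01.
  by rewrite -ca => -[].
by rewrite /U /c /g /= scale1r scale0r addr0 addrC subrK => ->.
Qed.

(** Proportional vectors are compared through [c], which is perpendicular to both. *)
Lemma size_preimages_const (a b : E) : a != 0 -> b != 0 ->
  size (preimages a) = size (preimages b).
Proof.
move=> a0 b0; have [d0|] := eqVneq (edet a b) 0; last exact: size_preimages_segment.
have pos (z : E) : z != 0 -> edet z (- z.2, z.1) != 0.
  move=> z0; apply: contraNneq z0; rewrite /edet /= mulrN opprK => e.
  have /eqP : z.1 ^+ 2 + z.2 ^+ 2 = 0 by rewrite -[RHS]e; ring.
  rewrite paddr_eq0 ?sqr_ge0 // !sqrf_eq0 => /andP[/eqP z1 /eqP z2].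
  by apply/eqP; rewrite [z]surjective_pairing z1 z2.
pose c : E := (- a.2, a.1).
have ac : edet a c != 0 by exact: pos.
have bc : edet b c != 0.
  have b' := pos b b0; apply: contraNneq b' => e.
  (* Lagrange's identity: [edet b c] is the scalar product of [a] and [b]. *)
  have h : edet a c * edet b (- b.2, b.1) = edet a b ^+ 2 + edet b c ^+ 2.
    rewrite /edet /c /=; ring.
  by move: h; rewrite d0 e expr0n addr0 => /eqP; rewrite mulf_eq0 (negbTE ac) orFb.
by rewrite (size_preimages_segment ac) (size_preimages_segment bc).
Qed.

Lemma branches_covering : finite_covering (punctured_plane R) (punctured_plane R) T.
Proof.
have e0 : ((1, 0) : E) != 0 by apply/eqP => -[/eqP]; rewrite oner_eq0.
split=> [x /eqP x0||]; first by apply/eqP; exact: TN0.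
  exact: continuous_subspaceT.
exists (size (preimages (T (1, 0)))).
  have : (1, 0) \in preimages (T (1, 0)) by rewrite mem_preimages // TN0.
  by case: (preimages _).
move=> y /eqP y0; rewrite (size_preimages_const (TN0 e0) y0).
have [V [oV Vy V0 [S [N [oN cS h1 h2 [h3 h4]]]]]] := evenly_covered y0.
have TNV x : V (T x) -> x != 0.
  by move=> /V0 /=; apply: contraNneq => ->; rewrite T0.
have oTV : open (T @^-1` V) by apply: open_comp => // x _; exact: contT.
exists V; split=> //.
  exists V => //; apply/seteqP; split=> [z Vz|z []//]; split=> //.
  by apply/eqP; exact: V0.
exists (fun i => N i `&` T @^-1` V); split.
- move=> i; exists (N i `&` T @^-1` V); first by apply: openI.
  apply/seteqP; split=> [x [Nx Vx]|x []//]; split=> //.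
  by apply/eqP; apply: TNV.
- move=> i j _ _ [x [[Ni Vx] [Nj _]]]; apply: (h3 i j (T x)) => //.
  by rewrite !h1.
- apply/seteqP; split=> [x [_ Vx]|x [i _ [Ni Vx]]].
    by have [i Ni] := h4 x Vx; exists i.
  by split=> //; apply/eqP; apply: TNV.
move=> i; split; first exact: continuous_subspaceT.
exists (S i); split.
- by apply: continuous_subspaceT; exact: cS.
- by move=> x [Nx Vx]; split=> //; rewrite h1.
- by move=> z Vz; have [h e] := h2 i z Vz; split=> //; split=> //=; rewrite /preimage /= e.
Qed.

End Covering.

(** * The tropical map: piecewise linearity and covering property *)

Section Topology.
Variables (R : realType).
Local Notation E := (R * R)%type.

Lemma fst_continuous : continuous (fun z : E => z.1 : R).
Proof. by move=> z; apply: cvg_fst. Qed.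
Lemma snd_continuous : continuous (fun z : E => z.2 : R).
Proof. by move=> z; apply: cvg_snd. Qed.

Lemma lin_continuous (a b : R) : continuous (fun z : E => z.1 * a + z.2 * b : R).
Proof.
move=> z; apply: cvgD; apply: cvgM; try exact: cvg_cst.
  exact: fst_continuous.
exact: snd_continuous.
Qed.

Lemma pair_continuous (f g : E -> R) : continuous f -> continuous g ->
  continuous (fun z => (f z, g z) : E).
Proof. by move=> cf cg z; apply: (cvg_pair (cf z) (cg z)). Qed.

Lemma rdot_continuous m : continuous (fun z : E => rdot z m : R).
Proof. exact: lin_continuous. Qed.

Lemma edet_continuous a : continuous (fun z : E => edet a z : R).
Proof.
have -> : (fun z : E => edet a z) = (fun z : E => z.1 * (- a.2) + z.2 * a.1).
  by apply: funext => z; rewrite /edet; ring.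
exact: lin_continuous.
Qed.

Definition mulE (a b c d : R) (z : E) : E := (z.1 * a + z.2 * b, z.1 * c + z.2 * d).

Lemma mulE_linear a b c d : linear (mulE a b c d).
Proof.
by move=> r x y; rewrite /mulE; congr pair; rewrite /= /GRing.scale /=; ring.
Qed.
HB.instance Definition _ a b c d := GRing.isLinear.Build R E E _ (mulE a b c d)
  (mulE_linear a b c d).

Lemma mulE_continuous a b c d : continuous (mulE a b c d).
Proof. by apply: pair_continuous; apply: lin_continuous. Qed.

Lemma edet_mulE a b c d z w : edet (mulE a b c d z) (mulE a b c d w) = (a * d - b * c) * edet z w.
Proof. by rewrite /edet /mulE /=; ring. Qed.


Lemma edet_perp_neq0 (w : E) : w != 0 -> w.1 ^+ 2 + w.2 ^+ 2 != 0.
Proof.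
apply: contra; rewrite paddr_eq0 ?sqr_ge0 // !expf_eq0 /= => /andP[/eqP e /eqP e'].
by apply/eqP; rewrite [w]surjective_pairing e e'.
Qed.

Lemma rdot_frame (w z : E) m : rdot z m * (w.1 ^+ 2 + w.2 ^+ 2) =
  rdot w m * (w.1 * z.1 + w.2 * z.2) + rdot (perp w) m * edet w z.
Proof. by rewrite /rdot /edet /perp /=; ring. Qed.

Lemma rdotZ (r : R) (t : E) m : rdot (r *: t) m = r * rdot t m.
Proof. by have -> : r *: t = (r * t.1, r * t.2) by []; rewrite /rdot /=; ring. Qed.

(** Two linear maps glued along the line through [w]. Such a map inverts T near a ray at which T
    changes its linear piece. *)
Definition bend (A B : E -> E) (d : R) (w z : E) : E :=
  if 0 <= d * edet w z then A z else B z.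

(** The linear maps agree at [w], so their difference is [edet w z] times a constant vector. The
    glued map is the second one plus [max(0, d * edet w z)] times a constant vector. *)
Lemma bend_continuous a b c e a' b' c' e' d w : w != 0 ->
  mulE a b c e w = mulE a' b' c' e' w ->
  continuous (bend (mulE a b c e) (mulE a' b' c' e') d w).
Proof.
move=> w0 [e1 e2].
have [->|d0] := eqVneq d 0.
  have -> : bend (mulE a b c e) (mulE a' b' c' e') 0 w = mulE a b c e.
    by apply: funext => z; rewrite /bend mul0r lexx.
  exact: mulE_continuous.
pose N := w.1 ^+ 2 + w.2 ^+ 2; have N0 : N != 0 := edet_perp_neq0 w0.
(* The difference of the maps at the vector [perp w], divided by [d] and by the squared length [N]
   of [w]. *)
pose k1 := (w.1 * (b - b') - w.2 * (a - a')) / (N * d).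
pose k2 := (w.1 * (e - e') - w.2 * (c - c')) / (N * d).
pose h z := Num.max 0 (d * edet w z) : R.
have ch : continuous h.
  move=> z; apply: (@continuous_max R E (fun=> 0) (fun z => d * edet w z) z).
    exact: cvg_cst.
  apply: cvgM; first exact: cvg_cst.
  exact: edet_continuous.
have -> : bend (mulE a b c e) (mulE a' b' c' e') d w = (fun z =>
    (z.1 * a' + z.2 * b' + h z * k1, z.1 * c' + z.2 * e' + h z * k2)).
  apply: funext => z; rewrite /bend /h; case: (leP 0 (d * edet w z)) => hz; last first.
    by rewrite !mul0r !addr0.
  have key p q p' q' : w.1 * p + w.2 * q = w.1 * p' + w.2 * q' ->
      z.1 * p + z.2 * q = z.1 * p' + z.2 * q' +
        d * edet w z * ((w.1 * (q - q') - w.2 * (p - p')) / (N * d)).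
    move=> ee; have -> : d * edet w z * ((w.1 * (q - q') - w.2 * (p - p')) / (N * d)) =
       edet w z * (w.1 * (q - q') - w.2 * (p - p')) / N by field; rewrite N0 d0.
    have -> : edet w z * (w.1 * (q - q') - w.2 * (p - p')) =
       N * (z.1 * (p - p') + z.2 * (q - q')) -
       (w.1 * z.1 + w.2 * z.2) * (w.1 * p + w.2 * q - (w.1 * p' + w.2 * q')).
      by rewrite /edet /N; ring.
    by rewrite ee subrr mulr0 subr0 mulrAC divff // mul1r; ring.
  by rewrite /mulE; congr pair; apply: key.
apply: pair_continuous => z.
  apply: cvgD; first exact: lin_continuous.
  by apply: cvgM; [exact: ch|exact: cvg_cst].
apply: cvgD; first exact: lin_continuous.
by apply: cvgM; [exact: ch|exact: cvg_cst].
Qed.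

Section Nu.
Variables (C : numClosedFieldType) (F : ratField C).
Local Notation A := (Pol F).
Implicit Types (P Q : A) (t z : E) (m n : nat * nat).

Lemma nu_min P n : n \in supp P ->
  (fun z => nu z P) = (fun z => \big[Num.min/rdot z (nvec n)]_(m <- supp P) rdot z (nvec m)).
Proof.
move=> nP; apply: funext => z; have P0 : P != 0.
  by apply: contraTneq nP => ->; rewrite mem_supp cf0 eqxx.
have [m [mP hm] ->] := low_exists_nu z P0.
have hn := hm n nP; apply/eqP; rewrite eq_le; apply/andP; split.
  elim: (supp P) hm => [|i r IH] h; first by rewrite big_nil.
  rewrite big_cons le_min h ?mem_head ?IH // => j jr.
  by apply: h; rewrite inE jr orbT.
elim: (supp P) mP => // i r IH; rewrite big_cons inE ge_min => /orP[/eqP ->|/IH ->].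
  by rewrite lexx.
by rewrite orbT.
Qed.

Lemma nu_continuous P : P != 0 -> continuous (fun z => nu z P : R).
Proof.
move=> P0; have [n [nP _] _] := low_exists_nu (0 : E) P0; rewrite (nu_min nP).
elim: (supp P) => [|i r IH] z.
  by under eq_fun do rewrite big_nil; apply: rdot_continuous.
under eq_fun do rewrite big_cons.
apply: (@continuous_min R E (fun z => rdot z (nvec i))
  (fun z => \big[Num.min/rdot z (nvec n)]_(m <- r) rdot z (nvec m))).
  exact: rdot_continuous.
exact: IH.
Qed.

(** An exponent of larger weight at [t0] keeps a larger weight nearby. Ties at [t0] are decided on
    one side of the ray by [perp t0] and on the other by its negative, according to the sign of
    [eps]. *)
Lemma near_nu t0 (eps : R) P m c : t0 != 0 -> eps != 0 -> c != 0 ->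
  bnd t0 (eps *: perp t0) P m c ->
  \forall z \near t0, 0 <= eps * edet t0 z -> nu z P = rdot z (nvec m).
Proof.
move=> t00 e0 c0 [hP cP].
have key : \forall z \near t0, forall n, n \in supp P ->
    0 <= eps * edet t0 z -> rdot z (nvec m) <= rdot z (nvec n).
  apply: near_all_seq => n nP; have /orP[lt|/andP[/eqP eq le]] := hP n nP.
    have d0 : 0 < rdot t0 (nvec n - nvec m) by rewrite rdotB subr_gt0.
    have : \forall z \near t0, 0 < rdot z (nvec n - nvec m).
      have cz : {for t0, continuous (fun z => rdot z (nvec n - nvec m))}.
        exact: rdot_continuous.
      exact: (cvgr_gt _ cz _ d0).
    by apply: filterS => z; rewrite rdotB subr_gt0 => /ltW.
  near=> z => hz; rewrite -subr_ge0 -rdotB.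
  have N0 : 0 < t0.1 ^+ 2 + t0.2 ^+ 2.
    by rewrite lt_def edet_perp_neq0 // addr_ge0 ?sqr_ge0.
  (* For a tie at [t0] the difference of weights is a positive multiple of the pairing with
     [perp t0] times [edet t0 z]; the factor [eps ^+ 2] puts one [eps] on each. *)
  rewrite -(pmulr_lge0 _ N0) rdot_frame rdotB eq subrr mul0r add0r.
  have e2 : 0 < eps ^+ 2 by rewrite lt_def sqrf_eq0 e0 sqr_ge0.
  rewrite -(pmulr_rge0 _ e2).
  have -> : eps ^+ 2 * (rdot (perp t0) (nvec n - nvec m) * edet t0 z) =
    (rdot (eps *: perp t0) (nvec n) - rdot (eps *: perp t0) (nvec m)) * (eps * edet t0 z).
    by rewrite !rdotZ rdotB; ring.
  by rewrite mulr_ge0 // subr_ge0.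
apply: filterS key => z h hz; apply: nuE; split; last by move=> n nP; apply: h.
by rewrite mem_supp cP.
Unshelve. all: by end_near. Qed.


Lemma nu_homog P t (r : R) : 0 <= r -> nu (r *: t) P = r * nu t P.
Proof.
have [->|P0] := eqVneq P 0.
  rewrite /nu !xgetPN ?mulr0 // => x [m [+ _] _]; by rewrite mem_supp cf0 eqxx.
move=> r0; have [m [mP h] ->] := low_exists_nu t P0.
have e n : rdot (r *: t) (nvec n) = r * rdot t (nvec n) by rewrite rdotZ.
rewrite -e; apply: nuE; split=> // n nP; rewrite !e; apply: ler_wpM2l => //; exact: h.
Qed.

Section Map.
Variables (P1 Q1 P2 Q2 : A) (delta : C).
Hypotheses (P10 : P1 != 0) (Q10 : Q1 != 0) (P20 : P2 != 0) (Q20 : Q2 != 0).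
Local Notation u := (toFun P1 / toFun Q1).
Local Notation v := (toFun P2 / toFun Q2).
Hypothesis delta0 : delta != 0.
Hypothesis pres : xF F * yF F * jac u v = cK F delta * (u * v).
Local Notation T := (@Tmap R C F P1 Q1 P2 Q2).

Lemma Tmap_homog (r : R) t : 0 <= r -> T (r *: t) = r *: T t.
Proof. by move=> r0; rewrite /Tmap !nu_homog // -!mulrBr. Qed.

Lemma Tmap_ray l : primitive l -> exists l', [/\ primitive l',
  T @` ray R l.1 l.2 = ray R l'.1 l'.2 &
  forall g, V l (pullb u v g) <-> V l' g].
Proof.
move=> pl; have [k [l' [k0 pl' Tl h]]] := Tmap_int R P10 Q10 P20 Q20 delta0 pres pl.
exists l'; split=> //; have k0' : 0 < k%:~R :> R by rewrite ltr0z.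
apply/seteqP; split=> [_ [t [r r0 ->] <-]|_ [r r0 ->]].
  exists (r * k%:~R); first by rewrite mulr_ge0 // ltW.
  have -> : (r * l.1%:~R, r * l.2%:~R) = r *: intv R l by [].
  rewrite Tmap_homog // Tl /intv /= !rmorphM /= -!mulrA.
  by [].
exists (r / k%:~R *: intv R l).
  by exists (r / k%:~R) => //; rewrite divr_ge0 // ltW.
rewrite Tmap_homog ?divr_ge0 // ?ltW // Tl /intv /= !rmorphM /=.
transitivity (r / k%:~R * (k%:~R * l'.1%:~R), r / k%:~R * (k%:~R * l'.2%:~R)) => //.
by rewrite !mulrA !divfK // gt_eqF.
Qed.

Lemma Tmap_lattice : preserves_lattice T.
Proof.
move=> a b; have N P : P != 0 -> exists n : int, nu ((a%:~R, b%:~R) : E) P = n%:~R.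
  move=> P0; have [m _ ->] := low_exists_nu ((a%:~R, b%:~R) : E) P0.
  by exists (dot (a, b) (nvec m)); rewrite -rdot_int.
have [n1 e1] := N _ P10; have [n2 e2] := N _ Q10.
have [n3 e3] := N _ P20; have [n4 e4] := N _ Q20.
by exists (n1 - n2), (n3 - n4); rewrite /Tmap e1 e2 e3 e4 !rmorphB.
Qed.

Lemma Tmap_continuous : continuous T.
Proof.
apply: pair_continuous => z; apply: cvgB; exact: nu_continuous.
Qed.

Local Notation quad := (((nat * nat) * (nat * nat)) * ((nat * nat) * (nat * nat)))%type.
(** Each quadruple is a guess of the lowest exponents of the four polynomials. Where the guess is
    right, T is [quad_map]. *)
Definition quads : seq quad :=
  [seq (a, b) | a <- [seq (p, q) | p <- supp P1, q <- supp Q1],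
                b <- [seq (p, q) | p <- supp P2, q <- supp Q2]].
Implicit Types q : quad.
Definition quad1 q : int * int := nvec q.1.1 - nvec q.1.2.
Definition quad2 q : int * int := nvec q.2.1 - nvec q.2.2.
Definition quad_map q : E -> E := mulE (quad1 q).1%:~R (quad1 q).2%:~R
  (quad2 q).1%:~R (quad2 q).2%:~R.
(** The inverse matrix. For a quadruple of determinant 0, division by zero makes it the zero map,
    which is still a continuous candidate for a branch. *)
Definition quad_inv q : E -> E := let d := (det (quad1 q) (quad2 q))%:~R in
  mulE ((quad2 q).2%:~R / d) (- (quad1 q).2%:~R / d)
    (- (quad2 q).1%:~R / d) ((quad1 q).1%:~R / d).

Lemma quad_mapE q z : quad_map q z = (rdot z (quad1 q), rdot z (quad2 q)).
Proof. by []. Qed.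

Lemma quad_mapK q : det (quad1 q) (quad2 q) != 0 -> cancel (quad_map q) (quad_inv q).
Proof.
move=> d0 z; have : (det (quad1 q) (quad2 q))%:~R != 0 :> R by rewrite intr_eq0.
rewrite [RHS]surjective_pairing /quad_inv /quad_map /mulE.
case: (quad1 q) (quad2 q) => a b [a' b']; rewrite /det rmorphB !rmorphM /= => d.
by congr pair; field.
Qed.

Lemma quad_invK q : det (quad1 q) (quad2 q) != 0 -> cancel (quad_inv q) (quad_map q).
Proof.
move=> d0 z; have : (det (quad1 q) (quad2 q))%:~R != 0 :> R by rewrite intr_eq0.
rewrite [RHS]surjective_pairing /quad_inv /quad_map /mulE.
case: (quad1 q) (quad2 q) => a b [a' b']; rewrite /det rmorphB !rmorphM /= => d.
by congr pair; field.
Qed.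

Lemma edet_quad q z w : edet (quad_map q z) (quad_map q w) =
  (det (quad1 q) (quad2 q))%:~R * edet z w.
Proof.
rewrite edet_mulE; congr (_ * _); case: (quad1 q) (quad2 q) => a b [a' b'].
by rewrite /det rmorphB !rmorphM.
Qed.

Lemma quad_inv_continuous q : continuous (quad_inv q).
Proof. exact: mulE_continuous. Qed.

Lemma Tmap_quad t s : t.1 * s.2 - t.2 * s.1 != 0 -> exists q a1 b1 a2 b2,
  [/\ [/\ bnd t s P1 q.1.1 a1, bnd t s Q1 q.1.2 b1, bnd t s P2 q.2.1 a2 & bnd t s Q2 q.2.2 b2],
      [/\ a1 != 0, b1 != 0, a2 != 0 & b2 != 0], q \in quads,
      (det (quad1 q) (quad2 q))%:~R = delta & T t = quad_map q t].
Proof.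
move=> /(flag_leads P10 Q10 P20 Q20 pres).
move=> [p1 [q1 [p2 [q2 [a1 [b1 [a2 [b2 [[h1 k1 h2 k2] [a10 b10 a20 b20] d e]]]]]]]]].
exists ((p1, q1), (p2, q2)), a1, b1, a2, b2; split=> //=.
case: (h1) (k1) (h2) (k2) => [_ x1] [_ x2] [_ x3] [_ x4].
by do 2! apply: allpairs_f; rewrite mem_supp ?x1 ?x2 ?x3 ?x4.
Qed.


Lemma low_closed P p : closed [set t : E | forall n, n \in supp P -> rdot t (nvec p) <= rdot t (nvec n)].
Proof.
have -> : [set t : E | forall n, n \in supp P -> rdot t (nvec p) <= rdot t (nvec n)] =
    \bigcap_(n in [set n | n \in supp P]) [set t : E | 0 <= rdot t (nvec n - nvec p)].
  by apply/seteqP; split=> t h n nP; have := h n nP; rewrite /= rdotB subr_ge0.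
apply: closed_bigI => n _.
apply: (@closed_comp _ _ (fun t : E => rdot t (nvec n - nvec p)) [set x | 0 <= x]).
  by move=> t _; exact: rdot_continuous.
exact: closed_ge.
Qed.

Lemma Tmap_pl : piecewise_linear T.
Proof.
split; first exact: Tmap_continuous.
pose cone P p := [set t : E | forall n, n \in supp P -> rdot t (nvec p) <= rdot t (nvec n)].
pose s q := cone P1 q.1.1 `&` cone Q1 q.1.2 `&` cone P2 q.2.1 `&` cone Q2 q.2.2.
have ms q r t : 0 <= r -> s q t -> s q (r *: t).
  have mc P p : 0 <= r -> cone P p t -> cone P p (r *: t).
    by move=> r0 h n nP; rewrite !rdotZ; apply: ler_wpM2l => //; apply: h.
  by move=> r0 [[[h1 h2] h3] h4]; split; [split; [split|]|]; apply: mc.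
pose dq : quad := (((0, 0), (0, 0)), ((0, 0), (0, 0)))%N.
exists (size quads), (fun i => s (nth dq quads i) ); split.
- by move=> i; split; [do !apply: closedI; exact: low_closed|move=> r t; apply: ms].
- apply/seteqP; split=> // t _.
  have [p1 [p1P h1] _] := low_exists_nu t P10; have [q1 [q1P k1] _] := low_exists_nu t Q10.
  have [p2 [p2P h2] _] := low_exists_nu t P20; have [q2 [q2P k2] _] := low_exists_nu t Q20.
  have : ((p1, q1), (p2, q2)) \in quads by do 2! apply: allpairs_f => //.
  by move=> /(nthP dq) [i ni e]; exists (Ordinal ni) => //; rewrite /= e.
move=> i; set q := nth _ _ _; have : q \in quads by apply: mem_nth.
move=> /allpairsP [[a b] [/allpairsP [[p1 q1] [p1P q1P ->]] /allpairsP [[p2 q2] [p2P q2P ->]] ->]] /=.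
exists (quad_map ((p1, q1), (p2, q2)) : {linear E -> E}) => t [[[h1 k1] h2] k2].
suff : T t = quad_map ((p1, q1), (p2, q2)) t by [].
rewrite quad_mapE /quad1 /quad2 /= /Tmap !rdotB.
by congr pair; congr (_ - _); apply: nuE; split.
Qed.

Lemma perp_flag (t : E) (e : R) : e != 0 -> t != 0 ->
  t.1 * (e *: perp t).2 - t.2 * (e *: perp t).1 != 0.
Proof.
move=> e0 t0; have -> : t.1 * (e *: perp t).2 - t.2 * (e *: perp t).1 =
  e * (t.1 ^+ 2 + t.2 ^+ 2).
  have -> : e *: perp t = (- (e * t.2), e * t.1) by rewrite -mulrN.
  by rewrite /=; ring.
by rewrite mulf_neq0 ?edet_perp_neq0.
Qed.

Lemma Tmap0 : T 0 = 0.
Proof. by rewrite -[X in T X](scale0r 0) Tmap_homog // scale0r. Qed.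

Lemma det_neq0 (d : int) : d%:~R = delta -> d != 0.
Proof. by move=> e; apply: contraNneq delta0 => d0; rewrite -e d0. Qed.

Lemma Tmap_branch t : t != 0 -> exists2 q, q \in quads & t = quad_inv q (T t).
Proof.
move=> t0; have [|q [_ [_ [_ [_ [_ _ qq dq ->]]]]]] := @Tmap_quad t (1 *: perp t).
  exact: perp_flag (oner_neq0 _) t0.
by exists q => //; rewrite quad_mapK //; apply: det_neq0.
Qed.

Lemma quad_inv0 q : quad_inv q 0 = 0.
Proof. exact: (linear0 (quad_inv q)). Qed.

Lemma Tmap_neq0 t : t != 0 -> T t != 0.
Proof.
move=> t0; have [q _ e] := Tmap_branch t0.
by apply: contra_neq t0 => e0; rewrite e e0 quad_inv0.
Qed.

(* Near t, Tmap is linear on each side of the line through t.  Both linear maps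
   have determinant delta, so their inverses fit together. *)
Lemma Tmap_local t : t != 0 -> exists S : E -> E,
  [/\ continuous S, S (T t) = t, \forall z \near t, S (T z) = z &
      \forall y \near T t, T (S y) = y].
Proof.
move=> t0; have N1 : (-1 : R) != 0 by rewrite oppr_eq0 oner_neq0.
(* The flags with second weights [perp t] and its negative give the linear pieces [q] and [q'] of T
   on the two sides of the ray. *)
have [q [a1 [b1 [a2 [b2 [[h1 k1 h2 k2] [a10 b10 a20 b20] _ dq Tq]]]]]] :=
  Tmap_quad (perp_flag (oner_neq0 _) t0).
have [q' [a1' [b1' [a2' [b2' [[h1' k1' h2' k2'] [a10' b10' a20' b20'] _ dq' Tq']]]]]] :=
  Tmap_quad (perp_flag N1 t0).
have ed : det (quad1 q') (quad2 q') = det (quad1 q) (quad2 q).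
  by apply/eqP; rewrite -(eqr_int C) dq dq'.
have d0 := det_neq0 dq; have d0' := det_neq0 dq'; set d := det (quad1 q) _ in ed d0.
have dR : (d%:~R : R) != 0 by rewrite intr_eq0.
have dd : 0 < (d%:~R : R) * d%:~R by rewrite -expr2 lt_def sqrf_eq0 dR sqr_ge0.
have Tp : \forall z \near t, 0 <= edet t z -> T z = quad_map q z.
  have := near_nu t0 (oner_neq0 _) a10 h1; have := near_nu t0 (oner_neq0 _) b10 k1.
  have := near_nu t0 (oner_neq0 _) a20 h2; have := near_nu t0 (oner_neq0 _) b20 k2.
  move=> x1 x2 x3 x4; near=> z => hz; rewrite /Tmap quad_mapE !rdotB.
  have hz' : 0 <= 1 * edet t z by rewrite mul1r.
  by congr pair; congr (_ - _); move: hz'; near: z.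
have Tn : \forall z \near t, edet t z <= 0 -> T z = quad_map q' z.
  have := near_nu t0 N1 a10' h1'; have := near_nu t0 N1 b10' k1'.
  have := near_nu t0 N1 a20' h2'; have := near_nu t0 N1 b20' k2'.
  move=> x1 x2 x3 x4; near=> z => hz; rewrite /Tmap quad_mapE !rdotB.
  have hz' : 0 <= -1 * edet t z by rewrite mulN1r oppr_ge0.
  by congr pair; congr (_ - _); move: hz'; near: z.
set w := T t in Tq Tq' *.
have w0 : w != 0 by apply: Tmap_neq0.
(* [quad_map q] multiplies [edet] by [d], so it carries the side where [edet t z] is nonnegative to
   the side where [d * edet w y] is. *)
pose S := bend (quad_inv q) (quad_inv q') d%:~R w.
have G0 : quad_inv q w = t by rewrite Tq quad_mapK.
have G0' : quad_inv q' w = t by rewrite Tq' quad_mapK.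
have cS : continuous S by apply: bend_continuous => //; rewrite -/(quad_inv _) G0.
have edG y : d%:~R * edet t (quad_inv q y) = edet w y.
  by rewrite -edet_quad -Tq quad_invK.
have edG' y : d%:~R * edet t (quad_inv q' y) = edet w y.
  by rewrite -ed -edet_quad -Tq' quad_invK.
have Sw : S w = t by rewrite /S /bend; case: ifP.
exists S; split=> //.
  apply: filterS2 Tp Tn => z hp hn; have [ez|/ltW ez] := leP 0 (edet t z).
    rewrite hp // /S /bend Tq edet_quad -/d mulrA pmulr_rge0 // ez.
    exact: quad_mapK.
  rewrite hn // /S /bend Tq' edet_quad ed mulrA.
  (* The other case is the line through [t], where both pieces agree with T. *)
  case: ifP; last by rewrite quad_mapK.
  rewrite pmulr_rge0 // => ez'; rewrite -hn // hp //.
  exact: quad_mapK.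
have n1 : \forall y \near w, (0 <= edet t (S y) -> T (S y) = quad_map q (S y)) /\
     (edet t (S y) <= 0 -> T (S y) = quad_map q' (S y)).
  have h : nbhs (S w) [set z | (0 <= edet t z -> T z = quad_map q z) /\
     (edet t z <= 0 -> T z = quad_map q' z)] by rewrite Sw; apply: filterS2 Tp Tn.
  exact: (cS w _ h).
apply: filterS n1 => y; rewrite /S /bend; case: ifP => [ey|/negbT ey] [h h'].
  have e0 : 0 <= edet t (quad_inv q y) by rewrite -(pmulr_rge0 _ dd) -mulrA edG.
  by rewrite (h e0) quad_invK.
have e0 : edet t (quad_inv q' y) <= 0.
  by rewrite -(pmulr_rle0 _ dd) -mulrA edG'; rewrite -ltNge in ey; exact: ltW.
by rewrite (h' e0) quad_invK.
Unshelve. all: by end_near. Qed.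

Lemma Tmap_covering : finite_covering (punctured_plane R) (punctured_plane R) T.
Proof.
pose dq : quad := (((0, 0), (0, 0)), ((0, 0), (0, 0)))%N.
apply: (@branches_covering R T (size quads) (fun j => quad_inv (nth dq quads j))).
- exact: Tmap_continuous.
- by move=> j; apply: quad_inv_continuous.
- exact: Tmap0.
- exact: Tmap_neq0.
- move=> x /Tmap_branch [q /(nthP dq) [i ni e] ex].
  by exists (Ordinal ni); rewrite /= e.
- exact: Tmap_local.
Qed.

End Map.
End Nu.

End Topology.

(** * Limits along arcs *)

Section PolyLimit.
Variable C : numFieldType.

Lemma near0_neq0 : \forall z \near (0 : C)^', z != 0.
Proof. by rewrite near_withinE; near=> z. Unshelve. all: by end_near. Qed.

Lemma horner_cvg (p : {poly C}) (z : C) : p.[x] @[x --> z] --> p.[z].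
Proof.
elim/poly_ind: p => [|p c IH].
  under eq_fun do rewrite horner0; rewrite horner0.
  exact: (@cvg_cst C 0 C (nbhs z)).
under eq_fun do rewrite hornerMXaddC.
rewrite hornerMXaddC; apply: (@cvgD C C C (nbhs z)).
  by apply: (@cvgM C C (nbhs z)) => //; exact: cvg_id.
exact: (@cvg_cst C c C (nbhs z)).
Qed.

Lemma near0_horner (f g : {poly C}) (e : C) : g.[0] != 0 -> 0 < e ->
  \forall z \near (0 : C)^',
    [/\ z != 0, g.[z] != 0 & `|f.[z] / g.[z] - f.[0] / g.[0]| < e].
Proof.
move=> g0 e0.
have cv : f.[z] / g.[z] @[z --> (0 : C)] --> f.[0] / g.[0].
  apply: (@cvgM C C (nbhs 0)); first exact: horner_cvg.
  by apply: (@cvgV C C (nbhs 0)) => //; exact: horner_cvg.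
have nz : \forall z \near (0 : C), g.[z] != 0.
  exact: (@cvgr_neq0 C C _ (nbhs (0 : C)) _ _ g.[0] (@horner_cvg g 0) g0).
have z0 := near0_neq0; have lt := cvgr_dist_lt _ _ cv _ e0.
have nz' : \forall z \near (0 : C)^', g.[z] != 0 by apply: cvg_within; exact: nz.
have lt' : \forall z \near (0 : C)^', `|f.[0] / g.[0] - f.[z] / g.[z]| < e.
  by apply: cvg_within; exact: lt.
near=> z; split; [near: z; exact: z0|near: z; exact: nz'|].
rewrite distrC; near: z; exact: lt'.
Unshelve. all: by end_near. Qed.

Lemma near0_ex (P Q : C -> Prop) : (\forall z \near (0 : C)^', P z) ->
  (\forall z \near (0 : C)^', Q z) -> exists2 z, P z & Q z.
Proof. by move=> h h'; have [z []] := filter_ex (filterI h h'); exists z. Qed.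

Lemma near0S (P Q : C -> Prop) : (forall z, P z -> Q z) ->
  (\forall z \near (0 : C)^', P z) -> \forall z \near (0 : C)^', Q z.
Proof. by move=> h; apply: filterS. Qed.

Lemma near0I (P Q : C -> Prop) : (\forall z \near (0 : C)^', P z) ->
  (\forall z \near (0 : C)^', Q z) -> \forall z \near (0 : C)^', P z /\ Q z.
Proof. exact: filterI. Qed.

End PolyLimit.

Section Arcs.
Variables (C : numClosedFieldType) (F : ratField C).
Local Notation K := (ratFun F).
Local Notation A := (Pol F).
Local Notation cK := (@cK C F).
Local Notation xF := (xF F).
Local Notation yF := (yF F).
Local Notation mon := (@mon C F).
Local Notation pt := (@pt C F).
Local Notation V := (@V C F).
Local Notation torus_point := (@torus_point C F).

Definition arc_tends_to (alpha beta : C) (a b : int) (p : point F) : Prop :=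
  forall g c, has_value p g c -> forall e : C, 0 < e ->
  \forall z \near (0 : C)^', exists2 w,
    has_value (torus_point (alpha * z ^ a) (beta * z ^ b)) g w & `|w - c| < e.

(** The part of [corresponds] that concerns the toric surface and the arcs. *)
Definition limit_ray (P : set (placed_curve F)) (a b : int) : Prop :=
  exists X D, [/\ toric_modification X, P (X, D) &
    forall alpha beta : C, alpha != 0 -> beta != 0 ->
    exists p, [/\ X p, arc_tends_to alpha beta a b p, D p,
      irreducible_component X (X `\` torus F) D &
      forall E, irreducible_component X (X `\` torus F) E -> E p -> E = D]].

Lemma torus_point_loc a b : is_loc (torus_point a b).
Proof. exact: good_loc (torus_point_good F a b). Qed.

Lemma has_valueXz (O : point F) g c (k : int) : is_loc O -> c != 0 -> has_value O g c ->
  has_value O (g ^ k) (c ^ k).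
Proof.
move=> L c0 h; case: (intP k) => [|n|n].
- by rewrite !expr0z -(cK1 F); apply: has_valueC.
- by rewrite -!exprnP; apply: has_valueX.
- by rewrite -!invr_expz -!exprnP; apply: has_valueV; [|apply: has_valueX|rewrite expf_neq0].
Qed.

Lemma torus_point_mon a b m : a != 0 -> b != 0 ->
  has_value (torus_point a b) (mon m) (a ^ m.1 * b ^ m.2).
Proof.
move=> a0 b0; have J : jac (xF - cK a) (yF - cK b) != 0.
  by rewrite jacBcl jacBcr jac_xy oner_neq0.
have L := torus_point_loc a b.
apply: has_valueM => //; apply: has_valueXz => //; first exact: lrml.
exact: lrmr.
Qed.

Section Arc.
Variables (alpha beta : C) (l : int * int).
Hypotheses (a0 : alpha != 0) (b0 : beta != 0).
Local Notation arc z := (torus_point (alpha * z ^ l.1) (beta * z ^ l.2)).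
Local Notation kappa m := (alpha ^ m.1 * beta ^ m.2).

Lemma arc_mon z m : z != 0 -> has_value (arc z) (mon m) (kappa m * z ^ dot l m).
Proof.
move=> z0; have -> : kappa m * z ^ dot l m =
    (alpha * z ^ l.1) ^ m.1 * (beta * z ^ l.2) ^ m.2.
  by rewrite !expfzMl !exprz_exp /dot expfzDr //; ring.
by apply: torus_point_mon; rewrite mulf_neq0 // expfz_neq0.
Qed.

(** Along the arc [mon (sdual l)] is a constant times [z] and [mon (tdual l)] is the constant [c].
    An element of [pt l c] thus becomes a quotient of polynomials in [z] whose value at 0 is its
    value at the point. *)
Lemma arc_tends (pl : primitive l) : arc_tends_to alpha beta l.1 l.2 (pt l (kappa (tdual l))).
Proof.
set c := kappa _; pose s := mon (sdual l); pose t := mon (tdual l) - cK c.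
have val (P : A) : exists2 f : {poly C}, f.[0] = ev0 P & forall z, z != 0 ->
    has_value (arc z) (sb s t P) f.[z].
  elim/(@Pol_ind _ F): P => [d| | |P Q [f f0 hf] [g g0 hg]|P Q [f f0 hf] [g g0 hg]].
  - exists d%:P => [|z _]; first by rewrite hornerC ev0C.
    by rewrite hornerC sbC; apply: has_valueC; apply: torus_point_loc.
  - exists (kappa (sdual l) *: 'X) => [|z z0]; first by rewrite hornerZ hornerX mulr0 ev0X.
    have := arc_mon (sdual l) z0.
    by rewrite dot_sdual // expr1z sbX hornerZ hornerX.
  - exists 0 => [|z z0]; first by rewrite horner0 ev0Y.
    rewrite horner0 sbY; have := arc_mon (tdual l) z0.
    rewrite dot_tdual expr0z mulr1 => h; rewrite -(subrr c).
    apply: has_valueB => //; first exact: torus_point_loc.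
    by apply: has_valueC; apply: torus_point_loc.
  - exists (f + g) => [|z z0]; first by rewrite hornerD f0 g0 ev0D.
    by rewrite hornerD sbD; apply: has_valueD; [apply: torus_point_loc|apply: hf|apply: hg].
  exists (f * g) => [|z z0]; first by rewrite hornerM f0 g0 ev0M.
  by rewrite hornerM sbM; apply: has_valueM; [apply: torus_point_loc|apply: hf|apply: hg].
have J : jac s t != 0 := jac_pt F pl c.
move=> g c0 h e e0; have [P [Q [Q0 eg]]] := has_value_loc (pt_loc F pl c) h.
rewrite eg in h *; have -> := has_value_uniq (lr_loc J) h (lr_value J P Q0).
have [f f0 hf] := val P; have [f' f0' hf'] := val Q.
rewrite -f0 -f0' in Q0 *; apply: near0S (near0_horner f Q0 e0) => z [z0 nz lt].
exists (f.[z] / f'.[z]) => //.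
apply: has_valueM; [exact: torus_point_loc|exact: hf|].
by apply: has_valueV; [exact: torus_point_loc|exact: hf'|].
Qed.

Lemma arc_limit p m c : arc_tends_to alpha beta l.1 l.2 p ->
  has_value p (mon m) c -> forall e, 0 < e ->
  \forall z \near (0 : C)^', `|kappa m * z ^ dot l m - c| < e.
Proof.
move=> T h e e0; apply: near0S (near0I (near0_neq0 C) (T _ _ h e e0)) => z [z0 [w hw]].
by rewrite (has_value_uniq (torus_point_loc _ _) hw (arc_mon m z0)).
Qed.

(** Along the arc the monomial is a constant times a positive power of [z] and tends to 0. *)
Lemma arc_limit0 p m c : arc_tends_to alpha beta l.1 l.2 p ->
  has_value p (mon m) c -> 0 < dot l m -> c = 0.
Proof.
move=> T h d0; apply: contrapT => /eqP c0.
have e0 : 0 < `|c| / 2 by rewrite divr_gt0 ?normr_gt0.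
have T1 := arc_limit T h e0; pose f := kappa m *: 'X^`|dot l m|%N.
have f0 : f.[0] = 0.
  by rewrite hornerZ hornerXn expr0n absz_eq0 gt_eqF // mulr0.
have one x : (1 : {poly C}).[x] = 1 by rewrite -polyC1 hornerC.
have e1 : (1 : {poly C}).[0] != 0 by rewrite one oner_neq0.
have [z h1 [_ _ h2]] := near0_ex T1 (near0_horner f e1 e0).
rewrite f0 !one !divr1 subr0 in h2.
have ez : f.[z] = kappa m * z ^ dot l m.
  by rewrite /f hornerZ hornerXn exprnP gez0_abs // ltW.
rewrite ez in h2; have h3 := ltrD h2 h1; rewrite -splitr in h3.
set x := kappa m * _ in h3; have hc : `|c| <= `|x| + `|x - c|.
  by rewrite -[X in `|X| <= _](subKr x); apply: ler_normB.
by have := le_lt_trans hc h3; rewrite ltxx.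
Qed.

End Arc.

Lemma limit_ray_divisor l : primitive l -> limit_ray (prime_of (V l)) l.1 l.2.
Proof.
move=> pl; have [X [cones [rays [T tX lr]]]] := toric_exists F pl.
have gX := toric_generic tX lr.
exists X, (divisor X l); split=> // [|alpha beta a0 b0].
  split; first exact: divisor_placed tX _ lr.
  exact: divisor_ring.
pose c := alpha ^ (tdual l).1 * beta ^ (tdual l).2.
have c0 : c != 0 by rewrite mulf_neq0 // expfz_neq0.
have Xc : X (pt l c) by apply: toric_pt tX _ _ lr c0.
exists (pt l c); split=> //.
- exact: arc_tends.
- exact: divisor_pt.
- exact: divisor_component T tX _ lr.
by move=> E; apply: component_pt T tX _ _ _ lr c0.
Qed.

(** Orthogonality to [tdual m] gives [l = k * m] with [k] the pairing with [sdual m]; primitivity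
    and the sign leave [k = 1]. *)
Lemma primitive_parallel l m : primitive l -> primitive m ->
  dot l (tdual m) = 0 -> 0 <= dot l (sdual m) -> l = m.
Proof.
move=> pl pm h0; have e := dot_sdual pm; set k := dot l (sdual m) => k0.
have el : l = (k * m.1, k * m.2).
  rewrite [LHS]surjective_pairing; congr pair.
    transitivity (l.1 * dot m (sdual m) + (sdual m).2 * dot l (tdual m)).
      by rewrite e h0; ring.
    by rewrite /k /dot /=; ring.
  transitivity (l.2 * dot m (sdual m) - (sdual m).1 * dot l (tdual m)).
    by rewrite e h0; ring.
  by rewrite /k /dot /=; ring.
have := dot_sdual pl; rewrite {1}el /dot /= => e1.
have {}e1 : k * dot m (sdual l) = 1 by rewrite -e1 /dot; ring.
have y0 : 0 < dot m (sdual l).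
  by rewrite ltNge; apply/negP => h; have := mulr_ge0_le0 k0 h; rewrite e1.
have k1 : k <= 1 by rewrite -e1 ler_peMr // -gtz0_ge1.
have : k = 1.
  apply/eqP; rewrite eq_le k1 -gtz0_ge1 lt_def k0 andbT.
  by apply: contra_eq_neq e1 => ->; rewrite mul0r.

by rewrite el => ->; rewrite !mul1r -surjective_pairing.
Qed.

(** The limit point lies on one component only, so it is no crossing but some [pt m c], and [m = l].
    There [mon (tdual m)] has the nonzero value [c], so its exponent along the arc is 0, while that
    of [mon (sdual m)] cannot be negative. *)
Lemma limit_ray_uniq l a b : primitive l -> coprimez a b ->
  limit_ray (prime_of (V l)) a b -> (a, b) = l.
Proof.
move=> pl ab [X [D [T [PD rD] h]]].
have [p [Xp tp Dp [ID subD _] uD]] := h 1 1 (oner_neq0 _) (oner_neq0 _).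
have [cones [rays tX]] := toric_tower T; have [k1 k2 k3] := tX.
have ring_div m : m \in rays -> D = divisor X m -> l = m.
  move=> mr e; apply: (V_inj (F := F)) => //; first exact: k2.
  by rewrite -rD /= e divisor_ring //; [exact: k2|exact: toric_generic tX _ mr].
case/k3: (Xp) => [tor|[k kc e]|[m [c [mr c0 e]]]].
- by have [_] := subD _ Dp.
- have [d1 kr1 kr2] := k1 _ kc; have [c1 c2] := cross_component tX kc.
  rewrite -e in c1 c2.
  have e1 := ring_div _ kr1 (esym (uD _ (divisor_component T tX kr1) c1)).
  have e2 := ring_div _ kr2 (esym (uD _ (divisor_component T tX kr2) c2)).
  by move: d1; rewrite -e1 -e2 /det mulrC subrr.
have pm := k2 _ mr.
have em : l = m.
  apply: ring_div => //; apply/esym/uD; first exact: divisor_component T tX _ mr.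
  by rewrite e; apply: divisor_pt => //; rewrite -e.
rewrite em e in tp *; have o1 := oner_neq0 C.
have lim n d : has_value (pt m c) (mon n) d -> 0 < dot (a, b) n -> d = 0.
  exact: (@arc_limit0 1 1 (a, b) o1 o1 _ _ _ tp).
have d0 : dot (a, b) (tdual m) = 0.
  apply/eqP; rewrite eq_le !leNgt; apply/andP; split; apply/negP => d0.
    by have c1 := lim _ _ (pt_t F pm c) d0; rewrite c1 eqxx in c0.
  have hv : has_value (pt m c) (mon (- tdual m)) c^-1.
    by rewrite monN; apply: has_valueV => //; [exact: pt_loc|exact: pt_t].
  have := lim _ _ hv; rewrite (_ : dot _ _ = - dot (a, b) (tdual m)).
    by rewrite oppr_gt0 => /(_ d0) /eqP; rewrite invr_eq0 (negPf c0).
  by rewrite /dot /=; ring.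
(* With a negative exponent, some power of [z] and its inverse would both have absolute value below
   1. *)
apply: primitive_parallel => //; rewrite leNgt; apply/negP => s0.
have hs : has_value (pt m c) (mon (sdual m)) 0 by apply/has_value0/pt_s.
have T1 := @arc_limit 1 1 (a, b) o1 o1 _ _ _ tp hs _ ltr01.
have x1 : (1 : {poly C}).[0] != 0 by rewrite -polyC1 hornerC.
have [z h1 [z0 _ h2]] := near0_ex T1 (near0_horner ('X^`|dot (a, b) (sdual m)|%N) x1 ltr01).
move: h1 h2; rewrite -!polyC1 !hornerC !divr1 !hornerXn expr0n absz_eq0 lt_eqF //= !subr0.
rewrite !exp1rz !mul1r => h1 h2.
have := ltr_pM (normr_ge0 _) (normr_ge0 _) h1 h2.
have -> : z ^+ `|dot (a, b) (sdual m)| = z ^ (- dot (a, b) (sdual m)).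
  by rewrite exprnP ltz0_abs.
by rewrite -normrM -expfzDr // subrr expr0z normr1 mulr1 ltxx.
Qed.

End Arcs.

(** * The tropical map of a rational map preserving eta *)

Lemma tropical_map (R : realType) (C : numClosedFieldType) (F : ratField C)
    (u v : ratFun F) (delta : C) : delta != 0 ->
  pullb u v (eta F) * jac u v = cK F delta * eta F ->
  exists T : R * R -> R * R,
    [/\ piecewise_linear T, preserves_lattice T,
        finite_covering (punctured_plane R) (punctured_plane R) T &
        forall l, primitive l -> exists l', [/\ primitive l',
          T @` ray R l.1 l.2 = ray R l'.1 l'.2 &
          forall Q, sharp_image (pullb u v) (prime_of (V l)) Q <->
            Q = prime_of (F := F) (V l')]].
Proof.
move=> d0 h; have J : jac u v != 0.
  apply: contra_eq_neq h => ->; rewrite mulr0 eq_sym mulf_neq0 ?cK_eq0 //.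
  exact: eta_neq0.
have u0 := jac_neq0l J; have v0 := jac_neq0r J.
(* The pullback of eta is du dv / (u v); clearing denominators leaves an identity between the
   Jacobian and [u * v]. *)
have pres : xF F * yF F * jac u v = cK F delta * (u * v).
  move: h; rewrite /eta pullbV // pullbM // pullb_x // pullb_y //.
  have x0 := xF0 F; have y0 := yF0 F => h.
  transitivity (xF F * yF F * (u * v) * ((u * v)^-1 * jac u v)).
    by field; rewrite u0 v0.
  by rewrite h; field; rewrite x0 y0.
have P0 (g : ratFun F) : g != 0 -> (numden g).1 != 0.
  by apply: contraNneq => e; rewrite [g]numdenE e toFun0 mul0r.
rewrite [u]numdenE [v]numdenE in pres J *.
move: (P0 u u0) (P0 v v0) (den_neq0 u) (den_neq0 v) => p1 p2 q1 q2.
exists (@Tmap R C F (numden u).1 (numden u).2 (numden v).1 (numden v).2); split.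
- exact: Tmap_pl.
- exact: Tmap_lattice.
- exact: Tmap_covering pres.
move=> l pl; have [l' [pl' e hV]] := Tmap_ray R p1 q1 p2 q2 d0 pres pl.
by exists l'; split=> // Q; apply: sharp_imageP.
Qed.

End Geo.

(** * The concrete field C(x, y) as an instance of the interface *)

Module Transfer.
Set Implicit Arguments.
Unset Strict Implicit.
Unset Printing Implicit Defensive.
Local Open Scope quotient_scope.

Lemma pi_Ratio (D : idomainType) (n d : D) : d != 0 ->
  \pi_(FracField.type D) (Ratio n d) = tofrac n / tofrac d.
Proof.
move=> d0; apply: (mulIf (x := tofrac d)); first by rewrite tofrac_eq0.
rewrite mulfVK ?tofrac_eq0 //; unlock tofrac; rewrite -[LHS]FracField.pi_mul.
apply/eqmodP; rewrite /= FracField.equivfE /FracField.mulf /=.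
by rewrite !numden_Ratio ?mulr1 ?mul1r ?oner_neq0 // mulrC.
Qed.


Lemma mnm_subnn n (m : multinom n) : mnm_sub m m = @mnm0 n.
Proof. by apply/mnmP => i; rewrite mnmBE mnm0E subnn. Qed.


Section Instance.
Variable R : realType.
Local Notation C := (Cplx R).
Local Notation K := (funfield R).
Local Notation i0 := (ord0 : 'I_2).
Local Notation i1 := (ord_max : 'I_2).

Lemma ord2P (i : 'I_2) : i = i0 \/ i = i1.
Proof. by case: i => [[|[|[]]]] // p; [left|right]; apply/val_inj. Qed.

Definition Poly2 : idomainType := mpoly 2 C.
Local Notation A := Poly2.
Implicit Types (P Q : A) (u v g : K).

Definition mpoly_cst (c : C) : A := mpolyC 2 c.
Definition mpoly_x : A := mpolyX C (mnm1 i0).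
Definition mpoly_y : A := mpolyX C (mnm1 i1).
Definition frac_pair g : A * A := frac (repr g).
Definition expo2 (m : nat * nat) : multinom 2 := Multinom [tuple m.1; m.2].
Definition pair2 (m : multinom 2) : nat * nat := (m i0, m i1).
Definition coef2 P m : C := mcoeff (expo2 m) P.
Definition supp2 P : seq (nat * nat) := [seq pair2 m | m <- msupp P].

Lemma pair2K : cancel pair2 expo2.
Proof. by move=> m; apply/mnmP => i; case: (ord2P i) => ->; rewrite multinomE /=. Qed.
Lemma expo2K : cancel expo2 pair2.
Proof. by case=> a b; rewrite /pair2 !multinomE. Qed.
Lemma expo2X m : mpolyX C (expo2 m) = mpoly_x ^+ m.1 * mpoly_y ^+ m.2.
Proof.
by rewrite mpolyXE_id big_ord_recl big_ord1 !multinomE /=; congr (_ * _ ^+ _).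
Qed.

Lemma mpoly2_ind (H : A -> Prop) :
  (forall c, H (mpoly_cst c)) -> H mpoly_x -> H mpoly_y ->
  (forall P Q, H P -> H Q -> H (P + Q)) ->
  (forall P Q, H P -> H Q -> H (P * Q)) -> forall P, H P.
Proof.
move=> HC HX HY HD HM P; elim/(@mpolyind 2 C): P => [|c m p _ _ Hp].
  by rewrite -mpolyC0; apply: HC.
have HXn P n : H P -> H (P ^+ n).
  move=> hP; elim: n => [|n IH]; last by rewrite exprS; apply: HM.
  by have := HC 1; rewrite /mpoly_cst mpolyC1.
apply: HD => //; rewrite -mul_mpolyC; apply: (HM); first exact: HC.
by rewrite -(pair2K m) expo2X; apply: HM; apply: HXn.
Qed.

Lemma frac_pair_neq0 g : (frac_pair g).2 != 0.
Proof. exact: denom_ratioP. Qed.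
Lemma frac_pairE g : g = tofrac (frac_pair g).1 / tofrac (frac_pair g).2.
Proof. by rewrite -pi_Ratio ?Ratio_numden ?reprK ?denom_ratioP. Qed.

Lemma mderiv_x0 : mderiv i0 mpoly_x = 1.
Proof. by rewrite mderivX !mnmE /= scale1r mnm_subnn mpolyX0. Qed.
Lemma mderiv_x1 : mderiv i1 mpoly_x = 0.
Proof. by rewrite mderivX !mnmE /= scale0r. Qed.
Lemma mderiv_y0 : mderiv i0 mpoly_y = 0.
Proof. by rewrite mderivX !mnmE /= scale0r. Qed.
Lemma mderiv_y1 : mderiv i1 mpoly_y = 1.
Proof. by rewrite mderivX !mnmE /= scale1r mnm_subnn mpolyX0. Qed.

(** In characteristic 0, differentiation in a variable that occurs in a monomial multiplies its
    coefficient by a nonzero integer. *)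
Lemma mderiv2_eq0 P : mderiv i0 P = 0 -> mderiv i1 P = 0 ->
  P = mpoly_cst (meval (fun=> 0) P).
Proof.
move=> d0 d1.
have e : P = mpoly_cst (mcoeff (@mnm0 2) P).
  apply/mpolyP => m; rewrite mcoeffC.
  have [->|/eqP m0] := eqVneq m (@mnm0 2); first by rewrite mulr1.
  rewrite mulr0.
  have [i mi] : exists i, m i != 0%N.
    case: (eqVneq (m i0) 0%N) => [e0|]; last by exists i0.
    case: (eqVneq (m i1) 0%N) => [e1|]; last by exists i1.
    by case: m0; apply/mnmP => i; rewrite mnm0E; case: (ord2P i) => ->.
  have : mderiv i P = 0 by case: (ord2P i) => ->.
  move/(congr1 (mcoeff (mnm_sub m (mnm1 i)))); rewrite mcoeff_deriv mcoeff0.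
  rewrite submK ?lep1mP // => /eqP; rewrite mulrn_eq0 => /= /eqP //.
by rewrite {2}e mevalC.
Qed.

Lemma msize_mderiv i P : P != 0 -> (mmeasure mdeg (mderiv i P) < mmeasure mdeg P)%N.
Proof.
move=> P0; rewrite (mpolySpred mdeg P0) ltnS /mmeasure.
apply/bigmax_leqP_seq => m; rewrite mcoeff_msupp mcoeff_deriv => mP _.
have : mnm_add m (mnm1 i) \in msupp P.
  by rewrite mcoeff_msupp; apply: contraNneq mP => ->; rewrite mul0rn.
move/(@msize_mdeg_lt 2 C); rewrite mdegD mdeg1 addn1 => h.
by rewrite -ltnS -(mpolySpred mdeg P0).
Qed.

Lemma mem_supp2 P m : (m \in supp2 P) = (coef2 P m != 0).
Proof. by rewrite -[m in LHS]expo2K mem_map ?mcoeff_msupp //; apply: can_inj pair2K. Qed.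

Lemma supp2_uniq P : uniq (supp2 P).
Proof. by rewrite map_inj_uniq ?msupp_uniq //; apply: can_inj pair2K. Qed.

Lemma poly2E P :
  P = \sum_(m <- supp2 P) mpoly_cst (coef2 P m) * (mpoly_x ^+ m.1 * mpoly_y ^+ m.2).
Proof.
rewrite big_map; apply: (etrans (mpolyE P)).
rewrite (@eq_bigr (mpoly 2 C) 0 +%R _ _ _ _ (fun m => mpoly_cst (coef2 P (pair2 m)) * (mpoly_x ^+ (pair2 m).1 * mpoly_y ^+ (pair2 m).2))) // => m _.
by rewrite -expo2X /coef2 pair2K mul_mpolyC.
Qed.

Lemma coef2MX P i j m : coef2 (mpoly_x ^+ i * mpoly_y ^+ j * P) m =
  if (i <= m.1)%N && (j <= m.2)%N then coef2 P (m.1 - i, m.2 - j)%N else 0.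
Proof.
rewrite -(expo2X (i, j)) mulrC /coef2; case: ifP => [/andP[im jm]|h].
  have -> : expo2 m = mnm_add (expo2 (i, j)) (expo2 (m.1 - i, m.2 - j)%N).
    apply/mnmP => k; rewrite mnmDE.
    by case: (ord2P k) => ->; rewrite !multinomE /= subnKC.
  by rewrite mcoeffMX.
apply/eqP; rewrite -[_ == _]negbK -mcoeff_msupp; apply: contraFN h.
rewrite (perm_mem (msuppMX _ _)) => /mapP[k _ /(congr1 pair2)]; rewrite expo2K => ->.
by rewrite /pair2 !mnmDE !multinomE /= !leq_addr.
Qed.

Lemma coef2_1 m : coef2 1 m = (m == (0, 0)%N)%:R.
Proof.
rewrite /coef2 mcoeff1 -(can_eq pair2K) expo2K; congr (_%:R); congr nat_of_bool.
by rewrite /pair2 !mnm0E.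
Qed.

Lemma coef2_dx P i j : coef2 (mderiv i0 P) (i, j) = coef2 P (i.+1, j) *+ i.+1.
Proof.
rewrite /coef2 mcoeff_deriv multinomE /=; congr (mcoeff _ _ *+ _).
apply/mnmP => k; rewrite mnmDE mnm1E.
by case: (ord2P k) => ->; rewrite !multinomE /= ?addn0 ?addn1.
Qed.
Lemma coef2_dy P i j : coef2 (mderiv i1 P) (i, j) = coef2 P (i, j.+1) *+ j.+1.
Proof.
rewrite /coef2 mcoeff_deriv multinomE /=; congr (mcoeff _ _ *+ _).
apply/mnmP => k; rewrite mnmDE mnm1E.
by case: (ord2P k) => ->; rewrite !multinomE /= ?addn0 ?addn1.
Qed.


Lemma tofracM2 : {morph @tofrac A : P Q / P * Q}. Proof. exact: rmorphM. Qed.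
Lemma tofracD2 : {morph @tofrac A : P Q / P + Q}. Proof. exact: rmorphD. Qed.
Lemma mpoly_cstD : {morph mpoly_cst : c d / c + d}. Proof. exact: mpolyCD. Qed.
Lemma mpoly_cstM : {morph mpoly_cst : c d / c * d}. Proof. exact: mpolyCM. Qed.
HB.instance Definition _ :=
  GRing.RMorphism.copy (@constK R) (@tofrac A \o @mpolyC 2 C).
Lemma substD u v : {morph subst u v : P Q / P + Q}.
Proof. by move=> P Q; apply: rmorphD. Qed.
Lemma substM u v : {morph subst u v : P Q / P * Q}.
Proof. by move=> P Q; apply: rmorphM. Qed.
Lemma substC u v c : subst u v (mpoly_cst c) = tofrac (mpoly_cst c).
Proof. exact: mmapC. Qed.
Lemma subst_x u v : subst u v mpoly_x = u.
Proof. by rewrite /subst mmapX mmap1U. Qed.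
Lemma subst_y u v : subst u v mpoly_y = v.
Proof. by rewrite /subst mmapX mmap1U. Qed.

Definition CXY : Geo.ratField C := @Geo.RatField C K A mpoly_cst mpoly_x mpoly_y
  (@tofrac A) frac_pair (fun i : 'I_2 => mderiv i) (@subst R) (meval (fun=> 0))
  (mmeasure mdeg) coef2 supp2 mpoly2_ind frac_pair_neq0 frac_pairE
  mpoly_cstD mpoly_cstM (mpolyC1 2 C) tofracD2 tofracM2 (@tofrac1 A) (@tofrac_eq0 A)
  substD substM substC subst_x subst_y
  (fun P Q => rmorphD (meval (fun=> 0)) P Q) (fun P Q => rmorphM (meval (fun=> 0)) P Q)
  (fun c => mevalC (fun=> 0) c) (mevalXU _ _) (mevalXU _ _)
  (fun i P Q => mderivD i P Q) (fun i P Q => mderivM i P Q) (fun i c => mderivC i c)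
  mderiv_x0 mderiv_x1 mderiv_y0 mderiv_y1 mderiv2_eq0 msize_mderiv mem_supp2
  supp2_uniq poly2E
  (fun P Q m => mcoeffD (expo2 m) P Q) (fun c P m => mcoeffCM c P (expo2 m))
  coef2MX coef2_1 coef2_dx coef2_dy.
End Instance.

(** * Agreement with the definitions of the statement *)

Section Transfer.
Variable R : realType.
Local Notation F := (CXY R).

Lemma x_transfer : Geo.xF F = xK R. Proof. by []. Qed.
Lemma y_transfer : Geo.yF F = yK R. Proof. by []. Qed.
Lemma eta_transfer : Geo.eta F = Defs.eta R.
Proof. by rewrite /Geo.eta x_transfer y_transfer. Qed.
Lemma jac_transfer : Geo.jac (F := F) = @Defs.jacobian R. Proof. by []. Qed.
Lemma form_coef_transfer : Geo.form_coef (F := F) = @form_coef R.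
Proof.
by apply/funext => w; apply/funext => u; apply/funext => v;
  rewrite /Geo.form_coef jac_transfer.
Qed.
Lemma form_vanishes_transfer : Geo.form_vanishes_at (F := F) = @form_vanishes_at R.
Proof. by rewrite /Geo.form_vanishes_at form_coef_transfer. Qed.
Lemma regular_form_transfer : Geo.regular_form_at (F := F) = @regular_form_at R.
Proof. by rewrite /Geo.regular_form_at form_coef_transfer. Qed.
Lemma pole_transfer : Geo.pole (Geo.eta F) = @pole R (Defs.eta R).
Proof. by rewrite /Geo.pole regular_form_transfer eta_transfer. Qed.

(** The two inductive predicates are not convertible, so they are compared by an induction on each
    side. *)
Lemma blowup_tower_transfer (adm : Defs.point R -> Prop) :
  Geo.blowup_tower (F := F) adm = blowup_tower adm.
Proof.
apply/funext => X; apply/propext; split; elim=> {X}.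
- exact: tower_P2.
- by move=> X u v _ T Xo a; apply: (tower_blowup T).
- exact: Geo.tower_P2.
- by move=> X u v _ T Xo a; apply: (Geo.tower_blowup T).
Qed.

Lemma modification_transfer : Geo.modification (F := F) = @modification R.
Proof. exact: blowup_tower_transfer. Qed.
Lemma toric_modification_transfer :
  Geo.toric_modification (F := F) = @toric_modification R.
Proof. exact: blowup_tower_transfer. Qed.
Lemma elaboration_transfer : Geo.elaboration (F := F) = @elaboration R.
Proof.
apply/funext => X; rewrite /Geo.elaboration modification_transfer.
by rewrite form_vanishes_transfer eta_transfer.
Qed.
Lemma is_placed_curve_transfer : Geo.is_placed_curve (F := F) = @is_placed_curve R.
Proof. by apply/funext => X; rewrite /Geo.is_placed_curve elaboration_transfer. Qed.
Lemma equivalent_curves_transfer :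
  Geo.equivalent_curves (F := F) = @equivalent_curves R.
Proof.
by apply/funext => X; apply/funext => Y; rewrite /Geo.equivalent_curves elaboration_transfer.
Qed.
Lemma is_eta_prime_transfer : Geo.is_eta_prime (F := F) = @is_eta_prime R.
Proof.
apply/funext => P; rewrite /Geo.is_eta_prime is_placed_curve_transfer.
by rewrite equivalent_curves_transfer.
Qed.
Lemma is_polar_prime_transfer : Geo.is_polar_prime (F := F) = @is_polar_prime R.
Proof.
by apply/funext => P; rewrite /Geo.is_polar_prime is_eta_prime_transfer pole_transfer.
Qed.
Lemma sharp_image_transfer (f : rational_map R) :
  Geo.sharp_image (F := F) (map_pullback f) = sharp_image f.
Proof.
apply/funext => P; apply/funext => Q.
by rewrite /Geo.sharp_image is_eta_prime_transfer elaboration_transfer.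
Qed.
Lemma limit_ray_transfer P a b : Geo.limit_ray (F := F) P a b <->
  exists X C, [/\ toric_modification X, P (X, C) &
      forall alpha beta : Cplx R, alpha != 0 -> beta != 0 ->
      exists p, [/\ X p, arc_tends_to alpha beta a b p, C p,
        irreducible_component X (X `\` torus R) C &
        forall E, irreducible_component X (X `\` torus R) E -> E p -> E = C]].
Proof. by rewrite /Geo.limit_ray toric_modification_transfer. Qed.
End Transfer.

Lemma pullback_transfer (R : realType) : Geo.pullb (F := CXY R) = @pullback R.
Proof. by []. Qed.

End Transfer.

Theorem theoremE (R : realType) (f : rational_map R) :
  preserves_eta f ->
  exists f_sharp : polar_prime R -> polar_prime R,
    (forall (C : polar_prime R) (Q : set (placed_curve R)),
       sharp_image f (sval C) Q <-> Q = sval (f_sharp C)) /\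
    exists T : R * R -> R * R,
      [/\ piecewise_linear T,
          preserves_lattice T,
          finite_covering (punctured_plane R) (punctured_plane R) T &
          forall (C : polar_prime R) (tau : set (R * R)),
            corresponds (sval C) tau ->
            corresponds (sval (f_sharp C)) (T @` tau)].
Proof.
move=> [_ [delta d0 h]].
have h' : Geo.pullb (F := Transfer.CXY R) (map_x f) (map_y f) (Geo.eta (Transfer.CXY R)) *
    Geo.jac (F := Transfer.CXY R) (map_x f) (map_y f) = Geo.cK (Transfer.CXY R) delta * Geo.eta (Transfer.CXY R).
  by rewrite Transfer.eta_transfer Transfer.pullback_transfer Transfer.jac_transfer.
have [T [T1 T2 T3 T4]] := Geo.tropical_map R d0 h'.
have key (D : polar_prime R) : exists E : polar_prime R,
    (forall Q, sharp_image f (sval D) Q <-> Q = sval E) /\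
    forall tau, corresponds (sval D) tau -> corresponds (sval E) (T @` tau).
  case: D => P /= pP.
  have pP' : Geo.is_polar_prime (F := Transfer.CXY R) P by rewrite Transfer.is_polar_prime_transfer.
  have [l pl eP] := Geo.polar_prime_ex pP'; have [l' [pl' er hs]] := T4 l pl.
  have pE := @Geo.polar_prime_of _ (Transfer.CXY R) l' pl'; rewrite Transfer.is_polar_prime_transfer in pE.
  exists (exist _ (Geo.prime_of (F := Transfer.CXY R) (Geo.V l')) pE); split=> /= [Q|tau [a [b [ab et hX]]]].
    by rewrite eP -Transfer.sharp_image_transfer; exact: hs.
  (* By uniqueness of the limit ray, the ray given by [corresponds] is that of [l], whose image
     under T is known. *)
  have /Transfer.limit_ray_transfer := hX; rewrite eP => /(Geo.limit_ray_uniq pl ab) el.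
  exists l'.1, l'.2; split; first exact: pl'.
    by rewrite et -er -el.
  by apply/Transfer.limit_ray_transfer; apply: Geo.limit_ray_divisor.
have [f_sharp hf] := choice key.
exists f_sharp; split=> [D Q|]; first by have [hf1 _] := hf D; apply: hf1.
exists T; split=> // D tau; have [_ hf2] := hf D; exact: hf2.
Qed.
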